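(* Let $N\ge 1$, $p\in(2,\infty)$, $q_*:=p-\frac{N}{N+1}$, $\eta:=\frac{1}{N(p-2)+p}$, and let $u_0\in W^{1,\infty}(\mathbb{R}^N)$ satisfy $u_0\ge 0$, $u_0\not\equiv 0$, with $\mathrm{supp}\,u_0$ compact in $\mathbb{R}^N$. Let $u$ be the solution to the Cauchy problem $$\partial_t u-\Delta_p u+|\nabla u|^{q_*}=0 \ \text{ in } (0,\infty)\times\mathbb{R}^N,\qquad u(0)=u_0 \ \text{ in } \mathbb{R}^N ,$$ and let $\varrho(t):=\inf\{R>0:\ u(t,x)=0 \text{ for } |x|>R\}$ for $t\ge 0$. Then there exists a positive constant $C_2$, depending only on $p$, $q_*$, $N$ and $u_0$, such that for any $t>0$, $$\varrho(t)\le C_2(1+t)^{\eta}\left(\log(1+t)\right)^{-\eta(p-2)(N+1)}$$ and $$\|u(t)\|_1\le C_2\left(\log(1+t)\right)^{-(N+1)} .$$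
   Context: $\Delta_p u:=\mathrm{div}(|\nabla u|^{p-2}\nabla u)$ is the $p$-Laplacian and $\|\cdot\|_r$ is the norm of $L^r(\mathbb{R}^N)$. ''The solution'' to the Cauchy problem is the unique non-negative viscosity solution $u\in BC([0,\infty)\times\mathbb{R}^N)$ (bounded and continuous); its existence and uniqueness are known, it is also a weak solution, it satisfies $0\le u(t,x)\le\|u_0\|_\infty$ and $\|\nabla u(t)\|_\infty\le\|\nabla u_0\|_\infty$ for all $t\ge 0$, and it is known that $u(t)$ is compactly supported for every $t>0$, so that $\varrho(t)$ is finite. *)

(* Defs.v *)
From HB Require Import structures.
From mathcomp Require Import all_boot all_order all_algebra.
From mathcomp Require Import all_classical all_reals all_analysis.

Set Implicit Arguments.
Unset Strict Implicit.
Unset Printing Implicit Defensive.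

Import Order.TTheory GRing.Theory Num.Theory.
Import numFieldNormedType.Exports.

Local Open Scope classical_set_scope.
Local Open Scope ring_scope.

(* Analysis on R^N takes place on 'rV[R]_N, integration on N.-tuple R, which
   carries the product (= Borel) sigma-algebra; [row_of_tuple] identifies the
   two. *)

Section lebesgue_measure_RN.
Variable R : realType.

Local Notation RR := (measurableTypeR R).

Definition row_of_tuple (N : nat) (v : N.-tuple RR) : 'rV[R]_N :=
  \row_i (tnth v i : R).

Section step.
Variables (n : nat) (m : {sigma_finite_measure set (n.-tuple RR) -> \bar R}).

Definition cons_pair (z : RR * n.-tuple RR) : n.+1.-tuple RR :=
  [tuple of z.1 :: z.2].

Lemma measurable_cons_pair : measurable_fun [set: RR * n.-tuple RR] cons_pair.
Proof. exact: measurable_cons. Qed.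

Definition lebesgue_step : set (n.+1.-tuple RR) -> \bar R :=
  pushforward (lebesgue_measure \x m)%E cons_pair.

Let mu0 : lebesgue_step set0 = 0%E.
Proof. by rewrite /lebesgue_step /pushforward preimage_set0 measure0. Qed.

Let mu_ge0 A : (0 <= lebesgue_step A)%E.
Proof. by rewrite /lebesgue_step /pushforward; exact: measure_ge0. Qed.

Let mu_sigma_additive : semi_sigma_additive lebesgue_step.
Proof.
move=> F mF tF mUF; rewrite /lebesgue_step /pushforward preimage_bigcup.
apply: measure_semi_sigma_additive.
- by move=> k; rewrite -[X in measurable X]setTI; exact: measurable_cons_pair.
- apply/trivIsetP => i j _ _ ij; rewrite -preimage_setI.
  by move/trivIsetP : tF => -> //; rewrite preimage_set0.
- rewrite -preimage_bigcup -[X in measurable X]setTI.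
  exact: measurable_cons_pair.
Qed.

HB.instance Definition _ := isMeasure.Build _ _ _ lebesgue_step
  mu0 mu_ge0 mu_sigma_additive.

Lemma lebesgue_stepE (A : set RR) (B : set (n.-tuple RR)) :
  measurable A -> measurable B ->
  lebesgue_step [set v | A (thead v) /\ B [tuple of behead v]] =
  (lebesgue_measure A * m B)%E.
Proof.
move=> mA mB; rewrite /lebesgue_step /pushforward.
rewrite [X in product_measure1 _ _ X](_ : _ = A `*` B) ?product_measure1E//.
have bcE x (v : n.-tuple RR) : [tuple of behead (cons_pair (x, v))] = v.
  exact/val_inj.
by apply/seteqP; split=> -[x v] /=; rewrite theadE bcE.
Qed.

Let mu_sigma_finite : sigma_finite setT lebesgue_step.
Proof.
have /sigma_finiteP[G [GT Gnd Goo]] := sigma_finiteT m.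
have /sigma_finiteP[H [HT Hnd Hoo]] := sigma_finiteT (@lebesgue_measure R).
exists (fun k => [set v : n.+1.-tuple RR |
  H k (thead v) /\ G k [tuple of behead v]]).
  apply/esym; rewrite -subTset => v _.
  have : [set: RR] (thead v) by [].
  rewrite HT => -[i _ Hi].
  have : [set: n.-tuple RR] [tuple of behead v] by [].
  rewrite GT => -[j _ Gj].
  exists (maxn i j) => //; split.
    by have /subsetPset := Hnd _ _ (leq_maxl i j); apply.
  by have /subsetPset := Gnd _ _ (leq_maxr i j); apply.
move=> k; have [mH Hk] := Hoo k; have [mG Gk] := Goo k; split.
- apply: measurableI.
  + rewrite -[X in measurable X]setTI; exact: (measurable_tnth ord0).
  + rewrite -[X in measurable X]setTI; exact: measurable_behead.
- by rewrite lebesgue_stepE// lte_mul_pinfty// ge0_fin_numE.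
Qed.

HB.instance Definition _ := Measure_isSigmaFinite.Build _ _ _ lebesgue_step
  mu_sigma_finite.

End step.

Fixpoint lebesgueRN (N : nat) :
    {sigma_finite_measure set (N.-tuple RR) -> \bar R} :=
  match N with
  | 0%N => \d_([tuple] : 0.-tuple RR)
  | n.+1 => lebesgue_step (lebesgueRN n)
  end.

Lemma lebesgueRN_box N (A : 'I_N -> set RR) : (forall i, measurable (A i)) ->
  lebesgueRN N [set v | forall i, A i (tnth v i)] =
  (\prod_(i < N) lebesgue_measure (A i))%E.
Proof.
elim: N A => [|n IHn] A mA.
  by rewrite big_ord0 /= diracE mem_set//= => -[].
rewrite big_ord_recl -IHn// -lebesgue_stepE//.
- congr (lebesgueRN n.+1 _); apply/seteqP; split=> v /=.
  + move=> Av; split; first exact: Av.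
    by move=> i; have := Av (lift ord0 i); rewrite [in X in X -> _](tuple_eta v) tnthS.
  + move=> [A0 A1] i; case: (unliftP ord0 i) => [j ->|->]//.
    by rewrite (tuple_eta v) tnthS.
- rewrite (_ : [set _ | _] = \bigcap_(i in [set: 'I_n])
    ((fun v : n.-tuple RR => tnth v i) @^-1` (A (lift ord0 i)))); last first.
    by apply/seteqP; split=> v /= Av i; [move=> _|]; apply: Av.
  apply: fin_bigcap_measurable => // i _.
  by rewrite -[X in measurable X]setTI; exact: measurable_tnth.
Qed.

End lebesgue_measure_RN.

Section space.
Variables (R : realType) (N : nat).
Implicit Types (f g : 'rV[R]_N -> R) (x : 'rV[R]_N).

(* The library norm on 'rV[R]_N is the sup norm. *)
Definition enorm x : R := Num.sqrt (\sum_(i < N) x 0 i ^+ 2).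

Definition basis (i : 'I_N) : 'rV[R]_N := delta_mx 0 i.

Definition partial (i : 'I_N) f : 'rV[R]_N -> R := fun x => 'D_(basis i) f x.

Definition grad f : 'rV[R]_N -> 'rV[R]_N := fun x => \row_i partial i f x.

Definition divergence (F : 'rV[R]_N -> 'rV[R]_N) : 'rV[R]_N -> R :=
  fun x => \sum_(i < N) partial i (fun y => F y 0 i) x.

(* For p > 2 and f of class C^2 the field |grad f|^(p-2) grad f is C^1, also
   at the critical points of f (0 `^ (p - 2) = 0 there). *)
Definition plaplacian (p : R) f : 'rV[R]_N -> R :=
  divergence (fun x => (enorm (grad f x) `^ (p - 2)) *: grad f x).

Definition supp f : set 'rV[R]_N := closure [set x | f x != 0].

Definition smooth f : Prop := forall s : seq 'I_N,
  let g := foldr partial f s in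
  continuous g /\ forall i x, derivable g x (basis i).

Definition test_function f : Prop := smooth f /\ compact (supp f).

Definition Linfty f : Prop :=
  (f \o @row_of_tuple R N) \in Lfun (lebesgueRN R N) +oo%E.

Definition weak_partial (i : 'I_N) f g : Prop :=
  forall phi, test_function phi ->
  (\int[lebesgueRN R N]_v
      (f (row_of_tuple v) * partial i phi (row_of_tuple v))%:E =
   - \int[lebesgueRN R N]_v
      (g (row_of_tuple v) * phi (row_of_tuple v))%:E)%E.

Definition W1infty f : Prop :=
  Linfty f /\ forall i, exists g, Linfty g /\ weak_partial i f g.

Definition L1norm f : \bar R :=
  ('N[lebesgueRN R N]_1[EFin \o f \o @row_of_tuple R N])%E.

End space.

Section evolution.
Variables (R : realType) (N : nat).
Implicit Types (u phi : R -> 'rV[R]_N -> R).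

Definition continuous_pos u : Prop :=
  forall z : R * 'rV[R]_N, 0 < z.1 -> {for z, continuous (fun y => u y.1 y.2)}.

(* C^{1,2}((0,oo) x R^N) *)
Definition C12 phi : Prop :=
  [/\ continuous_pos phi,
      (forall t x, 0 < t -> derivable (phi ^~ x) t 1) /\
        continuous_pos (fun t x => derive1 (phi ^~ x) t),
      forall i, (forall t x, 0 < t -> derivable (phi t) x (basis R i)) /\
        continuous_pos (fun t => partial i (phi t)) &
      forall i j,
        (forall t x, 0 < t -> derivable (partial i (phi t)) x (basis R j)) /\
        continuous_pos (fun t => partial j (partial i (phi t)))].

Definition pde_operator (p q : R) phi (t : R) (x : 'rV[R]_N) : R :=
  derive1 (phi ^~ x) t - plaplacian p (phi t) x + enorm (grad (phi t) x) `^ q.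

Definition viscosity_subsolution (p q : R) u : Prop :=
  forall phi (t : R) (x : 'rV[R]_N), C12 phi -> 0 < t ->
  (\forall z \near (t, x), u z.1 z.2 - phi z.1 z.2 <= u t x - phi t x) ->
  pde_operator p q phi t x <= 0.

Definition viscosity_supersolution (p q : R) u : Prop :=
  forall phi (t : R) (x : 'rV[R]_N), C12 phi -> 0 < t ->
  (\forall z \near (t, x), u t x - phi t x <= u z.1 z.2 - phi z.1 z.2) ->
  0 <= pde_operator p q phi t x.

Definition bounded_continuous u : Prop :=
  {within [set z : R * 'rV[R]_N | 0 <= z.1],
     continuous (fun z : R * 'rV[R]_N => u z.1 z.2)} /\
  exists M : R, forall t x, 0 <= t -> `|u t x| <= M.

(* u represents a function on [0,oo) x R^N; its values at t < 0 are irrelevant. *)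
Definition cauchy_solution (p q : R) (u0 : 'rV[R]_N -> R) u : Prop :=
  [/\ bounded_continuous u,
      forall t x, 0 <= t -> 0 <= u t x,
      viscosity_subsolution p q u,
      viscosity_supersolution p q u &
      forall x, u 0 x = u0 x].

(* Valued in \bar R: +oo when u t is not compactly supported. *)
Definition support_radius u (t : R) : \bar R :=
  ereal_inf [set r%:E | r in
    [set r : R | 0 < r /\ forall x : 'rV[R]_N, r < enorm x -> u t x = 0]].

End evolution.

Definition qstar (R : realType) (N : nat) (p : R) : R := p - N%:R / N.+1%:R.

Definition eta (R : realType) (N : nat) (p : R) : R :=
  (N%:R * (p - 2) + p)^-1.

(* Main.v *)
Require Import Defs.
From mathcomp Require Import all_boot all_order all_algebra.
From mathcomp Require Import all_classical all_reals all_analysis.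
From mathcomp Require Import ring lra.

Import Order.TTheory GRing.Theory Num.Theory.
Import numFieldNormedType.Exports.

Local Open Scope classical_set_scope.
Local Open Scope ring_scope.

Set Implicit Arguments.
Unset Strict Implicit.
Unset Printing Implicit Defensive.

(** The proof compares every solution with one explicit supersolution. For the
    p-Laplacian alone, the compactly supported self-similar solution of Barenblatt
    has amplitude t^(-N eta), radius t^eta and constant mass. At the critical
    exponent the absorption |grad u|^q of this solution is of the order of its
    time derivative, and it reduces the mass M at a rate M^(1 + 1/(N+1)) / t, which
    makes M decay like (log t)^(-(N+1)). Accordingly the barrier is, with
    tau = 2 + t and L = 1 + k ln tau,

      W(t,y) = A ((1 - z) (1 - lam z))_+^((p-1)/(p-2)),  z = (|y| / X)^(p/(p-1)),

    where X is proportional to tau^eta L^(- eta (p-2) (N+1)), A to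
    tau^(- N eta) L^(- p eta (N+1)), and thus A X^N to L^(-(N+1)). For lam = 0 the
    decrease of mass would make W fail to be a supersolution near the center and
    near the edge of the support, since the absorption vanishes there. With
    lam = l0 / L the diffusion has a surplus at both places, of the same order 1/L
    as the decrease of mass; in between the correction has the wrong sign, but
    there absorption, also of order 1/L, compensates it as soon as l0 is small.
    This is [drift_absorption_gt0], which [barrier_operator_gt0] turns into the
    strict inequality of a supersolution.

    A viscosity subsolution must lie below W ([barrier_comparison]). The barrier
    is not C^2 at the center and at the edge of its support, so time and
    space variables are doubled. At a maximum point of the doubled functional
    ([no_doubled_maximum]) the edge causes no trouble because W is flat there, the
    center is impossible because W has a peak there, and elsewhere smooth
    functions that touch the two powers in W ([upper], [lower]) provide a test
    function. The maximum exists because the support of u stays bounded on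
    bounded time intervals ([finite_propagation]), which is the same argument with
    the barrier F (1 + t) |x - c|^(2 K) and without doubling.

    Finally A and X can be taken so large at time 0 that W dominates the initial
    datum ([barrier_large]). Then u vanishes for |x| > X and is at most A, which
    bounds its integral by A (2 X)^N; both estimates follow since L is at least
    k ln (1 + t) ([radius_decay], [mass_decay]). *)

(** * Derivatives along lines and radial functions *)

Section calculus.
Variable R : realType.
Implicit Types (f g : R -> R) (x a df dg : R).

(** The derivative is an argument, so that the rules below compute it while a
    goal is being solved; [dv_eq] then leaves an identity between two formulas.
    *)
Definition has_deriv f x df : Prop := is_derive x 1 f df.

Lemma dv_eq f x df dg : has_deriv f x df -> df = dg -> has_deriv f x dg.
Proof. by move=> h <-. Qed.

Lemma dv_cst a x : has_deriv (fun=> a) x 0.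
Proof. exact: is_derive_cst. Qed.

Lemma dv_id x : has_deriv (fun y : R => y) x 1.
Proof. exact: is_derive_id. Qed.

Lemma dv_add f g x df dg : has_deriv f x df -> has_deriv g x dg ->
  has_deriv (fun y => f y + g y) x (df + dg).
Proof. exact: is_deriveD. Qed.

Lemma dv_opp f x df : has_deriv f x df -> has_deriv (fun y => - f y) x (- df).
Proof. exact: is_deriveN. Qed.

Lemma dv_mul f g x df dg : has_deriv f x df -> has_deriv g x dg ->
  has_deriv (fun y => f y * g y) x (f x * dg + g x * df).
Proof. exact: is_deriveM. Qed.

Lemma dv_exp f n x df : has_deriv f x df ->
  has_deriv (fun y => f y ^+ n) x (n%:R * f x ^+ n.-1 * df).
Proof.
move=> h; rewrite (_ : (fun y => f y ^+ n) = f ^+ n); last first.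
  by apply/funext => y; rewrite fctE.
exact: (is_deriveX n h).
Qed.

Lemma dv_comp f g x df dg : has_deriv f (g x) df -> has_deriv g x dg ->
  has_deriv (fun y => f (g y)) x (df * dg).
Proof. by move=> hf hg; exact: is_derive1_comp. Qed.

Lemma dv_expR f x df : has_deriv f x df ->
  has_deriv (fun y => expR (f y)) x (expR (f x) * df).
Proof. by move=> h; exact: (dv_comp (is_derive_expR _) h). Qed.

Lemma dv_ln f x df : 0 < f x -> has_deriv f x df ->
  has_deriv (fun y => ln (f y)) x ((f x)^-1 * df).
Proof. by move=> fx h; exact: (dv_comp (is_derive1_ln fx) h). Qed.

Lemma dv_powR f c x df : 0 < f x -> has_deriv f x df ->
  has_deriv (fun y => f y `^ c) x (c * f x `^ (c - 1) * df).
Proof.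
by move=> fx h; exact: (dv_comp (is_derive1_powR c fx) h).
Qed.

Lemma dv_inv f x df : f x != 0 -> has_deriv f x df ->
  has_deriv (fun y => (f y)^-1) x (- (f x) ^- 2 * df).
Proof.
move=> fx [hf hd]; split; first exact: derivableV.
by rewrite deriveV// hd.
Qed.

Lemma dv_continuous f x df : has_deriv f x df -> {for x, continuous f}.
Proof.
by case=> h _; apply: differentiable_continuous; apply/derivable1_diffP.
Qed.

End calculus.

Section radial.
Variables (R : realType) (N : nat).
Implicit Types (x v c : 'rV[R]_N) (f : 'rV[R]_N -> R).

Definition sqnorm x : R := \sum_(i < N) x 0 i ^+ 2.

Lemma is_derive_line f x v d :
  has_deriv (fun r : R => f (r *: v + x)) 0 d -> is_derive x v f d.
Proof.
have E : (fun h : R => h^-1 *: ((fun r : R => f (r *: v + x)) (h *: 1 + 0)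
           - f (0 *: v + x))) =
         (fun h : R => h^-1 *: (f (h *: v + x) - f x)).
  by apply/funext => h /=; rewrite addr0 scale0r add0r /GRing.scale /= mulr1.
case=> dg vg; split.
  by move: dg; rewrite /derivable /= E.
by rewrite -vg /derive /= E.
Qed.

Lemma sqnorm_ge0 x : 0 <= sqnorm x.
Proof. by apply: sumr_ge0 => i _; exact: sqr_ge0. Qed.

Lemma sqnorm0 : sqnorm 0 = 0.
Proof. by rewrite /sqnorm big1// => i _; rewrite mxE expr0n. Qed.

Lemma sqnorm_basis x i r :
  sqnorm (r *: Defs.basis R i + x) = sqnorm x + (2 * x 0 i * r + r ^+ 2).
Proof.
rewrite /sqnorm (bigD1 i)//= [in RHS](bigD1 i)//= !mxE !eqxx/= mulr1.
rewrite (eq_bigr (fun j => x 0 j ^+ 2)); last first.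
  by move=> j ji; rewrite !mxE/= (negbTE ji) mulr0 add0r.
by ring.
Qed.

Lemma sqnorm_shift x c i r :
  sqnorm (r *: Defs.basis R i + x - c) =
  sqnorm (x - c) + (2 * (x - c) 0 i * r + r ^+ 2).
Proof. by rewrite -addrA sqnorm_basis. Qed.

Lemma dv_sqnorm_line (a b : R) :
  has_deriv (fun r : R => a + (b * r + r ^+ 2)) 0 b.
Proof.
apply: dv_eq.
  apply: dv_add; first exact: dv_cst.
  apply: dv_add; last exact: dv_exp (dv_id _).
  by apply: dv_mul; [exact: dv_cst|exact: dv_id].
by rewrite /= expr1; ring.
Qed.

(** Radial functions are written as functions of the squared distance to the
    center: that one is a polynomial along every line, so no differentiability
    question arises at the center. *)
Lemma is_derive_radial (h h1 : R -> R) x c i :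
  has_deriv h (sqnorm (x - c)) (h1 (sqnorm (x - c))) ->
  is_derive x (Defs.basis R i) (fun y => h (sqnorm (y - c)))
    (h1 (sqnorm (x - c)) * (2 * (x - c) 0 i)).
Proof.
move=> dh; apply: is_derive_line.
under eq_fun do rewrite sqnorm_shift.
apply: dv_comp; last exact: dv_sqnorm_line.
by rewrite mulr0 expr0n/= !addr0.
Qed.

Lemma is_derive_radial_coord (h : R -> R) x c i j (d : R) :
  has_deriv h (sqnorm (x - c)) d ->
  is_derive x (Defs.basis R j) (fun y => h (sqnorm (y - c)) * (y - c) 0 i)
   (d * (2 * (x - c) 0 j) * (x - c) 0 i + h (sqnorm (x - c)) * (i == j)%:R).
Proof.
move=> dh; apply: is_derive_line.
have -> : (fun r : R => h (sqnorm (r *: Defs.basis R j + x - c)) *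
             (r *: Defs.basis R j + x - c) 0 i) =
          (fun r => h (sqnorm (x - c) + (2 * (x - c) 0 j * r + r ^+ 2)) *
                  (r * (i == j)%:R + (x - c) 0 i)).
  apply/funext => r; rewrite sqnorm_shift; congr (_ * _).
  by rewrite -addrA !mxE.
apply: dv_eq.
  apply: dv_mul.
    apply: dv_comp; last exact: dv_sqnorm_line.
    by rewrite mulr0 expr0n/= !addr0; exact: dh.
  apply: dv_add; last exact: dv_cst.
  by apply: dv_mul; [exact: dv_id|exact: dv_cst].
have -> : sqnorm (x - c) + (2 * (x - c) 0 j * 0 + 0 ^+ 2) = sqnorm (x - c).
  by rewrite mulr0 expr0n/= !addr0.
by ring.
Qed.

Lemma continuous_coordB c i : continuous (fun x => (x - c) 0 i).
Proof.
have -> : (fun x => (x - c) 0 i) = (fun x => x 0 i) - cst (c 0 i).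
  by apply/funext => x; rewrite !mxE.
move=> x; apply: continuousB; first exact: coord_continuous.
exact: cst_continuous.
Qed.

Lemma continuous_sqnorm c : continuous (fun x => sqnorm (x - c)).
Proof.
rewrite /sqnorm; apply: (@continuous_big R) => [|i _]; first exact: add_continuous.
have -> : (fun x => (x - c) 0 i ^+ 2) =
          (fun x => (x - c) 0 i) * (fun x => (x - c) 0 i).
  by apply/funext => x; rewrite expr2.
by move=> x; apply: continuousM; exact: continuous_coordB.
Qed.

End radial.

(** * The equation for radial test functions *)

Section positive_power.
Variable R : realType.

Lemma powR_lt_root (a e s : R) : 0 < a -> 0 < e -> 0 <= s -> s < e `^ a^-1 ->
  s `^ a < e.
Proof.
move=> a0 e0 s0 sd.
have -> : e = (e `^ a^-1) `^ a by rewrite -powRrM mulVf ?gt_eqF// powRr1// ltW.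
by apply: gt0_ltr_powR => //; rewrite nnegrE// powR_ge0.
Qed.

Lemma continuous_pospow (a : R) : 0 < a ->
  continuous (fun s : R => Num.max s 0 `^ a).
Proof.
move=> a0 s; have [s0|s0|->] := ltgtP s 0.
- rewrite /continuous_at max_r ?ltW// powR0 ?gt_eqF//.
  apply: cvg_near_cst; near=> y; rewrite max_r ?powR0 ?gt_eqF//.
  by apply: ltW; near: y; exact: lt_nbhsl.
- have E : \forall y \near s, y `^ a = Num.max y 0 `^ a.
    near=> y; rewrite max_l//.
    by apply: ltW; near: y; exact: (cvgr_gt s cvg_id).
  rewrite /continuous_at max_l ?ltW//.
  apply: cvg_trans; first exact: (near_eq_cvg E).
  exact: (dv_continuous (is_derive1_powR a s0)).
- rewrite /continuous_at max_r// powR0 ?gt_eqF//.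
  apply/cvgrPdist_lt => e e0; rewrite /=.
  near=> y; rewrite sub0r normrN ger0_norm ?powR_ge0//.
  apply: powR_lt_root => //; first by rewrite le_max lexx orbT.
  rewrite gt_max powR_gt0// andbT; near: y.
  by apply: lt_nbhsl; rewrite powR_gt0.
Unshelve. all: by end_near. Qed.

(** The flux of a radial function has the form k(r) r along a line through its
    center, where k is merely continuous because of the exponent p - 2. *)
Lemma dv_mulid (k : R -> R) : {for 0, continuous k} ->
  has_deriv (fun r => k r * r) 0 (k 0).
Proof.
move=> ck.
have L : h^-1 *: ((fun r => k r * r) (h *: (1 : R) + 0) - k 0 * 0)
    @[h --> (0 : R)^'] --> k 0.
  have ck' : k h @[h --> (0 : R)^'] --> k 0.
    exact: cvg_trans (cvg_app _ (@nbhs_dnbhs _ _)) ck.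
  apply: cvg_trans ck'; apply: near_eq_cvg; near=> h.
  rewrite /GRing.scale /= mulr1 addr0 mulr0 subr0 mulrCA mulVf ?mulr1//.
  by near: h; exact: nbhs_dnbhs_neq.
split; first by apply/cvg_ex; exists (k 0).
exact: (cvg_lim _ L).
Unshelve. all: by end_near. Qed.

End positive_power.

Section radial_test_functions.
Variables (R : realType) (N : nat).
Implicit Types (x c : 'rV[R]_N).

Lemma grad_radial (h h1 : R -> R) c y : (forall r, has_deriv h r (h1 r)) ->
  grad (fun y => h (sqnorm (y - c))) y =
  \row_i (h1 (sqnorm (y - c)) * (2 * (y - c) 0 i)).
Proof.
move=> dh; apply/rowP => i; rewrite !mxE /partial.
have H := is_derive_radial (h1 := h1) i (dh (sqnorm (y - c))).
by rewrite (@derive_val _ _ _ _ _ _ _ H) !mxE.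
Qed.

Lemma enorm_grad_radial (h h1 : R -> R) c y : (forall r, has_deriv h r (h1 r)) ->
  enorm (grad (fun y => h (sqnorm (y - c))) y) =
  Num.sqrt (4 * sqnorm (y - c) * h1 (sqnorm (y - c)) ^+ 2).
Proof.
move=> dh; rewrite (grad_radial _ _ dh) /enorm; congr Num.sqrt.
rewrite [in RHS]/sqnorm mulr_sumr mulr_suml; apply: eq_bigr => i _.
by rewrite !mxE; ring.
Qed.

Lemma enorm_grad_radial_powR (h h1 : R -> R) c y a :
  (forall r, has_deriv h r (h1 r)) ->
  enorm (grad (fun y => h (sqnorm (y - c))) y) `^ a =
  (4 * sqnorm (y - c) * h1 (sqnorm (y - c)) ^+ 2) `^ (a / 2).
Proof.
move=> dh; rewrite (enorm_grad_radial _ _ dh).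
rewrite -powR12_sqrt; last first.
  by apply: mulr_ge0; [apply: mulr_ge0 => //; exact: sqnorm_ge0|exact: sqr_ge0].
by rewrite -powRrM [2^-1 * a]mulrC.
Qed.

(** With f(y) = h(|y - c|^2), the flux |grad f|^(p-2) grad f at y equals this
    number times y - c. *)
Definition flux_density (p : R) (h1 : R -> R) (r : R) : R :=
  (4 * r * h1 r ^+ 2) `^ ((p - 2) / 2) * (2 * h1 r).

Lemma flux_radial p (h h1 : R -> R) c : (forall r, has_deriv h r (h1 r)) ->
  forall i,
  (fun y => ((enorm (grad (fun y => h (sqnorm (y - c))) y) `^ (p - 2)) *:
     grad (fun y => h (sqnorm (y - c))) y) 0 i) =
  (fun y => flux_density p h1 (sqnorm (y - c)) * (y - c) 0 i).
Proof.
move=> dh i; apply/funext => y; rewrite mxE (enorm_grad_radial_powR _ _ _ dh).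
by rewrite (grad_radial _ _ dh) mxE /flux_density; ring.
Qed.

Lemma dv_flux_density p (h1 : R -> R) r d : 0 < r -> h1 r != 0 ->
  has_deriv h1 r d ->
  has_deriv (flux_density p h1) r
    (flux_density p h1 r * ((p - 2) / 2 * (r^-1 + 2 * d / h1 r) + d / h1 r)).
Proof.
move=> r0 h0 dh.
have s0 : 0 < 4 * r * h1 r ^+ 2 by apply: mulr_gt0; [exact: mulr_gt0|rewrite exprn_even_gt0].
apply: dv_eq.
  apply: dv_mul.
    apply: dv_powR => //; apply: dv_mul; last by apply: dv_exp; exact: dh.
    by apply: dv_mul; [exact: dv_cst|exact: dv_id].
  by apply: dv_mul; [exact: dv_cst|exact: dh].
rewrite /flux_density /=.
rewrite [_ `^ ((p - 2) / 2 - 1)]powRD; last by rewrite (gt_eqF s0) implybT.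
rewrite powR_inv1 ?ltW//.
set E := _ `^ _; field.
by rewrite h0 gt_eqF.
Qed.

Lemma plaplacian_radial p (h h1 : R -> R) c x d :
  (forall r, has_deriv h r (h1 r)) -> has_deriv h1 (sqnorm (x - c)) d ->
  0 < sqnorm (x - c) -> h1 (sqnorm (x - c)) != 0 ->
  plaplacian p (fun y => h (sqnorm (y - c))) x =
  flux_density p h1 (sqnorm (x - c)) *
   (N%:R + (p - 2) + 2 * (p - 1) * (sqnorm (x - c) * d / h1 (sqnorm (x - c)))).
Proof.
move=> dh dh1 r0 h0; rewrite /plaplacian /divergence.
set r := sqnorm (x - c) in dh1 r0 h0 *; set K := flux_density p h1 r.
set d' := (p - 2) / 2 * (r^-1 + 2 * d / h1 r) + d / h1 r.
transitivity (\sum_(i < N) (K * d' * 2 * (x - c) 0 i ^+ 2 + K)).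
  apply: eq_bigr => i _; rewrite (flux_radial _ _ dh) /partial.
  have H := is_derive_radial_coord i i (dv_flux_density p r0 h0 dh1).
  by rewrite (@derive_val _ _ _ _ _ _ _ H) eqxx mulr1 -/r -/K -/d'; ring.
rewrite big_split/= -mulr_sumr -/(sqnorm (x - c)) -/r.
rewrite sumr_const card_ord -mulr_natr /d'.
by field; rewrite h0 gt_eqF.
Qed.

(** The gradient is O(|y - c|) near the center, so the flux is o(|y - c|)
    because p > 2, and its partial derivatives vanish there. *)
Lemma plaplacian_radial_center p (h h1 : R -> R) c : 2 < p ->
  (forall r, has_deriv h r (h1 r)) -> {for 0, continuous h1} ->
  plaplacian p (fun y => h (sqnorm (y - c))) c = 0.
Proof.
move=> p2 dh ch; rewrite /plaplacian /divergence big1// => i _.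
rewrite (flux_radial _ _ dh) /partial.
set k := (fun r : R => flux_density p h1 (r ^+ 2)).
have k0 : k 0 = 0.
  rewrite /k /flux_density expr0n/= mulr0 mul0r powR0 ?mul0r// gt_eqF//.
  by rewrite divr_gt0// subr_gt0.
suff H : is_derive c (Defs.basis R i)
    (fun y => flux_density p h1 (sqnorm (y - c)) * (y - c) 0 i) (k 0).
  by rewrite (@derive_val _ _ _ _ _ _ _ H).
apply: is_derive_line.
have -> : (fun r : R => flux_density p h1 (sqnorm (r *: Defs.basis R i + c - c)) *
   (r *: Defs.basis R i + c - c) 0 i) = (fun r => k r * r).
  apply/funext => r; rewrite sqnorm_shift addrK subrr sqnorm0 !mxE !eqxx/=.
  by rewrite mulr1 mulr0 mul0r !add0r.
apply: dv_mulid.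
have c2 : {for 0, continuous (fun r : R => r ^+ 2)} by exact: exprn_continuous.
have ch2 : {for 0, continuous (fun r : R => h1 (r ^+ 2))}.
  apply: (@continuous_comp _ _ _ (fun r : R => r ^+ 2) h1) => //.
  by rewrite expr0n.
have cs : {for 0, continuous (fun r : R => 4 * r ^+ 2 * h1 (r ^+ 2) ^+ 2)}.
  apply: continuousM; first by apply: continuousM => //; exact: cst_continuous.
  by apply: (@continuous_comp _ _ _ (fun r : R => h1 (r ^+ 2)) (fun r => r ^+ 2)) => //;
    exact: exprn_continuous.
rewrite /k /flux_density; apply: continuousM; last first.
  by apply: continuousM => //; exact: cst_continuous.
have -> : (fun r : R => (4 * r ^+ 2 * h1 (r ^+ 2) ^+ 2) `^ ((p - 2) / 2)) =
  (fun s : R => Num.max s 0 `^ ((p - 2) / 2)) \o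
  (fun r : R => 4 * r ^+ 2 * h1 (r ^+ 2) ^+ 2).
  apply/funext => r /=; rewrite max_l//.
  by apply: mulr_ge0; [apply: mulr_ge0 => //|]; exact: sqr_ge0.
apply: continuous_comp => //.
by apply: continuous_pospow; rewrite divr_gt0// subr_gt0.
Qed.


Lemma continuous_pos_ext (u v : R -> 'rV[R]_N -> R) :
  (forall t x, 0 < t -> u t x = v t x) -> continuous_pos v -> continuous_pos u.
Proof.
move=> e cv z z0; change (u y.1 y.2 @[y --> z] --> u z.1 z.2); rewrite e//.
apply: cvg_trans (cv z z0); apply: near_eq_cvg; near=> y => /=; rewrite e//.
by near: y; exact: (cvgr_gt z.1 (@cvg_fst _ _ _ _ _)).
Unshelve. all: by end_near. Qed.

(** A function g of time and squared radius with the derivatives that make g(t,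
    |x - c|^2) an admissible test function for any center c. *)
Record profile (g gt g1 g2 : R -> R -> R) : Prop := Profile {
  profile_dt : forall t r, 0 < t -> has_deriv (g^~ r) t (gt t r) ;
  profile_d1 : forall t r, 0 < t -> has_deriv (g t) r (g1 t r) ;
  profile_d2 : forall t r, 0 < t -> has_deriv (g1 t) r (g2 t r) ;
  profile_cont : forall z : R * R, 0 < z.1 ->
    [/\ {for z, continuous (fun y => g y.1 y.2)},
        {for z, continuous (fun y => gt y.1 y.2)},
        {for z, continuous (fun y => g1 y.1 y.2)} &
        {for z, continuous (fun y => g2 y.1 y.2)}] }.

Lemma continuous_pos_radial (k : R -> R -> R) c :
  (forall z : R * R, 0 < z.1 -> {for z, continuous (fun y => k y.1 y.2)}) ->
  continuous_pos (fun t x => k t (sqnorm (x - c))).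
Proof.
move=> ck z z0.
apply: (@continuous_comp _ _ _ (fun y : R * 'rV[R]_N => (y.1, sqnorm (y.2 - c)))
  (fun y => k y.1 y.2)); last exact: ck.
have c1 : (fun y : R * 'rV[R]_N => y.1) @ z --> z.1 by exact: cvg_fst.
have c2 : {for z, continuous (fun y : R * 'rV[R]_N => sqnorm (y.2 - c))}.
  apply: (@continuous_comp (R * 'rV[R]_N)%type 'rV[R]_N R snd (fun y => sqnorm (y - c))).
    exact: cvg_snd.
  exact: continuous_sqnorm.
exact: (cvg_pair c1 c2).
Qed.

Lemma continuous_pos_coord c i : continuous_pos (fun t x => (x - c) 0 i).
Proof.
move=> z z0; apply: (@continuous_comp (R * 'rV[R]_N)%type 'rV[R]_N R snd (fun y => (y - c) 0 i)).
  exact: cvg_snd.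
exact: continuous_coordB.
Qed.

Section profile_theory.
Variables (g gt g1 g2 : R -> R -> R) (c : 'rV[R]_N).
Hypothesis Pg : profile g gt g1 g2.
Let phi t x := g t (sqnorm (x - c)).

Lemma derive1_radial t x : 0 < t -> derive1 (phi ^~ x) t = gt t (sqnorm (x - c)).
Proof.
move=> t0; rewrite derive1E.
have H := profile_dt Pg (sqnorm (x - c)) t0.
by rewrite (@derive_val _ _ _ _ _ _ _ H).
Qed.

Lemma partial_radial t x i : 0 < t ->
  partial i (phi t) x = g1 t (sqnorm (x - c)) * (2 * (x - c) 0 i).
Proof.
move=> t0; have H := is_derive_radial i (profile_d1 Pg (sqnorm (x - c)) t0).
by rewrite /partial (@derive_val _ _ _ _ _ _ _ H).
Qed.

Lemma is_derive_partial_radial t x i j : 0 < t ->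
  is_derive x (Defs.basis R j) (partial i (phi t))
   (2 * g2 t (sqnorm (x - c)) * (2 * (x - c) 0 j) * (x - c) 0 i +
    2 * g1 t (sqnorm (x - c)) * (i == j)%:R).
Proof.
move=> t0.
have -> : partial i (phi t) =
  (fun y => (fun r => 2 * g1 t r) (sqnorm (y - c)) * (y - c) 0 i).
  by apply/funext => y; rewrite partial_radial//; ring.
have H : has_deriv (fun r => 2 * g1 t r) (sqnorm (x - c))
    (2 * g2 t (sqnorm (x - c))).
  apply: dv_eq.
    by apply: dv_mul; [exact: dv_cst|exact: (profile_d2 Pg _ t0)].
  by rewrite mulr0 addr0.
exact: (is_derive_radial_coord i j H).
Qed.

Lemma C12_radial : C12 phi.
Proof.
have Cc := profile_cont Pg.
have K i : continuous_pos (fun (t : R) x => (x - c) 0 i).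
  exact: continuous_pos_coord.
have M (a b : R -> 'rV[R]_N -> R) : continuous_pos a -> continuous_pos b ->
    continuous_pos (fun t x => a t x * b t x).
  by move=> ca cb z z0; apply: continuousM; [exact: ca|exact: cb].
have A (a b : R -> 'rV[R]_N -> R) : continuous_pos a -> continuous_pos b ->
    continuous_pos (fun t x => a t x + b t x).
  by move=> ca cb z z0; apply: continuousD; [exact: ca|exact: cb].
have C k : continuous_pos (fun (t : R) (x : 'rV[R]_N) => k).
  by move=> z z0; exact: cst_continuous.
have G1 : continuous_pos (fun t x => g1 t (sqnorm (x - c))).
  by apply: continuous_pos_radial => z /Cc[].
have G2 : continuous_pos (fun t x => g2 t (sqnorm (x - c))).
  by apply: continuous_pos_radial => z /Cc[].
split.
- by apply: continuous_pos_radial => z /Cc[].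
- split.
    by move=> t x t0; apply: ex_derive; exact: (profile_dt Pg (sqnorm (x - c)) t0).
  apply: (@continuous_pos_ext _ (fun t x => gt t (sqnorm (x - c)))).
    by move=> t x t0; exact: derive1_radial.
  by apply: continuous_pos_radial => z /Cc[].
- move=> i; split.
    move=> t x t0; apply: ex_derive.
    exact: is_derive_radial i (profile_d1 Pg (sqnorm (x - c)) t0).
  apply: (@continuous_pos_ext _
    (fun t x => g1 t (sqnorm (x - c)) * (2 * (x - c) 0 i))).
    by move=> t x t0; exact: partial_radial.
  by apply: (M) => //; apply: (M).
- move=> i j; split.
    by move=> t x t0; apply: ex_derive; exact: is_derive_partial_radial.
  apply: (@continuous_pos_ext _ (fun t x =>
    2 * g2 t (sqnorm (x - c)) * (2 * (x - c) 0 j) * (x - c) 0 i +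
    2 * g1 t (sqnorm (x - c)) * (i == j)%:R)).
    move=> t x t0; have H := is_derive_partial_radial x i j t0.
    by rewrite {1}/partial (@derive_val _ _ _ _ _ _ _ H).
  by apply: (A); repeat apply: (M) => //.
Qed.

Lemma pde_operator_radial p q t x : 0 < t ->
  0 < sqnorm (x - c) -> g1 t (sqnorm (x - c)) != 0 ->
  let r := sqnorm (x - c) in
  pde_operator p q phi t x =
  gt t r - flux_density p (g1 t) r *
   (N%:R + (p - 2) + 2 * (p - 1) * (r * g2 t r / g1 t r)) +
  (4 * r * g1 t r ^+ 2) `^ (q / 2).
Proof.
move=> t0 r0 h0 r; rewrite /pde_operator derive1_radial//.
have d1 s := profile_d1 Pg s t0.
rewrite (plaplacian_radial _ d1 (profile_d2 Pg _ t0))//.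
by rewrite (enorm_grad_radial_powR _ _ _ d1).
Qed.

Lemma pde_operator_radial_center p q t : 2 < p -> q != 0 -> 0 < t ->
  pde_operator p q phi t c = gt t 0.
Proof.
move=> p2 q0 t0; rewrite /pde_operator derive1_radial//.
have d1 s := profile_d1 Pg s t0.
rewrite (plaplacian_radial_center _ p2 d1); last first.
  exact: dv_continuous (profile_d2 Pg 0 t0).
rewrite (enorm_grad_radial_powR _ _ _ d1) subrr sqnorm0 mulr0 mul0r.
rewrite powR0 ?subr0 ?addr0//.
by rewrite mulf_neq0// invr_eq0 pnatr_eq0.
Qed.

End profile_theory.

End radial_test_functions.

(** * The algebraic inequality behind the supersolution *)

Section powR_bounds.
Variable R : realType.
Implicit Types m a l : R.

Lemma powRE_expR m a : 0 < m -> m `^ a = expR (a * ln m).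
Proof. by move=> m0; rewrite /powR gt_eqF. Qed.

Lemma ln_ge_1subV m : 0 < m -> (m - 1) / m <= ln m.
Proof.
move=> m0; have mV0 : 0 < m^-1 by rewrite invr_gt0.
have : ln (1 + (m^-1 - 1)) <= m^-1 - 1 by apply: le_ln1Dx; rewrite ltrBDr; lra.
rewrite [1 + _]addrC subrK lnV ?posrE// => h.
by rewrite mulrBl mul1r divff ?gt_eqF//; lra.
Qed.

Lemma powR_ge_tangent m a : 0 < m -> 0 <= a -> 1 + a * ((m - 1) / m) <= m `^ a.
Proof.
move=> m0 a0; rewrite powRE_expR//; apply: le_trans (expR_ge1Dx _).
by rewrite lerD2l ler_wpM2l// ln_ge_1subV.
Qed.

Lemma powR_le_double m a l : 0 < m -> m <= 1 + l -> 0 <= l -> 0 <= a ->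
  a * l <= 1 / 2 -> m `^ a <= 1 + 2 * (a * l).
Proof.
move=> m0 ml l0 a0 al; rewrite powRE_expR//.
have lm : ln m <= l.
  have h : ln (1 + (m - 1)) <= m - 1 by apply: le_ln1Dx; lra.
  by have e : 1 + (m - 1) = m by [ring]; move: h; rewrite e; lra.
have x0 : 0 <= a * l by rewrite mulr_ge0.
apply: (@le_trans _ _ (expR (a * l))); first by rewrite ler_expR ler_wpM2l.
have := expR_ge1Dx (- (a * l)); rewrite expRN => h.
have e0 := expR_gt0 (a * l).
have : (1 - a * l) * expR (a * l) <= 1.
  by rewrite -ler_pdivlMr// mul1r.
set e := expR _ in e0 *; set x := a * l in x0 al *.
by move=> {}h; nra.
Qed.

End powR_bounds.

Section profile_inequality.
Variables (R : realType) (p n : R).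
Hypotheses (p2 : 2 < p) (n1 : 1 <= n).

(** Minus the z-derivative of [press] is 1 + l - 2 l z, the factor by which the
    correction changes the slope of the profile 1 - z. *)
Definition slope (l z : R) := 1 + l * (1 - 2 * z).
(** The barrier is the power (p-1)/(p-2) of this expression; at l = 0 this is
    the profile of the Barenblatt solution. The factor with l is the correction
    that compensates the loss of mass. *)
Definition press (l z : R) := (1 - z) * (1 - l * z).

(** What time derivative and p-Laplacian of the barrier contribute, up to a
    positive factor, when the logarithm grows at the rate k = l0 / (4 p (N+1)).
    It vanishes for l = 0, because the Barenblatt solution is exact, and is
    therefore of order l. *)
Definition drift (l z : R) :=
  press l z * (n * (slope l z `^ (p - 1) - 1)
    - 2 * p * l * z * slope l z `^ (p - 2) - l / 4) +
  p / (p - 2) * slope l z * z *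
    (1 - (p - 2) * (l / (4 * p)) - slope l z `^ (p - 1)).

Section bounds.
Variables l z : R.
Hypotheses (l0 : 0 < l) (lp : l <= (4 * p)^-1) (z0 : 0 <= z) (z1 : z <= 1).

Local Ltac hyps := move: (p2) (n1) (l0) (z0) (z1) => ? ? ? ? ?.

Let pl : p * l <= 1 / 4.
Proof.
hyps.
have p0 : 0 < 4 * p by lra.
have : 4 * p * l <= 1 by rewrite -ler_pdivlMl// mulr1.
by lra.
Qed.

Let l8 : l <= 1 / 8.
Proof.
hyps.
have : 0 <= (p - 2) * l by rewrite mulr_ge0//; lra.
by have := pl; lra.
Qed.

Let lz0 : 0 <= l * z. Proof. by rewrite mulr_ge0// ltW. Qed.

Let lz1 : l * z <= l. Proof. by rewrite ler_piMr// ltW. Qed.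

Lemma slope_bounds : 1 / 2 <= slope l z <= 2.
Proof.
hyps; move: l8 lz0 lz1 => ? ? ?.
by rewrite /slope; apply/andP; split; lra.
Qed.

Lemma slope_gt0 : 0 < slope l z.
Proof. by have /andP[] := slope_bounds; lra. Qed.

Lemma press_ge0 : 0 <= press l z.
Proof.
hyps; move: l8 lz0 lz1 => ? ? ?.
by rewrite /press mulr_ge0//; lra.
Qed.

Lemma press_le : press l z <= 1 - z.
Proof.
hyps; move: l8 lz0 lz1 => ? ? ?.
by rewrite /press ler_piMr//; lra.
Qed.

Let mp1 : slope l z `^ (p - 1) <= 1 + 2 * ((p - 1) * l).
Proof.
hyps.
have /andP[] := slope_bounds => ? ?.
apply: powR_le_double; rewrite ?slope_gt0//.
- by move: lz0; rewrite /slope; lra.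
- exact: ltW.
- by lra.
- by have := pl; lra.
Qed.

Let mp2 : slope l z `^ (p - 2) <= 2.
Proof.
hyps.
have /andP[] := slope_bounds => ? ?.
apply: (@le_trans _ _ (1 + 2 * ((p - 2) * l))); last by have := pl; lra.
apply: powR_le_double; rewrite ?slope_gt0//.
- by move: lz0; rewrite /slope; lra.
- exact: ltW.
- by lra.
- by have := pl; lra.
Qed.

Let reaction_ge : - (2 * p * l) <=
  1 - (p - 2) * (l / (4 * p)) - slope l z `^ (p - 1).
Proof.
hyps.
have h : (p - 2) * (l / (4 * p)) <= l / 4.
  have -> : l / 4 = p * (l / (4 * p)) by field; lra.
  by rewrite ler_wpM2r ?divr_ge0//; lra.
by have := mp1; lra.
Qed.

Let front_ge : - (4 * p ^+ 2 / (p - 2) * (z * l)) <= p / (p - 2) * slope l z * z *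
    (1 - (p - 2) * (l / (4 * p)) - slope l z `^ (p - 1)).
Proof.
hyps.
have c0 : 0 <= p / (p - 2) by rewrite divr_ge0; lra.
have /andP[s1 s2] := slope_bounds.
have -> : 4 * p ^+ 2 / (p - 2) * (z * l) = p / (p - 2) * (2 * p * l) * (2 * z).
  by field; lra.
move: c0 s1 s2 reaction_ge; set k := p / (p - 2); set s := slope l z.
set r := 1 - _ - _ => k0 s1 s2 hr.
have ksz : 0 <= k * s * z by apply: mulr_ge0 => //; apply: mulr_ge0 => //; lra.
have : k * s * z * - (2 * p * l) <= k * s * z * r by rewrite ler_wpM2l.
have q0 : 0 <= k * (2 * p * l) * z.
  by apply: mulr_ge0 => //; apply: mulr_ge0 => //; apply: mulr_ge0; lra.
have : k * (2 * p * l) * z * s <= k * (2 * p * l) * z * 2 by rewrite ler_wpM2l.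
by lra.
Qed.

Let bulk_ge : - ((2 * n * (p - 1) + 4 * p + 1) * l) <=
  n * (slope l z `^ (p - 1) - 1) - 2 * p * l * z * slope l z `^ (p - 2) - l / 4.
Proof.
hyps.
have h1 : - (2 * l) <= (slope l z - 1) / slope l z.
  have /andP[s1 s2] := slope_bounds; have s0 := slope_gt0.
  have : l * (1 / 2) <= l * slope l z by apply: ler_wpM2l s1; exact: ltW.
  have e : slope l z - 1 = l - 2 * (l * z) by rewrite /slope; ring.
  by move: lz1; rewrite ler_pdivlMr// e; lra.
have h2 : 1 - (p - 1) * (2 * l) <= slope l z `^ (p - 1).
  apply: le_trans (powR_ge_tangent slope_gt0 _); last by lra.
  by rewrite lerD2l -mulrN ler_wpM2l//; lra.
have h3 : 2 * p * l * z * slope l z `^ (p - 2) <= 4 * p * l.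
  have h : z * slope l z `^ (p - 2) <= 2.
    by apply: le_trans mp2; rewrite ler_piMl// powR_ge0.
  have q0 : 0 <= p * l by rewrite mulr_ge0//; lra.
  have -> : 2 * p * l * z * slope l z `^ (p - 2) =
            (2 * (p * l)) * (z * slope l z `^ (p - 2)) by ring.
  have -> : 4 * p * l = (2 * (p * l)) * 2 by ring.
  by rewrite ler_wpM2l// mulr_ge0.
have h4 : - (n * ((p - 1) * (2 * l))) <= n * (slope l z `^ (p - 1) - 1).
  by rewrite -mulrN ler_wpM2l//; lra.
by lra.
Qed.

Lemma drift_ge : - ((2 * n * (p - 1) + 4 * p + 1 + 4 * p ^+ 2 / (p - 2)) * l) <=
  drift l z.
Proof.
hyps.
have := bulk_ge; have := front_ge; rewrite /drift.
set F := p / _ * _ * _ * _; set B := _ - l / 4.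
have c0 : 0 <= 4 * p ^+ 2 / (p - 2).
  by rewrite divr_ge0 ?mulr_ge0 ?sqr_ge0//; lra.
set c := 4 * p ^+ 2 / (p - 2) in c0 *.
have := press_ge0; have := press_le; set P := press l z => P1 P0 hF hB.
have np0 : 0 <= n * (p - 1) by rewrite mulr_ge0//; lra.
have C0 : 0 <= (2 * n * (p - 1) + 4 * p + 1) * l by rewrite mulr_ge0 ?ltW//; lra.
move: C0 hB; set C := (_ + _ + 1) * l => C0 hB.
have hC : - C <= P * B.
  have : P * - C <= P * B by rewrite ler_wpM2l.
  have : P * C <= C by rewrite ler_piMl//; lra.
  by lra.
have hz : c * (z * l) <= c * l by rewrite ler_wpM2l// mulrC.
by rewrite mulrDl -/C; lra.
Qed.

(** Near the center [slope] exceeds 1: the corrected profile is steeper than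
    that of Barenblatt, diffuses more, and this gain of order l dominates. The
    gradient vanishes there, so absorption could not help. *)
Lemma drift_gt0_center : z <= (8 * (1 + 4 * p))^-1 ->
  z <= (p - 2) / (128 * p ^+ 2) -> 0 < drift l z.
Proof.
hyps.
move=> za zb.
have za' : (1 + 4 * p) * z <= 1 / 8.
  have h : 0 < 8 * (1 + 4 * p) by lra.
  have : 8 * (1 + 4 * p) * z <= 1 by rewrite -ler_pdivlMl// mulr1.
  by lra.
have pz : 0 <= p * z by rewrite mulr_ge0//; lra.
have z8 : z <= 1 / 8 by lra.
have lz8 : l * z <= l * (1 / 8) by apply: ler_wpM2l z8; exact: ltW.
have zb' : 4 * p ^+ 2 / (p - 2) * (z * l) <= l / 32.
  have h : 4 * p ^+ 2 / (p - 2) * z <= 1 / 32.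
    have c0 : 0 <= 4 * p ^+ 2 / (p - 2).
      by rewrite divr_ge0 ?mulr_ge0 ?sqr_ge0//; lra.
    apply: le_trans (ler_wpM2l c0 zb) _.
    rewrite le_eqVlt; apply/orP; left; apply/eqP; field.
    by apply/andP; split; lra.
  rewrite mulrA; have := ler_wpM2r (ltW l0) h; lra.
have s1 : 1 <= slope l z by move: lz8; rewrite /slope; lra.
have s2 : slope l z <= 2 by have /andP[] := slope_bounds.
have h1 : l * (1 - 2 * z) / 2 <= (slope l z - 1) / slope l z.
  have h0 : 0 <= l * (1 - 2 * z) / 2 by lra.
  rewrite ler_pdivlMr ?slope_gt0//.
  have -> : slope l z - 1 = l * (1 - 2 * z) by rewrite /slope; ring.
  by have := ler_wpM2l h0 s2; lra.
have h2 : 1 + l * (1 - 2 * z) / 2 <= slope l z `^ (p - 1).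
  apply: le_trans (powR_ge_tangent slope_gt0 _); last by lra.
  rewrite lerD2l; apply: le_trans h1 _; apply: ler_peMl; last by lra.
  by apply: divr_ge0; [lra|exact: ltW slope_gt0].
have h3 : 2 * p * l * z * slope l z `^ (p - 2) <= 4 * p * l * z.
  have q0 : 0 <= p * l * z by rewrite !mulr_ge0//; lra.
  have -> : 2 * p * l * z * slope l z `^ (p - 2) =
            (2 * (p * l * z)) * slope l z `^ (p - 2) by ring.
  have -> : 4 * p * l * z = (2 * (p * l * z)) * 2 by ring.
  by rewrite ler_wpM2l// mulr_ge0.
have h4 : l * (1 - 2 * z) / 2 <= n * (slope l z `^ (p - 1) - 1).
  have h0 : 0 <= l * (1 - 2 * z) / 2 by lra.
  have h5 : 0 <= slope l z `^ (p - 1) - 1 by lra.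
  have : slope l z `^ (p - 1) - 1 <= n * (slope l z `^ (p - 1) - 1).
    by rewrite ler_peMl.
  by lra.
have hB : l / 8 <=
  n * (slope l z `^ (p - 1) - 1) - 2 * p * l * z * slope l z `^ (p - 2) - l / 4.
  have := ler_wpM2l (ltW l0) za'.
  by lra.
have hP : 1 / 2 <= press l z.
  have : (7 / 8) * (1 - z) <= (1 - l * z) * (1 - z).
    by rewrite ler_wpM2r//; move: l8; lra.
  by rewrite /press; lra.
have := front_ge; rewrite /drift; set F := p / _ * _ * _ * _.
move: hB hP; set B := _ - l / 4; set P := press l z => hB hP hF.
have : 1 / 2 * (l / 8) <= P * B by apply: ler_pM => //; lra.
by lra.
Qed.

(** Near the edge of the support [slope] is below 1, so the speed that the flux
    prescribes for the free boundary is less than the speed at which the support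
    of the barrier expands. Here [press] is small, and with it the absorption.
    *)
Lemma drift_gt0_edge : 3 / 4 <= z ->
  (2 * n * (p - 1) + 4 * p + 1) * (1 - z) < 3 / 32 -> 0 < drift l z.
Proof.
hyps.
move=> zc34 zc; rewrite /drift.
have lz34 : l * (3 / 4) <= l * z by apply: ler_wpM2l zc34; exact: ltW.
have s1 : slope l z <= 1 by move: lz34; rewrite /slope; lra.
have s2 : 1 / 2 <= slope l z by have /andP[] := slope_bounds.
have h1 : slope l z `^ (p - 1) <= slope l z.
  by apply: ge1r_powR; rewrite ?slope_gt0//; lra.
have h2 : (p - 2) * (l / (4 * p)) <= l / 4.
  have -> : l / 4 = p * (l / (4 * p)) by field; lra.
  by rewrite ler_wpM2r ?divr_ge0//; lra.
have h3 : l / 4 <= 1 - (p - 2) * (l / (4 * p)) - slope l z `^ (p - 1).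
  have e : slope l z = 1 + l * (1 - 2 * z) by [].
  by move: h1 h2 lz34 e; lra.
have c1 : 1 <= p / (p - 2) by rewrite ler_pdivlMr; lra.
have h4 : 3 / 8 <= p / (p - 2) * slope l z * z.
  have h : 1 / 2 * (3 / 4) <= slope l z * z by apply: ler_pM => //; lra.
  have h' : 0 <= slope l z * z by lra.
  have := ler_wpM2r h' c1; rewrite mulrA; lra.
move: h3; set F := 1 - _ - _ => h3.
have hF : 3 / 8 * (l / 4) <= p / (p - 2) * slope l z * z * F.
  by apply: ler_pM => //; lra.
have := bulk_ge; set B := _ - l / 4.
have := press_ge0; have := press_le; set P := press l z => P1 P0.
have np0 : 0 <= n * (p - 1) by rewrite mulr_ge0//; lra.
move: zc; set C := (_ + _ + 1) => zc hB.
have C0 : 0 <= C by rewrite /C; lra.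
have hPB : - (C * (1 - z) * l) <= P * B.
  have : - (P * (C * l)) <= P * B by rewrite -mulrN ler_wpM2l.
  have : P * (C * l) <= (1 - z) * (C * l).
    by apply: ler_wpM2r => //; apply: mulr_ge0 => //; exact: ltW.
  by lra.
have : C * (1 - z) * l < 3 / 32 * l by rewrite ltr_pM2r.
by lra.
Qed.

End bounds.

End profile_inequality.

Section small_parameter.
Variables (R : realType) (p n : R).
Hypotheses (p2 : 2 < p) (n1 : 1 <= n).

(** The drift is at least - C l everywhere and positive near both ends of (0,1).
    In between, the absorption is bounded below by a multiple of B / L, and l =
    l0 / L has the same decay in L: a small l0 works for all L at once. *)
Lemma drift_absorption_gt0 (B b1 q : R) : 0 < B -> 0 <= b1 -> 0 <= q ->
  exists2 l0 : R, 0 < l0 <= (4 * p)^-1 &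
  forall L z : R, 1 <= L -> 0 < z < 1 ->
  0 < drift p n (l0 / L) z +
      B / L * (press (l0 / L) z `^ b1 * slope (l0 / L) z `^ q * z `^ (q / p)).
Proof.
move=> B0 b10 q0; move: (p2) (n1) => ? ?.
set C1 := 2 * n * (p - 1) + 4 * p + 1.
have np0 : 0 <= n * (p - 1) by rewrite mulr_ge0//; lra.
have C10 : 1 <= C1 by rewrite /C1; lra.
have k0 : 0 <= 4 * p ^+ 2 / (p - 2).
  by rewrite divr_ge0 ?mulr_ge0 ?sqr_ge0//; lra.
set C2 := C1 + 4 * p ^+ 2 / (p - 2).
have C20 : 1 <= C2 by rewrite /C2; lra.
pose z1 := Num.min (8 * (1 + 4 * p))^-1 ((p - 2) / (128 * p ^+ 2)).
have z10 : 0 < z1.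
  rewrite /z1 lt_min invr_gt0; apply/andP; split; first by lra.
  by rewrite divr_gt0 ?mulr_gt0 ?exprn_gt0//; lra.
pose d := (16 * C1)^-1.
have d0 : 0 < d by rewrite invr_gt0; lra.
have dC : C1 * d = 1 / 16 by rewrite /d; field; lra.
have d1 : d <= 1 / 16.
  by have : 1 * d <= C1 * d by [rewrite ler_wpM2r// ltW]; lra.
pose c := (d / 2) `^ b1 * (1 / 2) `^ q * z1 `^ (q / p).
have c0 : 0 < c by rewrite !mulr_gt0// powR_gt0//; lra.
pose l0 := Num.min (4 * p)^-1 (B * c / (2 * C2)).
have l00 : 0 < l0.
  rewrite lt_min invr_gt0; apply/andP; split; first by lra.
  by apply: divr_gt0; [exact: mulr_gt0|lra].
have l0p : l0 <= (4 * p)^-1 by rewrite ge_min lexx.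
have l0c : l0 * C2 < B * c.
  have : l0 <= B * c / (2 * C2) by rewrite ge_min lexx orbT.
  rewrite ler_pdivlMr; last by lra.
  have : 0 < B * c by rewrite mulr_gt0.
  by lra.
exists l0; first by rewrite l00.
move=> L z L1 /andP[zp zl]; have L0 : 0 < L by lra.
set l := l0 / L.
have lp : 0 < l by rewrite divr_gt0.
have ll : l <= (4 * p)^-1.
  by apply: le_trans l0p; rewrite ler_pdivrMr// ler_peMr// ltW.
have abs0 : 0 <= B / L * (press l z `^ b1 * slope l z `^ q * z `^ (q / p)).
  apply: mulr_ge0; first by apply: divr_ge0; exact: ltW.
  by rewrite !mulr_ge0 ?powR_ge0.
(* Center, then edge, then the region where the absorption is bounded below. *)
have [zz1|zz1] := leP z z1.
  move: zz1; rewrite le_min => /andP[za zb].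
  by rewrite ltr_pwDl//; apply: drift_gt0_center => //; exact: ltW.
have [zd|zd] := ltP (1 - z) d.
  have zC : C1 * (1 - z) <= C1 * d.
    by apply: ler_wpM2l; [lra|exact: ltW].
  rewrite ltr_pwDl//; apply: drift_gt0_edge => //; try exact: ltW; try lra.
  by rewrite -/C1; lra.
have D : - (C2 * l) <= drift p n l z by apply: drift_ge => //; exact: ltW.
have A : B / L * c <= B / L * (press l z `^ b1 * slope l z `^ q * z `^ (q / p)).
  apply: ler_wpM2l; first by apply: divr_ge0; exact: ltW.
  have l8 : l <= 1 / 8.
    apply: le_trans ll _; rewrite -[1 / 8]invf_div divr1 lef_pV2 ?posrE; lra.
  have /andP[sl _] := slope_bounds p2 n1 lp ll (ltW zp) (ltW zl).
  have P0 := press_ge0 p2 n1 lp ll (ltW zp) (ltW zl).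
  have P1 : d / 2 <= press l z.
    have lz8 : l * z <= 1 / 8 * 1 by apply: ler_pM => //; exact: ltW.
    have : (1 - z) * (1 / 2) <= (1 - z) * (1 - l * z).
      by rewrite ler_wpM2l//; lra.
    by rewrite /press; lra.
  apply: ler_pM; rewrite ?mulr_ge0 ?powR_ge0//.
    apply: ler_pM; rewrite ?powR_ge0//.
      by apply: ge0_ler_powR; rewrite ?nnegrE//; lra.
    by apply: ge0_ler_powR; rewrite ?nnegrE//; lra.
  apply: ge0_ler_powR; rewrite ?nnegrE; [|exact: ltW..].
  by apply: divr_ge0; lra.
have : C2 * l < B / L * c.
  have -> : C2 * l = l0 * C2 / L by rewrite /l; ring.
  have -> : B / L * c = B * c / L by ring.
  by rewrite ltr_pM2r ?invr_gt0.
by lra.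
Qed.

End small_parameter.

(** * Joint continuity and composite radial profiles *)

Section joint_continuity.
Variables (R : realType) (T : topologicalType).
Implicit Types (f g : T -> R) (h : R -> R) (z : T).

(** A name for pointwise continuity, so that the combinators below determine
    their function arguments by unification. *)
Definition cont_at f z : Prop := {for z, continuous f}.

Lemma ca_cst (c : R) z : cont_at (fun=> c) z.
Proof. exact: cst_continuous. Qed.

Lemma ca_add f g z : cont_at f z -> cont_at g z -> cont_at (fun y => f y + g y) z.
Proof. by move=> cf cg; exact: continuousD. Qed.

Lemma ca_opp f z : cont_at f z -> cont_at (fun y => - f y) z.
Proof. by move=> cf; exact: continuousN. Qed.

Lemma ca_mul f g z : cont_at f z -> cont_at g z -> cont_at (fun y => f y * g y) z.
Proof. by move=> cf cg; exact: continuousM. Qed.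

Lemma ca_exp f n z : cont_at f z -> cont_at (fun y => f y ^+ n) z.
Proof.
move=> cf; apply: (@continuous_comp _ _ _ f (fun r => r ^+ n)) => //.
exact: exprn_continuous.
Qed.

Lemma ca_comp h f z : {for f z, continuous h} -> cont_at f z ->
  cont_at (fun y => h (f y)) z.
Proof. by move=> ch cf; exact: (@continuous_comp _ _ _ f h). Qed.

End joint_continuity.

Section composite_profile.
Variable R : realType.
Variables (A A' y y' l l' pen pen' E E1 E2 U U1 U2 : R -> R).
Hypotheses
  (dA : forall t, 0 < t -> has_deriv A t (A' t))
  (dy : forall t, 0 < t -> has_deriv y t (y' t))
  (dl : forall t, 0 < t -> has_deriv l t (l' t))
  (dpen : forall t, 0 < t -> has_deriv pen t (pen' t))
  (cA' : forall t, 0 < t -> {for t, continuous A'})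
  (cy' : forall t, 0 < t -> {for t, continuous y'})
  (cl' : forall t, 0 < t -> {for t, continuous l'})
  (cpen' : forall t, 0 < t -> {for t, continuous pen'})
  (dE : forall r, has_deriv E r (E1 r))
  (dE1 : forall r, has_deriv E1 r (E2 r))
  (cE2 : continuous E2)
  (dU : forall r, has_deriv U r (U1 r))
  (dU1 : forall r, has_deriv U1 r (U2 r))
  (cU2 : continuous U2).

Let Z t r := y t * E r.
Let Q t r := press (l t) (Z t r).

(** The shape of the test functions below: A, y and l are the amplitude, the
    inverse scale and the correction of the barrier, E and U stand for smooth
    replacements of the two non-smooth powers, and pen is a function of time. *)
Definition composite t r := A t * U (press (l t) (y t * E r)) + pen t.

Definition composite_t t r :=
  A' t * U (Q t r) +
  A t * (U1 (Q t r) * (- (slope (l t) (Z t r) * (y' t * E r)) -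
                       Z t r * (1 - Z t r) * l' t)) + pen' t.

Definition composite_1 t r :=
  A t * (U1 (Q t r) * - (slope (l t) (Z t r) * (y t * E1 r))).

Definition composite_2 t r :=
  A t * (U2 (Q t r) * (slope (l t) (Z t r) * (y t * E1 r)) ^+ 2 +
         U1 (Q t r) * (2 * l t * (y t * E1 r) ^+ 2 -
                       slope (l t) (Z t r) * (y t * E2 r))).

Lemma profile_composite :
  profile composite composite_t composite_1 composite_2.
Proof.
split.
- move=> t r t0; apply: dv_eq.
    apply: dv_add; last exact: dpen.
    apply: dv_mul; first exact: dA.
    apply: dv_comp; first exact: dU.
    rewrite /press; apply: dv_mul.
      apply: dv_add; first exact: dv_cst.
      by apply: dv_opp; apply: dv_mul; [exact: dy|exact: dv_cst].
    apply: dv_add; first exact: dv_cst.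
    apply: dv_opp; apply: dv_mul; first exact: dl.
    by apply: dv_mul; [exact: dy|exact: dv_cst].
  by rewrite /composite_t /Q /Z /press /slope /=; ring.
- move=> t r t0; apply: dv_eq.
    apply: dv_add; last exact: dv_cst.
    apply: dv_mul; first exact: dv_cst.
    apply: dv_comp; first exact: dU.
    rewrite /press; apply: dv_mul.
      apply: dv_add; first exact: dv_cst.
      by apply: dv_opp; apply: dv_mul; [exact: dv_cst|exact: dE].
    apply: dv_add; first exact: dv_cst.
    apply: dv_opp; apply: dv_mul; first exact: dv_cst.
    by apply: dv_mul; [exact: dv_cst|exact: dE].
  by rewrite /composite_1 /Q /Z /press /slope /=; ring.
- move=> t r t0; apply: dv_eq.
    apply: dv_mul; first exact: dv_cst.
    apply: dv_mul.
      apply: dv_comp; first exact: dU1.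
      rewrite /Q /Z /press; apply: dv_mul.
        apply: dv_add; first exact: dv_cst.
        by apply: dv_opp; apply: dv_mul; [exact: dv_cst|exact: dE].
      apply: dv_add; first exact: dv_cst.
      apply: dv_opp; apply: dv_mul; first exact: dv_cst.
      by apply: dv_mul; [exact: dv_cst|exact: dE].
    apply: dv_opp; rewrite /slope /Z; apply: dv_mul.
      apply: dv_add; first exact: dv_cst.
      apply: dv_mul; first exact: dv_cst.
      apply: dv_add; first exact: dv_cst.
      apply: dv_opp; apply: dv_mul; first exact: dv_cst.
      by apply: dv_mul; [exact: dv_cst|exact: dE].
    by apply: dv_mul; [exact: dv_cst|exact: dE1].
  by rewrite /composite_2 /Q /Z /press /slope /=; ring.
- move=> z z0.
  have F (h : R -> R) : {for z.1, continuous h} ->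
      cont_at (fun v : R * R => h v.1) z.
    by move=> ch; apply: (ca_comp (f := fst)) => //; exact: cvg_fst.
  have S (h : R -> R) : {for z.2, continuous h} ->
      cont_at (fun v : R * R => h v.2) z.
    by move=> ch; apply: (ca_comp (f := snd)) => //; exact: cvg_snd.
  have kA := F _ (dv_continuous (dA z0)).
  have kA' := F _ (cA' z0).
  have ky := F _ (dv_continuous (dy z0)).
  have ky' := F _ (cy' z0).
  have kl := F _ (dv_continuous (dl z0)).
  have kl' := F _ (cl' z0).
  have kp := F _ (dv_continuous (dpen z0)).
  have kp' := F _ (cpen' z0).
  have kE := S _ (dv_continuous (dE z.2)).
  have kE1 := S _ (dv_continuous (dE1 z.2)).
  have kE2 := S _ (cE2 (x := z.2)).
  have kZ : cont_at (fun v : R * R => Z v.1 v.2) z by exact: ca_mul.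
  have k1 := @ca_cst R _ 1 z; have k2 := @ca_cst R _ 2 z.
  have kQ : cont_at (fun v : R * R => Q v.1 v.2) z.
    apply: ca_mul; first by apply: ca_add => //; exact: ca_opp.
    by apply: ca_add => //; apply: ca_opp; exact: ca_mul.
  have ks : cont_at (fun v : R * R => slope (l v.1) (Z v.1 v.2)) z.
    apply: ca_add => //; apply: ca_mul => //; apply: ca_add => //.
    by apply: ca_opp; exact: ca_mul.
  have kU : cont_at (fun v : R * R => U (Q v.1 v.2)) z.
    by apply: (ca_comp (h := U)) => //; exact: dv_continuous (dU _).
  have kU1 : cont_at (fun v : R * R => U1 (Q v.1 v.2)) z.
    by apply: (ca_comp (h := U1)) => //; exact: dv_continuous (dU1 _).
  have kU2 : cont_at (fun v : R * R => U2 (Q v.1 v.2)) z.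
    by apply: (ca_comp (h := U2)) => //; exact: cU2.
  split.
  + exact: (ca_add (ca_mul kA kU) kp).
  + apply: (ca_add (ca_add (ca_mul kA' kU) (ca_mul kA (ca_mul kU1
      (ca_add (ca_opp (ca_mul ks (ca_mul ky' kE))) (ca_opp (ca_mul
        (ca_mul kZ (ca_add k1 (ca_opp kZ))) kl')))))) kp').
  + exact: (ca_mul kA (ca_mul kU1 (ca_opp (ca_mul ks (ca_mul ky kE1))))).
  + exact: (ca_mul kA (ca_add
      (ca_mul kU2 (ca_exp (n := 2) (ca_mul ks (ca_mul ky kE1))))
      (ca_mul kU1 (ca_add (ca_mul (ca_mul k2 kl) (ca_exp (n := 2) (ca_mul ky kE1)))
         (ca_opp (ca_mul ks (ca_mul ky kE2))))))).
Qed.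

End composite_profile.

(** * Smooth functions touching a power at one point *)

Section log_touching.
Variable R : realType.
Implicit Types (f df : R -> R) (a c u v x y : R).

(** Mean value theorem, for a and u in either order. *)
Lemma ge_by_deriv f df a u :
  (forall c, Num.min a u <= c <= Num.max a u ->
     has_deriv f c (df c) /\ 0 <= df c * (u - a)) ->
  f a <= f u.
Proof.
move=> H.
have key x y : x <= y -> Num.min a u = x -> Num.max a u = y ->
    exists2 c, x <= c <= y & f y - f x = df c * (y - x).
  move=> xy ex ey.
  have [||c] := @MVT_segment R f df x y xy.
  - by move=> c; rewrite in_itv/= => /andP[c1 c2]; apply: (H c _).1;
      rewrite ex ey !ltW.
  - apply: derivable_within_continuous => c; rewrite in_itv/= => cxy.
    by apply: ex_derive; apply: (H c _).1; rewrite ex ey.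
  - by rewrite in_itv/= => cxy e; exists c.
have [au|/ltW ua] := leP a u.
  have m1 := min_l au; have m2 := max_r au.
  have [c cc e] := key a u au m1 m2.
  by rewrite -subr_ge0 e; apply: (H c _).2; rewrite m1 m2.
have m1 := min_r ua; have m2 := max_l ua.
have [c cc e] := key u a ua m1 m2.
rewrite -subr_ge0 -opprB e -mulrN opprB.
by apply: (H c _).2; rewrite m1 m2.
Qed.

Lemma between_mul_ge0 c u : Num.min 0 u <= c <= Num.max 0 u -> 0 <= c * u.
Proof.
have [u0|u0] := leP 0 u => /andP[c1 c2].
  by rewrite mulr_ge0.
by rewrite mulr_le0// ltW.
Qed.

(** Third and fourth order Taylor polynomials of ln (1 + u), the second with a
    last coefficient large enough to make it a lower bound for |u| <= 1/2. The
    cubic is increasing on the whole line, which the touching argument needs. *)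
Definition cubic u : R := u - u ^+ 2 / 2 + u ^+ 3 / 3.
Definition quartic u : R := cubic u - u ^+ 4.

Lemma dv_ln1D c : -1 < c -> has_deriv (fun v => ln (1 + v)) c (1 + c)^-1.
Proof.
move=> c1; have c0 : 0 < 1 + c by lra.
have h : has_deriv (fun v => 1 + v) c (0 + 1).
  by apply: dv_add; [exact: dv_cst|exact: dv_id].
by apply: dv_eq (dv_ln c0 h) _; rewrite add0r mulr1.
Qed.

Lemma dv_cubic c : has_deriv cubic c (1 - c + c ^+ 2).
Proof.
apply: dv_eq; rewrite /cubic.
  apply: dv_add.
    apply: dv_add; first exact: dv_id.
    apply: dv_opp; apply: dv_mul; last exact: dv_cst.
    by apply: dv_exp; exact: dv_id.
  apply: dv_mul; last exact: dv_cst.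
  by apply: dv_exp; exact: dv_id.
by rewrite /=; field.
Qed.

Lemma dv_quartic c : has_deriv quartic c (1 - c + c ^+ 2 - 4 * c ^+ 3).
Proof.
apply: dv_eq; rewrite /quartic.
  apply: dv_add; first exact: dv_cubic.
  by apply: dv_opp; apply: dv_exp; exact: dv_id.
by rewrite /=; ring.
Qed.

Lemma ln_le_cubic u : -1 < u -> ln (1 + u) <= cubic u.
Proof.
move=> u1; rewrite -subr_ge0.
have -> : 0 = cubic 0 - ln (1 + 0).
  by rewrite (addr0 1) ln1 /cubic !expr0n/= !mul0r !(subr0, addr0).
apply: (@ge_by_deriv (fun v => cubic v - ln (1 + v))
         (fun c => 1 - c + c ^+ 2 - (1 + c)^-1)) => c.
rewrite subr0 => cu; have cu0 := between_mul_ge0 cu.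
move: cu; rewrite ge_min le_max => /andP[c1 c2].
have cm : -1 < c by have [] := orP c1; lra.
have c0 : 0 < 1 + c by lra.
split.
  by apply: dv_add; [exact: dv_cubic|apply: dv_opp; exact: dv_ln1D].
have -> : 1 - c + c ^+ 2 - (1 + c)^-1 = c ^+ 2 * (c / (1 + c)) by field; lra.
rewrite -mulrA mulr_ge0 ?sqr_ge0// mulrAC.
by apply: divr_ge0 => //; exact: ltW.
Qed.

Lemma ln_ge_quartic u : - (1 / 2) <= u <= 1 / 2 -> quartic u <= ln (1 + u).
Proof.
move=> /andP[u1 u2]; rewrite -subr_ge0.
have -> : 0 = ln (1 + 0) - quartic 0.
  by rewrite (addr0 1) ln1 /quartic /cubic !expr0n/= !mul0r !(subr0, addr0).
apply: (@ge_by_deriv (fun v => ln (1 + v) - quartic v)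
         (fun c => (1 + c)^-1 - (1 - c + c ^+ 2 - 4 * c ^+ 3))) => c.
rewrite subr0 => cu; have cu0 := between_mul_ge0 cu.
move: cu; rewrite ge_min le_max => /andP[c1 c2].
have cm : - (1 / 2) <= c by have [] := orP c1; lra.
have c0 : 0 < 1 + c by lra.
split.
  by apply: dv_add; [apply: dv_ln1D; lra|apply: dv_opp; exact: dv_quartic].
have -> : (1 + c)^-1 - (1 - c + c ^+ 2 - 4 * c ^+ 3) =
          c ^+ 2 * (c * ((3 + 4 * c) / (1 + c))) by field; lra.
rewrite -mulrA mulr_ge0 ?sqr_ge0// mulrAC; apply: mulr_ge0 => //.
by apply: divr_ge0; lra.
Qed.

Lemma cubic_homo u v : u <= v -> cubic u <= cubic v.
Proof.
move=> uv; apply: (ge_by_deriv (df := fun c => 1 - c + c ^+ 2)) => c _.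
split; first exact: dv_cubic.
by rewrite mulr_ge0 ?subr_ge0//; nra.
Qed.

Section touching.
Variables (b x0 : R).
Hypotheses (x00 : 0 < x0).
Let u (x : R) := (x - x0) / x0.

Let xE x : x = x0 * (1 + u x).
Proof. by rewrite /u; field; rewrite gt_eqF. Qed.

(** A function that is smooth on the whole line and touches x^b from above at
    x0, with the same first two derivatives. The barrier is singular at the
    center and at the edge of its support, whereas a test function must be C^2
    on all of space: the two powers in the barrier are replaced by such
    functions. *)
Definition upper x := expR (b * (ln x0 + cubic (u x))).
Definition upper1 x := upper x * (b * (1 - u x + u x ^+ 2) / x0).
Definition upper2 x := upper x *
  ((b * (1 - u x + u x ^+ 2) / x0) ^+ 2 + b * (2 * u x - 1) / x0 ^+ 2).

(** The same from below, on a neighbourhood of x0 only. *)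
Definition lower x := expR (b * (ln x0 + quartic (u x))).
Definition lower1 x := lower x * (b * (1 - u x + u x ^+ 2 - 4 * u x ^+ 3) / x0).
Definition lower2 x := lower x *
  ((b * (1 - u x + u x ^+ 2 - 4 * u x ^+ 3) / x0) ^+ 2 +
   b * (2 * u x - 1 - 12 * u x ^+ 2) / x0 ^+ 2).

Let dv_u x : has_deriv u x x0^-1.
Proof.
apply: dv_eq.
  apply: dv_mul; last exact: dv_cst.
  by apply: dv_add; [exact: dv_id|exact: dv_cst].
by rewrite mulr0 add0r addr0 mulr1.
Qed.

Lemma dv_upper x : has_deriv upper x (upper1 x).
Proof.
apply: dv_eq.
  apply: dv_expR; apply: dv_mul; first exact: dv_cst.
  apply: dv_add; first exact: dv_cst.
  by apply: dv_comp; [exact: dv_cubic|exact: dv_u].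
by rewrite /upper1 /upper; ring.
Qed.

Lemma dv_upper1 x : has_deriv upper1 x (upper2 x).
Proof.
apply: dv_eq.
  apply: dv_mul; first exact: dv_upper.
  apply: dv_mul; last exact: dv_cst.
  apply: dv_mul; first exact: dv_cst.
  apply: dv_add; last by apply: dv_exp; exact: dv_u.
  by apply: dv_add; [exact: dv_cst|apply: dv_opp; exact: dv_u].
by rewrite /upper2 /upper1 /=; field; rewrite gt_eqF.
Qed.

Lemma dv_lower x : has_deriv lower x (lower1 x).
Proof.
apply: dv_eq.
  apply: dv_expR; apply: dv_mul; first exact: dv_cst.
  apply: dv_add; first exact: dv_cst.
  by apply: dv_comp; [exact: dv_quartic|exact: dv_u].
by rewrite /lower1 /lower; ring.
Qed.

Lemma dv_lower1 x : has_deriv lower1 x (lower2 x).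
Proof.
apply: dv_eq.
  apply: dv_mul; first exact: dv_lower.
  apply: dv_mul; last exact: dv_cst.
  apply: dv_mul; first exact: dv_cst.
  apply: dv_add; last first.
    by apply: dv_opp; apply: dv_mul; [exact: dv_cst|apply: dv_exp; exact: dv_u].
  apply: dv_add; last by apply: dv_exp; exact: dv_u.
  by apply: dv_add; [exact: dv_cst|apply: dv_opp; exact: dv_u].
by rewrite /lower2 /lower1 /=; field; rewrite gt_eqF.
Qed.

Let cu x : cont_at u x. Proof. exact: dv_continuous (dv_u x). Qed.

Lemma continuous_upper2 : continuous upper2.
Proof.
move=> x; have c1 := @ca_cst R _ 1 x; have c2 := @ca_cst R _ 2 x.
have cb := @ca_cst R _ b x; have ci := @ca_cst R _ x0^-1 x.
have ci2 := @ca_cst R _ (x0 ^+ 2)^-1 x.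
have cp : cont_at upper x by exact: dv_continuous (dv_upper x).
have kx := @cu x.
exact: (ca_mul cp (ca_add (ca_exp (n := 2) (ca_mul (ca_mul cb
  (ca_add (ca_add c1 (ca_opp kx)) (ca_exp (n := 2) kx))) ci))
  (ca_mul (ca_mul cb (ca_add (ca_mul c2 kx) (ca_opp c1))) ci2))).
Qed.

Lemma continuous_lower2 : continuous lower2.
Proof.
move=> x; have c1 := @ca_cst R _ 1 x; have c2 := @ca_cst R _ 2 x.
have c4 := @ca_cst R _ 4 x; have c12 := @ca_cst R _ 12 x.
have cb := @ca_cst R _ b x; have ci := @ca_cst R _ x0^-1 x.
have ci2 := @ca_cst R _ (x0 ^+ 2)^-1 x.
have cp : cont_at lower x by exact: dv_continuous (dv_lower x).
have kx := @cu x.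
exact: (ca_mul cp (ca_add (ca_exp (n := 2) (ca_mul (ca_mul cb
  (ca_add (ca_add (ca_add c1 (ca_opp kx)) (ca_exp (n := 2) kx))
    (ca_opp (ca_mul c4 (ca_exp (n := 3) kx))))) ci))
  (ca_mul (ca_mul cb (ca_add (ca_add (ca_mul c2 kx) (ca_opp c1))
    (ca_opp (ca_mul c12 (ca_exp (n := 2) kx))))) ci2))).
Qed.

Let u0 : u x0 = 0. Proof. by rewrite /u subrr mul0r. Qed.

Lemma upperE : upper x0 = x0 `^ b.
Proof.
by rewrite /upper u0 /cubic !expr0n/= !mul0r !addr0 subr0 addr0 powRE_expR.
Qed.

Lemma upper1E : upper1 x0 = x0 `^ b * b / x0.
Proof. by rewrite /upper1 upperE u0 expr0n/= subr0 addr0 mulr1 mulrA. Qed.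

Lemma upper2E : upper2 x0 = x0 `^ b * (b * (b - 1)) / x0 ^+ 2.
Proof.
by rewrite /upper2 upperE u0 expr0n/=; field; rewrite gt_eqF.
Qed.

Lemma lowerE : lower x0 = x0 `^ b.
Proof.
by rewrite /lower u0 /quartic /cubic !expr0n/= !mul0r !addr0 !subr0 !addr0 powRE_expR.
Qed.

Lemma lower1E : lower1 x0 = x0 `^ b * b / x0.
Proof.
by rewrite /lower1 lowerE u0 !expr0n/= mulr0 !subr0 addr0 mulr1 mulrA.
Qed.

Lemma lower2E : lower2 x0 = x0 `^ b * (b * (b - 1)) / x0 ^+ 2.
Proof.
by rewrite /lower2 lowerE u0 !expr0n/=; field; rewrite gt_eqF.
Qed.

Lemma powR_le_upper x : 0 <= b -> 0 < x -> x `^ b <= upper x.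
Proof.
move=> b0 xp; rewrite powRE_expR// ler_expR ler_wpM2l//.
have u1 : 0 < 1 + u x by rewrite -(pmulr_rgt0 _ x00) -xE.
rewrite {1}(xE x) lnM ?posrE// lerD2l ln_le_cubic//; lra.
Qed.

Lemma upper_homo x y : 0 <= b -> x <= y -> upper x <= upper y.
Proof.
move=> b0 xy; rewrite ler_expR ler_wpM2l// lerD2l cubic_homo//.
by apply: ler_wpM2r; [rewrite invr_ge0 ltW|rewrite lerD2r].
Qed.

Lemma lower_le_powR x : 0 <= b -> x0 / 2 <= x <= 3 / 2 * x0 -> lower x <= x `^ b.
Proof.
move=> b0 /andP[xl xu]; have xp : 0 < x by move: x00; lra.
rewrite powRE_expR// ler_expR ler_wpM2l//.
have ub : - (1 / 2) <= u x <= 1 / 2.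
  by rewrite /u ler_pdivlMr// ler_pdivrMr//; apply/andP; split; lra.
have u1 : 0 < 1 + u x by have /andP[] := ub; lra.
by rewrite {2}(xE x) lnM ?posrE// lerD2l ln_ge_quartic.
Qed.

Lemma lower_gt0 x : 0 < lower x. Proof. exact: expR_gt0. Qed.

End touching.

End log_touching.

(** * Amplitude, radius and correction of the barrier *)

Section barrier_coefficients.
Variables (R : realType) (N : nat) (p H k l0 : R).
Local Notation n := (N%:R : R).
Local Notation et := (eta N p).

(** Exponents of the Barenblatt profile (1 - |y|^pconj)^gam. *)
Definition gam : R := (p - 1) / (p - 2).
Definition pconj : R := p / (p - 1).

(** Stands for ln (1 + t), from which it differs by bounded factors for large t,
    but it is at least 1 and its derivative is small with k. Times are shifted
    by 2, so that the barrier makes sense slightly before time 0. *)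
Definition den s : R := 1 + k * ln (2 + s).
Definition delta s : R := (n + 1) * k / den s.
(** Chosen to make [balance_diffusion] true. *)
Definition rad0 : R := ((p - 2) * H + (p - 1) * ln (gam * pconj) - ln et) / p.
(** Logarithm of the amplitude. With [lnrad] for the radius, the mass amp *
    rad^N is proportional to den^-(N+1), while the power laws in time are those
    of the Barenblatt solution. H is free: it fixes the size. *)
Definition lnamp s : R := H - n * et * ln (2 + s) - p * et * (n + 1) * ln (den s).
Definition lnrad s : R :=
  rad0 + et * ln (2 + s) - (p - 2) * et * (n + 1) * ln (den s).
Definition amp s := expR (lnamp s).
Definition scl s := expR (- (pconj * lnrad s)).
Definition lam s := l0 / den s.

Definition amp1 s := amp s * (- (n * et) - p * et * delta s) / (2 + s).
Definition scl1 s := scl s * (- pconj * (et - (p - 2) * et * delta s)) / (2 + s).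
Definition lam1 s := - (lam s * (k / den s)) / (2 + s).

Hypotheses (p2 : 2 < p) (k0 : 0 <= k).

Lemma eta_gt0 : 0 < et.
Proof.
rewrite /eta invr_gt0; have : 0 <= n * (p - 2) by rewrite mulr_ge0//; move: p2; lra.
by move: p2; lra.
Qed.

Lemma gam_gt1 : 1 < gam.
Proof. by rewrite /gam ltr_pdivlMr; move: p2; lra. Qed.

Lemma pconj_gt1 : 1 < pconj.
Proof. by rewrite /pconj ltr_pdivlMr; move: p2; lra. Qed.

Lemma pconj_lt2 : pconj < 2.
Proof. by rewrite /pconj ltr_pdivrMr; move: p2; lra. Qed.

Lemma qstar_gt1 : 1 < qstar N p.
Proof.
have : N%:R / N.+1%:R <= 1 :> R by rewrite ler_pdivrMr ?ltr0n// mul1r ler_nat.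
by rewrite /qstar; move: (_ / _) (p2) => w; lra.
Qed.

Section at_time.
Variable s : R.
Hypothesis s1 : -1 < s.

Lemma tau_gt0 : 0 < 2 + s. Proof. by move: s1; lra. Qed.

Lemma den_ge1 : 1 <= den s.
Proof. by rewrite /den lerDl mulr_ge0// ln_ge0//; move: s1; lra. Qed.

Lemma den_gt0 : 0 < den s. Proof. exact: lt_le_trans den_ge1. Qed.

Let dv_tau : has_deriv (fun s => 2 + s) s 1.
Proof.
apply: (dv_eq (df := 0 + 1)); last by rewrite add0r.
by apply: dv_add; [exact: dv_cst|exact: dv_id].
Qed.

Let dv_lntau : has_deriv (fun s => ln (2 + s)) s (2 + s)^-1.
Proof. by apply: dv_eq (dv_ln tau_gt0 dv_tau) _; rewrite mulr1. Qed.

Lemma dv_den : has_deriv den s (k / (2 + s)).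
Proof.
apply: (dv_eq (df := 0 + (k * (2 + s)^-1 + ln (2 + s) * 0))).
  apply: dv_add; first exact: dv_cst.
  by apply: dv_mul; first exact: dv_cst.
by rewrite mulr0 addr0 add0r.
Qed.

Let dv_lnden : has_deriv (fun s => ln (den s)) s (k / den s / (2 + s)).
Proof. by apply: dv_eq (dv_ln den_gt0 dv_den) _; ring. Qed.

Lemma dv_amp : has_deriv amp s (amp1 s).
Proof.
apply: dv_eq.
  apply: dv_expR; rewrite /lnamp; apply: dv_add.
    apply: dv_add; first exact: dv_cst.
    by apply: dv_opp; apply: dv_mul; [exact: dv_cst|exact: dv_lntau].
  by apply: dv_opp; apply: dv_mul; [exact: dv_cst|exact: dv_lnden].
rewrite /amp1 /amp /delta; set e := expR _; set ett := et.
by field; rewrite !gt_eqF ?tau_gt0 ?den_gt0.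
Qed.

Lemma dv_scl : has_deriv scl s (scl1 s).
Proof.
apply: dv_eq.
  apply: dv_expR; apply: dv_opp; apply: dv_mul; first exact: dv_cst.
  rewrite /lnrad; apply: dv_add.
    apply: dv_add; first exact: dv_cst.
    by apply: dv_mul; [exact: dv_cst|exact: dv_lntau].
  by apply: dv_opp; apply: dv_mul; [exact: dv_cst|exact: dv_lnden].
rewrite /scl1 /scl /delta; set e := expR _; set ett := et; set pc := pconj.
by field; rewrite !gt_eqF ?tau_gt0 ?den_gt0.
Qed.

Lemma dv_lam : has_deriv lam s (lam1 s).
Proof.
apply: dv_eq.
  apply: dv_mul; first exact: dv_cst.
  by apply: dv_inv; [rewrite gt_eqF ?den_gt0|exact: dv_den].
rewrite /lam1 /lam.
by field; rewrite !gt_eqF ?tau_gt0 ?den_gt0.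
Qed.

Let ca_inv (f : R -> R) : f s != 0 -> cont_at f s -> cont_at (fun y => (f y)^-1) s.
Proof. by move=> f0 cf; exact: cvgV. Qed.

Let c_tauV : cont_at (fun s : R => (2 + s)^-1) s.
Proof.
apply: ca_inv; first by rewrite gt_eqF ?tau_gt0.
exact: dv_continuous dv_tau.
Qed.

Let c_denV : cont_at (fun s : R => (den s)^-1) s.
Proof.
apply: ca_inv; first by rewrite gt_eqF ?den_gt0.
exact: dv_continuous dv_den.
Qed.

Let c_delta : cont_at delta s.
Proof. exact: (ca_mul (@ca_cst R _ _ s) c_denV). Qed.

Lemma continuous_amp1 : {for s, continuous amp1}.
Proof.
exact: (ca_mul (ca_mul (dv_continuous dv_amp) (ca_add (@ca_cst R _ _ s)
  (ca_opp (ca_mul (@ca_cst R _ _ s) c_delta)))) c_tauV).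
Qed.

Lemma continuous_scl1 : {for s, continuous scl1}.
Proof.
exact: (ca_mul (ca_mul (dv_continuous dv_scl) (ca_mul (@ca_cst R _ _ s)
  (ca_add (@ca_cst R _ _ s)
  (ca_opp (ca_mul (@ca_cst R _ _ s) c_delta))))) c_tauV).
Qed.

Lemma continuous_lam1 : {for s, continuous lam1}.
Proof.
exact: (ca_mul (ca_opp (ca_mul (dv_continuous dv_lam)
  (ca_mul (@ca_cst R _ _ s) c_denV))) c_tauV).
Qed.

(** Diffusion and time derivative of the barrier have the same size, namely amp
    / (2 + s): the logarithmic factors of amplitude and radius cancel. *)
Lemma balance_diffusion :
  (p - 2) * lnamp s + (p - 1) * ln (gam * pconj) - p * lnrad s =
  ln et - ln (2 + s).
Proof.
have e : et * (n * (p - 2) + p) = 1.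
  by rewrite mulVf// -invr_eq0 -/et gt_eqF ?eta_gt0.
rewrite /lnamp /lnrad /rad0; set lt := ln (2 + s); set ld := ln (den s).
set lg := ln (gam * pconj); set le := ln et.
transitivity (le - et * (n * (p - 2) + p) * lt).
  by set x := et; field; move: p2; lra.
by rewrite e mul1r.
Qed.

(** The size of the absorption relative to amp / (2 + s) / den. *)
Definition absorption_const : R :=
  expR (qstar N p * ln (gam * pconj) + (qstar N p - 1) * H - qstar N p * rad0).

(** The critical exponent is the one for which the absorption has, up to a power
    of the logarithm, the size of the time derivative. The exponent N + 1 of the
    logarithm in the mass is the one that makes this power equal to - 1, as in
    the relative rate at which the mass decreases. *)
Lemma balance_absorption :
  (qstar N p - 1) * lnamp s + qstar N p * (ln (gam * pconj) - lnrad s) =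
  ln absorption_const - ln (2 + s) - ln (den s).
Proof.
have e : et * (n * (p - 2) + p) = 1.
  by rewrite mulVf// -invr_eq0 -/et gt_eqF ?eta_gt0.
rewrite /absorption_const expRK /lnamp /lnrad.
set lt := ln (2 + s); set ld := ln (den s); set lg := ln (gam * pconj).
have n1 : n + 1 != 0 by rewrite natr1 pnatr_eq0.
have -> : qstar N p = p - n / (n + 1) by rewrite /qstar natr1.
transitivity ((p - n / (n + 1)) * lg + (p - n / (n + 1) - 1) * H -
   (p - n / (n + 1)) * rad0 - et * (n * (p - 2) + p) * lt
     - et * (n * (p - 2) + p) * ld).
  by set x := et; set y := rad0; field.
by rewrite e !mul1r.
Qed.

End at_time.
End barrier_coefficients.

(** * The equation at the test functions of the barrier *)

Section barrier_operator.
Variables (R : realType) (N : nat) (p H k l0 : R).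
Hypotheses (p2 : 2 < p) (l00 : 0 < l0) (l0p : l0 <= (4 * p)^-1)
  (kE : k = l0 / (4 * p * (N%:R + 1))) (hN : (1 <= N)%N).
Local Notation n := (N%:R : R).
Local Notation et := (eta N p).
Local Notation q := (qstar N p).
Local Notation gam := (gam p).
Local Notation pc := (pconj p).
Local Notation amp := (amp N p H k).
Local Notation scl := (scl N p H k).
Local Notation den := (den k).
Local Notation lam := (lam k l0).
Local Notation B := (absorption_const N p H).

Hypothesis supersolution : forall L z : R, 1 <= L -> 0 < z < 1 ->
  0 < drift p n (l0 / L) z + B / et / L *
   (press (l0 / L) z `^ ((gam - 1) * (q - 1)) * slope (l0 / L) z `^ q *
    z `^ (q / p)).

Let k0 : 0 <= k.
Proof.
rewrite kE divr_ge0 ?(ltW l00)// mulr_ge0 ?addr_ge0//; move: p2; lra.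
Qed.

(** Both nonlinear terms are powers of the gradient, whose logarithm is affine
    in the logarithms of the data: after the two balance relations these powers
    split into the expected factors. V is the logarithm of |grad| / |y|, that
    is, of twice the derivative in the squared radius. *)
Lemma steepness_powR (lA lX lr lP lm lt ld lB : R) (b := pc / 2)
  (lz := - (pc * lX) + b * lr)
  (V := lA + ln (gam * pc) + (gam - 1) * lP + lm + lz - lr) :
  (p - 2) * lA + (p - 1) * ln (gam * pc) - p * lX = ln et - lt ->
  (q - 1) * lA + q * (ln (gam * pc) - lX) = lB - lt - ld ->
  (p - 2) / 2 * (lr + 2 * V) + V = lA + (ln et - lt) + gam * lP + (p - 1) * lm /\
  q / 2 * (lr + 2 * V) = lA - lt + (lB - ld) + (gam - 1) * lP +
    ((gam - 1) * (q - 1) * lP + q * lm + q / p * lz).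
Proof.
move=> <- e2; have -> : lB = (q - 1) * lA + q * (ln (gam * pc) - lX) + lt + ld.
  by rewrite e2; ring.
rewrite /V /lz /b; move: (ln (gam * pc)) (qstar N p) => lg q'.
have h : [/\ p - 1 != 0, p - 2 != 0 & p != 0].
  by split; apply/eqP; move: p2; lra.
by case: h => h1 h2 h3; rewrite /gam /pconj; split; field; rewrite ?h1 ?h2 ?h3.
Qed.

(** The operator at the touching point is a positive multiple of [drift] plus
    absorption, up to a nonnegative rest: the effect of the decrease of the
    correction factor in time, and the penalisation. *)
Lemma balance_algebra (A tau G P m z l dl Dm2 Bc L X l1 pen1 : R) (a := pc / 2) :
  tau != 0 -> P != 0 -> m != 0 -> L != 0 -> et != 0 -> a != 0 ->
  let Dm1 := m * Dm2 in
  let rho := - ((gam - 1) * (m * z * a) / P) - 2 * l * z * a / m + (a - 1) in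
  A * (- (n * et) - p * et * dl) / tau * G +
   A * (G * gam / P * (- (m * (z * (- pc * (et - (p - 2) * et * dl)) / tau)) -
      z * (1 - z) * l1)) + pen1
   - - (A * (et / tau) * G * Dm1) * (n + (p - 2) + 2 * (p - 1) * rho) +
   A / tau * (Bc / L) * (G / P) * X =
  A / tau * (G / P) * et * (P * (n * (Dm1 - 1) - 2 * p * l * z * Dm2 - p * dl) +
    p / (p - 2) * m * z * (1 - (p - 2) * dl - Dm1) + Bc / et / L * X) +
  (A * (G * gam / P) * (z * (1 - z) * - l1) + pen1).
Proof.
move=> t0 P0 m0 L0 e0 a0 Dm1 rho; rewrite /rho /Dm1 /a.
have h : [/\ p - 1 != 0, p - 2 != 0 & p != 0].
  by split; apply/eqP; move: p2; lra.
case: h => h1 h2 h3; move: e0; set x := et => e0.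
by rewrite /gam /pconj; field; rewrite ?h1 ?h2 ?t0 ?P0 ?m0 ?L0 ?e0.
Qed.

Section at_point.
Variables (s1 t1 r1 : R) (pen pen' : R -> R).
Hypotheses (s1m : -1 < s1) (t10 : 0 < t1) (d1 : -1 <= s1 - t1) (r10 : 0 < r1).
Hypotheses (dpen : forall t, 0 < t -> has_deriv pen t (pen' t))
  (cpen' : forall t, 0 < t -> {for t, continuous pen'})
  (pen0 : 0 <= pen' t1).
Let d := s1 - t1.
Let z1 := scl s1 * r1 `^ (pc / 2).
Hypothesis z1lt1 : z1 < 1.
Let P1 := press (lam s1) z1.

Let lam_s1 : 0 < lam s1 <= (4 * p)^-1.
Proof.
have D1 := den_ge1 k0 s1m; have D0 := den_gt0 k0 s1m.
rewrite /lam divr_gt0//=; apply: le_trans l0p.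
by rewrite ler_pdivrMr// ler_peMr// ltW.
Qed.

Let z10 : 0 < z1. Proof. by rewrite mulr_gt0 ?expR_gt0 ?powR_gt0. Qed.

Let m0 : 0 < slope (lam s1) z1.
Proof.
have /andP[a b] := lam_s1.
by apply: (slope_gt0 p2 (n := n)); rewrite ?ler1n//; exact: ltW.
Qed.

Lemma barrier_press_gt0 : 0 < P1.
Proof.
have /andP[a b] := lam_s1; rewrite /P1 /press mulr_gt0//; first by move: z1lt1; lra.
have : lam s1 * z1 < lam s1 by rewrite gtr_pMr.
have : (4 * p)^-1 <= 1 by rewrite invf_le1; move: p2; lra.
by lra.
Qed.

(** The test function that touches the barrier, translated in time by s1 - t1,
    at the squared radius r1 where the doubled functional has its maximum. *)
Definition barrier_test : R -> R -> R :=
  composite (fun t => amp (t + d)) (fun t => scl (t + d)) (fun t => lam (t + d))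
   pen (lower (pc / 2) r1) (upper gam P1).

Definition barrier_test_t : R -> R -> R :=
  composite_t (fun t => amp (t + d)) (fun t => amp1 N p H k (t + d))
   (fun t => scl (t + d)) (fun t => scl1 N p H k (t + d))
   (fun t => lam (t + d)) (fun t => lam1 k l0 (t + d))
   pen' (lower (pc / 2) r1) (upper gam P1) (upper1 gam P1).

Definition barrier_test_1 : R -> R -> R :=
  composite_1 (fun t => amp (t + d)) (fun t => scl (t + d)) (fun t => lam (t + d))
   (lower (pc / 2) r1) (lower1 (pc / 2) r1) (upper1 gam P1).

Definition barrier_test_2 : R -> R -> R :=
  composite_2 (fun t => amp (t + d)) (fun t => scl (t + d)) (fun t => lam (t + d))
   (lower (pc / 2) r1) (lower1 (pc / 2) r1) (lower2 (pc / 2) r1)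
   (upper1 gam P1) (upper2 gam P1).

Let dv_shift (f f1 : R -> R) : (forall s, -1 < s -> has_deriv f s (f1 s)) ->
  forall t, 0 < t -> has_deriv (fun t => f (t + d)) t (f1 (t + d)).
Proof.
move=> df t t0.
apply: (dv_eq (df := f1 (t + d) * (1 + 0))); last by rewrite addr0 mulr1.
apply: dv_comp; first by apply: df; move: d1 t0; rewrite /d; lra.
by apply: dv_add; [exact: dv_id|exact: dv_cst].
Qed.

Let c_shift (f : R -> R) : (forall s, -1 < s -> {for s, continuous f}) ->
  forall t, 0 < t -> {for t, continuous (fun t => f (t + d))}.
Proof.
move=> cf t t0; apply: (ca_comp (h := f) (f := fun t => t + d)).
  by apply: cf; move: d1 t0; rewrite /d; lra.
apply: dv_continuous.
by apply: dv_add; [exact: dv_id|exact: dv_cst].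
Qed.

Lemma profile_barrier_test :
  profile barrier_test barrier_test_t barrier_test_1 barrier_test_2.
Proof.
have P0 := barrier_press_gt0.
refine (profile_composite _ _ _ dpen _ _ _ cpen' _ _ _ _ _ _).
- by apply: dv_shift => s; exact: dv_amp.
- by apply: dv_shift => s; exact: dv_scl.
- by apply: dv_shift => s; exact: dv_lam.
- by apply: c_shift => s; exact: continuous_amp1.
- by apply: c_shift => s; exact: continuous_scl1.
- by apply: c_shift => s; exact: continuous_lam1.
- by move=> r; exact: dv_lower.
- by move=> r; exact: dv_lower1.
- exact: continuous_lower2.
- by move=> r; exact: dv_upper.
- by move=> r; exact: dv_upper1.
- exact: continuous_upper2.
Qed.

Let A := amp s1.
Let tau := 2 + s1.
Let L := den s1.
Let m := slope (lam s1) z1.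
Let G := P1 `^ gam.
Let sigma := A * (G * gam / P1 * (m * (z1 * (pc / 2) / r1))).

Let shiftE : t1 + d = s1. Proof. by rewrite /d; ring. Qed.

Let valZ : scl (t1 + d) * lower (pc / 2) r1 r1 = z1.
Proof. by rewrite shiftE lowerE. Qed.

Let valP : press (lam (t1 + d)) (scl (t1 + d) * lower (pc / 2) r1 r1) = P1.
Proof. by rewrite valZ shiftE. Qed.

Let val_zE1 : scl (t1 + d) * lower1 (pc / 2) r1 r1 = z1 * (pc / 2) / r1.
Proof. by rewrite shiftE lower1E// /z1; ring. Qed.

Lemma barrier_test_at : barrier_test t1 r1 = A * G + pen t1.
Proof. by rewrite /barrier_test /composite valP upperE ?barrier_press_gt0 ?shiftE. Qed.

Lemma barrier_test_1_at : barrier_test_1 t1 r1 = - sigma.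
Proof.
rewrite /barrier_test_1 /composite_1 valP valZ val_zE1 upper1E ?barrier_press_gt0//.
by rewrite shiftE /sigma -/A -/m -/G; ring.
Qed.

Lemma barrier_test_2_at : r1 * barrier_test_2 t1 r1 / barrier_test_1 t1 r1 =
  - ((gam - 1) * (m * z1 * (pc / 2)) / P1) - 2 * lam s1 * z1 * (pc / 2) / m
   + (pc / 2 - 1).
Proof.
have P0 := barrier_press_gt0.
have G0 : 0 < G by rewrite powR_gt0.
have A0 : 0 < A by exact: expR_gt0.
have g1 := gam_gt1 p2; have c1 := pconj_gt1 p2.
rewrite barrier_test_1_at /barrier_test_2 /composite_2 valP valZ val_zE1.
rewrite upper1E// upper2E// -/G.
have -> : scl (t1 + d) * lower2 (pc / 2) r1 r1 =
          z1 * (pc / 2 * (pc / 2 - 1)) / r1 ^+ 2.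
  by rewrite shiftE lower2E// /z1; ring.
rewrite shiftE -/A -/m /sigma.
have m0' : 0 < m by [].
move: P0 G0 A0 g1 c1 m0' z10 r10; move: P1 G A m z1 gam pc (lam s1) r1.
move=> P G' A' m' z ga c l r P0 G0 A0 g1 c1 m0' z0 r0; field.
by do ?[apply/andP; split]; rewrite ?gt_eqF//; lra.
Qed.

Let lP := ln P1.
Let lm := ln m.
Let lr := ln r1.
Let lA := lnamp N p H k s1.
Let lX := lnrad N p H k s1.
Let lz := - (pc * lX) + pc / 2 * lr.
Let V := lA + ln (gam * pc) + (gam - 1) * lP + lm + lz - lr.

Let zE : z1 = expR lz.
Proof. by rewrite /z1 /scl powRE_expR// -expRD. Qed.

Let twosigma : 2 * sigma = expR V.
Proof.
have P0 := barrier_press_gt0.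
have g1 := gam_gt1 p2; have c1 := pconj_gt1 p2.
have gc0 : 0 < gam * pc by rewrite mulr_gt0//; lra.
have key (a b c e f g : R) : expR (a + b + c + e + f - g) =
    expR a * expR b * expR c * expR e * expR f / expR g.
  by rewrite expRB !expRD.
rewrite /V key -zE /lP /lm /lr !lnK ?posrE//.
have -> : expR ((gam - 1) * ln P1) = G / P1.
  by rewrite mulrBl mul1r expRB lnK ?posrE// /G powRE_expR.
by rewrite /sigma -[expR lA]/A; field; rewrite !gt_eqF.
Qed.

Let sigma0 : 0 < sigma.
Proof. by have := expR_gt0 V; rewrite -twosigma pmulr_rgt0. Qed.

Let grad_sq : 4 * r1 * (- sigma) ^+ 2 = expR (lr + 2 * V).
Proof.
have key (a b : R) : expR (a + 2 * b) = expR a * (expR b * expR b).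
  by rewrite -!expRD; congr expR; ring.
by rewrite key /lr lnK ?posrE// -twosigma; ring.
Qed.

Let powers := @steepness_powR lA lX lr lP lm (ln tau) (ln L) (ln B)
  (balance_diffusion N H k p2 s1) (balance_absorption N H k p2 s1).

Let tau0 : 0 < tau. Proof. exact: tau_gt0. Qed.
Let L0 : 0 < L. Proof. exact: den_gt0. Qed.
Let B0 : 0 < B. Proof. exact: expR_gt0. Qed.

Lemma barrier_flux :
  flux_density p (barrier_test_1 t1) r1 = - (A * (et / tau) * G * m `^ (p - 1)).
Proof.
have P0 := barrier_press_gt0; have e0 := eta_gt0 N p2.
rewrite /flux_density barrier_test_1_at grad_sq mulrN mulrN; congr (- _).
have key (a b c e f : R) : expR (a + (b - c) + e + f) =
    expR a * (expR b / expR c) * expR e * expR f.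
  by rewrite !expRD expRN.
rewrite twosigma -expRM [_ * ((p - 2) / 2)]mulrC -expRD powers.1.
by rewrite key !lnK ?posrE// /G /lP /lm !powRE_expR.
Qed.

Lemma barrier_gradient : (4 * r1 * barrier_test_1 t1 r1 ^+ 2) `^ (q / 2) =
  A / tau * (B / L) * (G / P1) *
   (P1 `^ ((gam - 1) * (q - 1)) * m `^ q * z1 `^ (q / p)).
Proof.
have P0 := barrier_press_gt0.
rewrite barrier_test_1_at grad_sq -expRM [_ * (q / 2)]mulrC.
have key (a b c e f g h i : R) : expR (a - b + (c - e) + f + (g + h + i)) =
    expR a / expR b * (expR c / expR e) * expR f * (expR g * expR h * expR i).
  by rewrite !expRD !expRN.
rewrite powers.2 key !lnK ?posrE//.
have -> : expR ((gam - 1) * lP) = G / P1.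
  by rewrite mulrBl mul1r expRB /lP lnK ?posrE// /G powRE_expR.
have -> : expR (q / p * lz) = z1 `^ (q / p) by rewrite zE powRE_expR ?expR_gt0// expRK.
by rewrite !powRE_expR.
Qed.

(** The touching functions have the first two derivatives of the powers they
    replace, so the operator takes at the touching point the value it would have
    for the barrier, and this one is a strict supersolution. *)
Lemma barrier_operator_gt0 (x c : 'rV[R]_N) : sqnorm (x - c) = r1 ->
  0 < pde_operator p q (fun t x => barrier_test t (sqnorm (x - c))) t1 x.
Proof.
move=> xr; have P0 := barrier_press_gt0.
have e0 := eta_gt0 N p2.
have g1 := gam_gt1 p2; have c1 := pconj_gt1 p2.
have G0 : 0 < G by rewrite powR_gt0.
have A0 : 0 < A by exact: expR_gt0.
have m0' : 0 < m by [].
rewrite (pde_operator_radial profile_barrier_test)//; rewrite xr//; last first.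
  by rewrite barrier_test_1_at oppr_eq0 gt_eqF.
rewrite barrier_test_2_at barrier_flux barrier_gradient.
rewrite /barrier_test_t /composite_t valP valZ upperE// upper1E// shiftE.
rewrite -/A -/G -/m.
have -> : scl1 N p H k s1 * lower (pc / 2) r1 r1 =
  z1 * (- pc * (et - (p - 2) * et * delta N k s1)) / tau.
  by rewrite lowerE// /scl1 /z1 /tau; ring.
have mE : m * m `^ (p - 2) = m `^ (p - 1).
  have -> : p - 1 = 1 + (p - 2) by ring.
  rewrite [_ `^ (1 + _)]powRD; last by rewrite (gt_eqF m0') implybT.
  by rewrite powRr1// ltW.
rewrite -mE.
rewrite /amp1 -/A -/tau.
have D : delta N k s1 = lam s1 / (4 * p).
  have pn0 : p != 0 by apply/eqP; move: p2; lra.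
  have n10 : n + 1 != 0 by rewrite natr1 pnatr_eq0.
  have nk : (n + 1) * k = l0 / (4 * p) by rewrite kE; field; rewrite n10 pn0.
  by rewrite /delta nk; rewrite /lam; ring.
rewrite balance_algebra; last first.
- by rewrite gt_eqF// divr_gt0//; lra.
- by rewrite gt_eqF.
- by rewrite gt_eqF.
- by rewrite gt_eqF.
- by rewrite gt_eqF.
- by rewrite gt_eqF.
have z1i : 0 < z1 < 1 by rewrite z10.
have := supersolution (den_ge1 k0 s1m) z1i.
rewrite /drift -/(lam s1) -/m -/P1 -/L mE D => ss.
apply: ltr_pwDl.
  rewrite pmulr_rgt0; last first.
    by rewrite mulr_gt0// mulr_gt0// divr_gt0.
  apply: lt_le_trans ss _; rewrite le_eqVlt; apply/orP; left; apply/eqP.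
  congr (_ * (_ - _) + _ + _); field; apply/eqP; move: p2; lra.
apply: addr_ge0 => //; apply: mulr_ge0.
  by rewrite mulr_ge0 ?ltW// divr_gt0// mulr_gt0//; lra.
apply: mulr_ge0; first by rewrite mulr_ge0 ?ltW// subr_gt0.
rewrite /lam1 mulNr opprK; apply: divr_ge0; last exact: ltW.
have /andP[/ltW lp _] := lam_s1.
by rewrite mulr_ge0// divr_ge0// ltW.
Qed.

End at_point.

End barrier_operator.

(** * Norms, compactness and the penalisation in time *)

Section space_time.
Variables (R : realType) (N : nat).
Implicit Types (x y : 'rV[R]_N) (u : R -> 'rV[R]_N -> R).

Lemma coord_le_norm x i : `|x 0 i| <= `|x|.
Proof.
have /mapP[j Hj ->] : `|x 0 i| \in [seq `|x k.1 k.2| | k : 'I_1 * 'I_N].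
  by apply/mapP; exists (0, i) => //=; rewrite mem_enum.
by rewrite [leRHS]/Num.norm /= mx_normrE; apply/bigmax_geP; right => /=; exists j.
Qed.

Lemma sqr_norm_le_sqnorm x : `|x| ^+ 2 <= sqnorm x.
Proof.
have [->|x0] := eqVneq x 0; first by rewrite normr0 expr0n sqnorm_ge0.
have : mx_norm x != 0 by rewrite -[mx_norm x]/(`|x|) normr_eq0.
move=> /mx_norm_neq0[[i j] e].
have -> : `|x| = `|x 0 j| by rewrite [`|x|]e (ord1 i).
rewrite real_normK ?num_real// /sqnorm (bigD1 j)//= lerDl.
by apply: sumr_ge0 => k _; exact: sqr_ge0.
Qed.

Lemma sqnorm_le_norm x : sqnorm x <= N%:R * `|x| ^+ 2.
Proof.
rewrite /sqnorm; apply: (@le_trans _ _ (\sum_(i < N) `|x| ^+ 2)).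
  apply: ler_sum => i _; rewrite -[leLHS]real_normK ?num_real//.
  by rewrite lerXn2r ?nnegrE// coord_le_norm.
by rewrite sumr_const card_ord mulr_natl.
Qed.

Lemma sqnorm_gt0 x : x != 0 -> 0 < sqnorm x.
Proof.
move=> x0; apply: lt_le_trans (sqr_norm_le_sqnorm x).
by rewrite exprn_gt0// normr_gt0.
Qed.

Lemma compact_sup_ball y r : 0 < r -> compact [set x | `|y - x| <= r].
Proof.
move=> r0; apply: bounded_closed_compact; last first.
  by rewrite -[X in closed X]/(closed_ball_ Num.norm y r) -closed_ballE//;
    exact: closed_ball_closed.
exists (`|y| + r); split; first exact: num_real.
move=> M HM x /= xr; apply: le_trans (ltW HM).
have -> : x = y - (y - x) by rewrite opprB addrC subrK.
by apply: le_trans (ler_normB _ _) _; rewrite lerD2l.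
Qed.

Lemma continuous_clip u : bounded_continuous u ->
  continuous (fun z : R * 'rV[R]_N => u (Num.max z.1 0) z.2).
Proof.
case=> /subspace_continuousP cu _ z.
pose r (z : R * 'rV[R]_N) := (Num.max z.1 0, z.2).
have Ar w : 0 <= (r w).1 by rewrite /r le_max lexx orbT.
have cr : r @ z --> r z.
  have c1 : {for z, continuous (fun w : R * 'rV[R]_N => Num.max w.1 0)}.
    have f0 : {for z, continuous (fst : R * 'rV[R]_N -> R)} by exact: cvg_fst.
    have k0 : {for z, continuous (cst 0 : R * 'rV[R]_N -> R)}.
      exact: cst_continuous.
    exact: continuous_max f0 k0.
  have c2 : (fun w : R * 'rV[R]_N => w.2) @ z --> z.2 by exact: cvg_snd.
  exact: (cvg_pair c1 c2).
have cr' : r @ z --> within [set z | 0 <= z.1] (nbhs (r z)).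
  move=> P wP.
  have H : \forall w \near z, 0 <= (r w).1 -> P (r w) := cr _ wP.
  change (nbhs z (r @^-1` P)).
  by apply: filterS H => w h; exact: h (Ar w).
exact: (cvg_comp r (fun z => u z.1 z.2) cr' (cu _ (Ar z))).
Qed.

Lemma penalisation_small (B e t T : R) : 0 <= t -> t < T -> 0 < e ->
  exists2 n : nat, (0 < n)%N & B * (t / T) ^+ n < e.
Proof.
move=> t0 tT e0; have T0 : 0 < T by exact: le_lt_trans tT.
have q1 : `|t / T| < 1.
  by rewrite ger0_norm ?divr_ge0// ?ltr_pdivrMr ?mul1r// ltW.
have : B * (t / T) ^+ n @[n --> \oo] --> B * 0.
  by apply: cvgMr; exact: cvg_expr.
rewrite mulr0 => /cvgr_lt/(_ e e0)[m _ mP].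
by exists m.+1 => //; apply: mP => /=.
Qed.

(** Added to a barrier, it excludes a maximum at time T, where it equals the
    bound B, and makes the barrier a strict supersolution; a large n makes it
    negligible at any earlier time, see [penalisation_small]. *)
Definition pen (B T : R) (n : nat) (t : R) := B * (t / T) ^+ n.
Definition pen1 (B T : R) (n : nat) (t : R) := B * (n%:R * (t / T) ^+ n.-1 / T).

Lemma dv_pen B T n t : has_deriv (pen B T n) t (pen1 B T n t).
Proof.
apply: dv_eq.
  apply: dv_mul; first exact: dv_cst.
  by apply: dv_exp; apply: dv_mul; [exact: dv_id|exact: dv_cst].
by rewrite /pen1; ring.
Qed.

Lemma continuous_pen1 B T n : continuous (pen1 B T n).
Proof.
move=> t; have c k := @ca_cst R _ k t.
have ct : cont_at (fun t : R => t) t by exact: cvg_id.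
exact: (ca_mul (c _) (ca_mul (ca_mul (c _) (ca_exp (n := n.-1)
  (ca_mul ct (c _)))) (c _))).
Qed.

Lemma pen1_gt0 B T n t : 0 < B -> 0 < T -> (0 < n)%N -> 0 < t ->
  0 < pen1 B T n t.
Proof.
move=> B0 T0 n0 t0.
by rewrite mulr_gt0// divr_gt0// mulr_gt0 ?ltr0n// exprn_gt0// divr_gt0.
Qed.

Lemma pen_ge0 B T n t : 0 <= B -> 0 < T -> 0 <= t -> 0 <= pen B T n t.
Proof. by move=> B0 T0 t0; rewrite mulr_ge0// exprn_ge0// divr_ge0// ltW. Qed.

Lemma pen_end B T n : 0 < T -> pen B T n T = B.
Proof. by move=> T0; rewrite /pen divff ?gt_eqF// expr1n mulr1. Qed.

End space_time.

(** * Power barriers and finite speed of propagation *)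

Section finite_propagation.
Variables (R : realType) (N : nat) (p q : R).
Hypotheses (p2 : 2 < p) (q0 : q != 0).

Section power_barrier.
Variables (F B T : R) (j n : nat).
Let K := j.+2.

Let g t r := F * (1 + t) * r ^+ K + pen B T n t.
Let gt t r := F * r ^+ K + pen1 B T n t.
Let g1 t r := F * (1 + t) * (K%:R * r ^+ j.+1).
Let g2 t r := F * (1 + t) * (K%:R * (j.+1%:R * r ^+ j)).

Lemma profile_power : profile g gt g1 g2.
Proof.
split.
- move=> t r _; apply: dv_eq.
    apply: dv_add; last exact: dv_pen.
    apply: dv_mul; last exact: dv_cst.
    apply: dv_mul; first exact: dv_cst.
    by apply: dv_add; [exact: dv_cst|exact: dv_id].
  by rewrite /gt /=; ring.
- move=> t r _; apply: dv_eq.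
    apply: dv_add; last exact: dv_cst.
    apply: dv_mul; first exact: dv_cst.
    by apply: dv_exp; exact: dv_id.
  by rewrite /g1 /K /=; ring.
- move=> t r _; apply: dv_eq.
    apply: dv_mul; first exact: dv_cst.
    apply: dv_mul; first exact: dv_cst.
    by apply: dv_exp; exact: dv_id.
  by rewrite /g2 /K /=; ring.
- move=> z z0; have c k := @ca_cst R _ k z.
  have c1 : cont_at (fun v : R * R => v.1) z by exact: cvg_fst.
  have c2 : cont_at (fun v : R * R => v.2) z by exact: cvg_snd.
  have cp : cont_at (fun v : R * R => pen B T n v.1) z.
    exact: (ca_comp (dv_continuous (dv_pen B T n z.1)) c1).
  have cp1 : cont_at (fun v : R * R => pen1 B T n v.1) z.
    exact: (ca_comp (continuous_pen1 (x := z.1)) c1).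
  have cF : cont_at (fun v : R * R => F * (1 + v.1)) z.
    exact: (ca_mul (c _) (ca_add (c _) c1)).
  split.
  + exact: (ca_add (ca_mul cF (ca_exp c2)) cp).
  + exact: (ca_add (ca_mul (c _) (ca_exp c2)) cp1).
  + exact: (ca_mul cF (ca_mul (c _) (ca_exp c2))).
  + exact: (ca_mul cF (ca_mul (c _) (ca_mul (c _) (ca_exp c2)))).
Qed.

Let D : R := N%:R + (p - 2) + 2 * (p - 1) * j.+1%:R.
Let th : R := (K%:R - 1 / 2) * (p - 2) - 1.

Lemma power_flux t r : 0 < F -> 0 < t -> 0 < r ->
  flux_density p (g1 t) r *
    (N%:R + (p - 2) + 2 * (p - 1) * (r * g2 t r / g1 t r)) =
  D * ((2 * K%:R * (F * (1 + t))) `^ (p - 1) * r `^ th) * r ^+ K.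
Proof.
move=> F0 t0 r0; set Ft := F * (1 + t).
have Ft0 : 0 < Ft by rewrite mulr_gt0//; lra.
have rn0 : r != 0 by rewrite gt_eqF.
have Fn0 : Ft != 0 by rewrite gt_eqF.
have Kn0 : (K%:R : R) != 0 by rewrite pnatr_eq0.
have -> : r * g2 t r / g1 t r = j.+1%:R.
  rewrite /g1 /g2 -/Ft exprS; field.
  by rewrite Fn0 rn0 Kn0 expf_neq0.
set X := 2 * K%:R * Ft.
have X0 : 0 < X by rewrite mulr_gt0// mulr_gt0// ltr0n.
have -> : flux_density p (g1 t) r = X `^ (p - 1) * r `^ th * r ^+ K.
  rewrite /flux_density /g1 -/Ft.
  have rjE : r ^+ j.+1 = expR (j.+1%:R * ln r) by rewrite expRM_natl lnK.
  have jK : K%:R = j.+1%:R + 1 :> R by rewrite natr1.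
  have -> : 4 * r * (Ft * (K%:R * r ^+ j.+1)) ^+ 2 =
      expR (2 * ln X + (2 * K%:R - 1) * ln r).
    have key (a b e : R) : expR (2 * a + (b + 2 * e)) =
        expR a * expR a * (expR b * (expR e * expR e)).
      by rewrite -!expRD; congr expR; ring.
    have -> : (2 * K%:R - 1) * ln r = ln r + 2 * (j.+1%:R * ln r).
      by rewrite jK; ring.
    by rewrite key -rjE !lnK ?posrE// /X; ring.
  have -> : 2 * (Ft * (K%:R * r ^+ j.+1)) = expR (ln X + (K%:R - 1) * ln r).
    have -> : (K%:R - 1) * ln r = j.+1%:R * ln r by rewrite jK; ring.
    by rewrite expRD -rjE lnK ?posrE// /X; ring.
  have -> : r ^+ K = expR (K%:R * ln r) by rewrite expRM_natl lnK.
  rewrite -expRM -expRD !powRE_expR// -!expRD.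
  by congr expR; rewrite /th; field.
by rewrite -/D; ring.
Qed.

Lemma power_operator_gt0 t r (x c : 'rV[R]_N) : 0 < F -> 0 < B -> 0 < T ->
  (0 < n)%N -> 0 < t -> sqnorm (x - c) = r -> 0 < r ->
  D * ((2 * K%:R * (F * (1 + t))) `^ (p - 1) * r `^ th) <= F ->
  0 < pde_operator p q (fun t x => g t (sqnorm (x - c))) t x.
Proof.
move=> F0 B0 T0 n0 t0 xr r0 H.
have Ft0 : 0 < F * (1 + t) by rewrite mulr_gt0//; lra.
rewrite (pde_operator_radial profile_power)//; rewrite xr//; last first.
  by rewrite /g1 !mulf_neq0 ?expf_neq0 ?pnatr_eq0 ?gt_eqF//; lra.
rewrite power_flux// /gt; apply: ltr_wpDr; first exact: powR_ge0.
have := pen1_gt0 B0 T0 n0 t0.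
have : D * ((2 * K%:R * (F * (1 + t))) `^ (p - 1) * r `^ th) * r ^+ K <= F * r ^+ K.
  by rewrite ler_wpM2r// exprn_ge0// ltW.
by lra.
Qed.

Lemma power_operator_center_gt0 t (c : 'rV[R]_N) : 0 < B -> 0 < T ->
  (0 < n)%N -> 0 < t ->
  0 < pde_operator p q (fun t x => g t (sqnorm (x - c))) t c.
Proof.
move=> B0 T0 n0 t0; rewrite (pde_operator_radial_center _ profile_power)//.
by rewrite /gt expr0n/= mulr0 add0r pen1_gt0.
Qed.

End power_barrier.

(** On a ball of radius rho the p-Laplacian of this barrier is at most of order
    rho^-p relative to its time derivative, F being chosen to have the value B
    on the boundary: a large ball suffices. The power K must be so large that
    the remaining power of r is nonnegative. *)
Lemma power_barrier_small (B T : R) : 0 < B -> 0 < T ->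
  exists (j : nat) (rho : R), 0 < rho /\ let F := B / (rho ^+ 2) ^+ j.+2 in
  forall t r : R, 0 <= t <= T -> 0 < r -> r <= N%:R * rho ^+ 2 ->
  (N%:R + (p - 2) + 2 * (p - 1) * j.+1%:R) *
    ((2 * j.+2%:R * (F * (1 + t))) `^ (p - 1) *
     r `^ ((j.+2%:R - 1 / 2) * (p - 2) - 1)) <= F.
Proof.
move=> B0 T0.
have p20 : 0 < p - 2 by move: p2; lra.
pose j := Num.bound (p - 2)^-1.
have jp : 1 <= j%:R * (p - 2).
  rewrite -ler_pdivrMr// div1r; apply/ltW.
  by rewrite /j; apply: archi_boundP; rewrite invr_ge0 ltW.
set th := (j.+2%:R - 1 / 2) * (p - 2) - 1.
have th0 : 0 <= th.
  by rewrite /th -[j.+2%:R]/((2 + j)%:R) natrD; lra.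
set D := N%:R + (p - 2) + 2 * (p - 1) * j.+1%:R.
have D0 : 0 < D.
  apply: ltr_wpDr; first by rewrite mulr_ge0//; move: p2; lra.
  by apply: ltr_wpDl => //.
set X := 2 * j.+2%:R * (B * (1 + T)).
have X0 : 0 < X.
  by apply: mulr_gt0; [exact: mulr_gt0|apply: mulr_gt0 => //; lra].
pose C := D * (X `^ (p - 1) * N.+1%:R `^ th) / B.
have C0 : 0 < C by rewrite divr_gt0// !mulr_gt0// powR_gt0.
pose rho := 1 + C.
have rho1 : 1 <= rho by rewrite lerDl ltW.
have rho0 : 0 < rho by lra.
exists j, rho; split=> // F t r /andP[t0 tT] r0 rr.
have E0 : 0 < (rho ^+ 2) ^+ j.+2 by rewrite !exprn_gt0.
have F0 : 0 < F by rewrite divr_gt0.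
have Y0 : 0 <= 2 * j.+2%:R * (F * (1 + t)).
  by apply: mulr_ge0; [exact: mulr_ge0|apply: mulr_ge0; [exact: ltW|lra]].
have h1 : (2 * j.+2%:R * (F * (1 + t))) `^ (p - 1) <=
    (X / (rho ^+ 2) ^+ j.+2) `^ (p - 1).
  apply: ge0_ler_powR; rewrite ?nnegrE//.
  - by move: p2; lra.
  - by rewrite divr_ge0 ?ltW.
  rewrite /X /F.
  have -> : 2 * j.+2%:R * (B * (1 + T)) / (rho ^+ 2) ^+ j.+2 =
    2 * j.+2%:R * (B / (rho ^+ 2) ^+ j.+2 * (1 + T)) by ring.
  by rewrite ler_pM2l ?mulr_gt0 ?ltr0n// ler_pM2l//; lra.
have h2 : r `^ th <= (N.+1%:R * rho ^+ 2) `^ th.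
  apply: ge0_ler_powR => //; rewrite ?nnegrE ?(ltW r0)//.
    by rewrite mulr_ge0// exprn_ge0// ltW.
  by apply: le_trans rr _; rewrite ler_pM2r ?exprn_gt0// ler_nat.
apply: (@le_trans _ _ (D * ((X / (rho ^+ 2) ^+ j.+2) `^ (p - 1) *
    (N.+1%:R * rho ^+ 2) `^ th))).
  by rewrite ler_pM2l//; apply: ler_pM; rewrite ?powR_ge0.
set lX := ln X; set lr := ln rho; set lN := ln (N.+1%:R : R).
have rE : rho = expR lr by rewrite lnK.
have E1 : (rho ^+ 2) ^+ j.+2 = expR (2 * (j.+2%:R * lr)).
  by rewrite -exprM {1}rE -expRM_natl natrM; congr expR; ring.
have -> : (X / (rho ^+ 2) ^+ j.+2) `^ (p - 1) * (N.+1%:R * rho ^+ 2) `^ th =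
  X `^ (p - 1) * N.+1%:R `^ th * expR (- (p * lr)) / (rho ^+ 2) ^+ j.+2.
  have -> : X / (rho ^+ 2) ^+ j.+2 = expR (lX - 2 * (j.+2%:R * lr)).
    by rewrite E1 expRB lnK.
  have -> : N.+1%:R * rho ^+ 2 = expR (lN + 2 * lr).
    by rewrite expRD lnK ?posrE ?ltr0n// expRM_natl -rE.
  rewrite E1 -expRN -!expRM (powRE_expR _ X0) powRE_expR ?ltr0n// -!expRD.
  by congr expR; rewrite -/lX -/lN /th; field.
rewrite /F [D * _]mulrA ler_pM2r ?invr_gt0//.
rewrite [D * _]mulrA.
have CB : D * (X `^ (p - 1) * N.+1%:R `^ th) = C * B.
  by rewrite /C divfK// gt_eqF.
rewrite CB -[leRHS]mul1r mulrAC ler_pM2r// expRN ler_pdivrMr ?expR_gt0// mul1r.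
apply: (@le_trans _ _ rho); first by rewrite lerDr.
rewrite [leLHS]rE ler_expR ler_peMl ?ln_ge0//.
by move: p2; lra.
Qed.

End finite_propagation.

Section propagation.
Variables (R : realType) (N : nat) (p q : R).
Hypotheses (p2 : 2 < p) (q0 : q != 0).
Implicit Types (u : R -> 'rV[R]_N -> R).

Lemma continuous_sqnorm_pair (c : 'rV[R]_N) :
  continuous (fun z : R * 'rV[R]_N => sqnorm (z.2 - c)).
Proof.
move=> z; apply: (@continuous_comp (R * 'rV[R]_N)%type 'rV[R]_N R snd
  (fun y => sqnorm (y - c))); last exact: continuous_sqnorm.
exact: cvg_snd.
Qed.

Lemma near_cylinder (T r : R) (c : 'rV[R]_N) (t1 : R) (x1 : 'rV[R]_N) :
  0 < t1 -> t1 < T -> `|c - x1| < r ->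
  \forall z \near (t1, x1), [/\ 0 < z.1, z.1 < T & `|c - z.2| < r].
Proof.
move=> t10 t1T x1r.
have cf : (fun z : R * 'rV[R]_N => z.1) @ (t1, x1) --> t1 by exact: cvg_fst.
have cg : (fun z : R * 'rV[R]_N => `|c - z.2|) @ (t1, x1) --> `|c - x1|.
  apply: cvg_norm; apply: cvgB; first exact: cvg_cst.
  exact: cvg_snd.
near=> z; split; near: z.
- exact: (cvgr_gt t1 cf).
- exact: (cvgr_lt t1 cf).
- exact: (cvgr_lt _ cg).
Unshelve. all: by end_near. Qed.

(** If u were positive at xs, far from the support of u(0), the barrier centered
    at xs would touch u from above: it exceeds u on the boundary of the ball,
    where it is at least B, and at time 0, where u vanishes on the ball. The
    functions touch at an interior point, where the operator is positive. *)
Lemma finite_propagation u B R0 T :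
  bounded_continuous u -> (forall t x, 0 <= t -> u t x <= B) -> 0 < B ->
  (forall t x, 0 <= t -> 0 <= u t x) -> viscosity_subsolution p q u ->
  (forall x, R0 < `|x| -> u 0 x = 0) -> 0 < T ->
  exists R1 : R, forall t x, 0 <= t <= T -> R1 < `|x| -> u t x = 0.
Proof.
move=> bu uB B0 u0 vu ini T0; set T' := T + 1.
have T'0 : 0 < T' by rewrite /T'; lra.
have [j [rho [rho0 small]]] := power_barrier_small N p2 B0 T'0.
exists (R0 + rho) => ts xs /andP[ts0 tsT] xsR.
apply/eqP; rewrite eq_le u0// andbT leNgt; apply/negP => us0.
have tsT' : ts < T' by rewrite /T'; lra.
have [n n0 pn] := penalisation_small B ts0 tsT' us0.
set F := B / (rho ^+ 2) ^+ j.+2 in small.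
have E0 : 0 < (rho ^+ 2) ^+ j.+2 by rewrite !exprn_gt0.
have F0 : 0 < F by rewrite divr_gt0.
(* The bound B is reached at distance rho, hence this F. *)
pose g t r := F * (1 + t) * r ^+ j.+2 + pen B T' n t.
pose Phi (z : R * 'rV[R]_N) :=
  u (Num.max z.1 0) z.2 - g z.1 (sqnorm (z.2 - xs)).
have cPhi : continuous Phi.
  move=> z; have c k := @ca_cst R (R * 'rV[R]_N)%type k z.
  have c1 : cont_at (fun v : R * 'rV[R]_N => v.1) z by exact: cvg_fst.
  have c2 : cont_at (fun v : R * 'rV[R]_N => sqnorm (v.2 - xs)) z.
    exact: continuous_sqnorm_pair.
  have cp : cont_at (fun v : R * 'rV[R]_N => pen B T' n v.1) z.
    exact: (ca_comp (dv_continuous (dv_pen B T' n z.1)) c1).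
  exact: (ca_add (continuous_clip bu (x := z)) (ca_opp (ca_add (ca_mul (ca_mul (c _)
    (ca_add (c _) c1)) (ca_exp c2)) cp))).
pose K := `[0, T']%classic `*` [set x : 'rV[R]_N | `|xs - x| <= rho].
have cK : compact K.
  by apply: compact_setX; [exact: segment_compact|exact: compact_sup_ball].
have Ks : K (ts, xs).
  split=> /=; first by rewrite in_itv/= ts0 ltW.
  by rewrite subrr normr0 ltW.
have [[t1 x1] K1 M1] := compact_EVT_max (ex_intro _ _ Ks) cK
  (continuous_subspaceT cPhi).
move: K1; rewrite inE => -[/=]; rewrite in_itv/= => /andP[t10 t1T] x1r.
have P0 : 0 < Phi (t1, x1).
  apply: lt_le_trans (M1 (ts, xs) _); last by rewrite inE.
  rewrite /Phi /g /= subrr sqnorm0 expr0n/= mulr0 add0r max_l// subr_gt0.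
  exact: pn.
have g0 t r : 0 <= t -> 0 <= r -> pen B T' n t <= g t r.
  move=> t0 r0; rewrite /g lerDr; apply: mulr_ge0; last exact: exprn_ge0.
  by apply: mulr_ge0; [exact: ltW|lra].
have gs := g0 t1 _ t10 (sqnorm_ge0 (x1 - xs)).
have pt1 : 0 <= pen B T' n t1 by apply: pen_ge0 => //; exact: ltW.
have t1p : 0 < t1.
  rewrite lt_neqAle t10 andbT; apply/eqP => t1E; move: P0.
  rewrite /Phi /= -t1E max_l// ini; first by rewrite t1E; lra.
  have := ler_normB xs (xs - x1); rewrite opprB addrC subrK.
  have : `|xs| <= `|xs - x1| + `|x1| by rewrite -[X in `|X| <= _](subrK x1) ler_normD.
  by lra.
have t1lt : t1 < T'.
  rewrite lt_neqAle t1T andbT; apply/eqP => t1E; move: P0.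
  have := uB t1 x1 t10; rewrite /Phi /= max_l//; move: gs.
  by rewrite t1E pen_end//; lra.
have x1lt : `|xs - x1| < rho.
  rewrite ltNge; apply/negP => x1g; move: P0.
  have : B <= F * (1 + t1) * sqnorm (x1 - xs) ^+ j.+2.
    have h1 : (rho ^+ 2) ^+ j.+2 <= sqnorm (x1 - xs) ^+ j.+2.
      apply: lerXn2r; rewrite ?nnegrE ?sqnorm_ge0 ?exprn_ge0 ?(ltW rho0)//.
      apply: le_trans (sqr_norm_le_sqnorm _); rewrite distrC.
      by apply: lerXn2r; rewrite ?nnegrE// ltW.
    have -> : B = F * (rho ^+ 2) ^+ j.+2 by rewrite /F divfK// gt_eqF.
    apply: ler_pM => //; [exact: ltW|exact: ltW|].
    by rewrite ler_peMr ?ltW//; lra.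
  have := uB t1 x1 t10; rewrite /Phi /g /= max_l//; move: pt1.
  by lra.
have C12g := C12_radial xs (profile_power F B T' j n).
have := vu _ t1 x1 C12g t1p.
have loc : \forall z \near (t1, x1), u z.1 z.2 -
    g z.1 (sqnorm (z.2 - xs)) <= u t1 x1 - g t1 (sqnorm (x1 - xs)).
  near=> z.
  have [h1 h2 h3] : [/\ 0 < z.1, z.1 < T' & `|xs - z.2| < rho].
    by near: z; exact: near_cylinder.
  have Kz : z \in K by rewrite inE; split=> /=; [rewrite in_itv/= !ltW|exact: ltW].
  by have := M1 _ Kz; rewrite /Phi /= (max_l (ltW h1)) (max_l t10).
move=> /(_ loc); apply/negP; rewrite -ltNge.
have [x1E|x1n] := eqVneq x1 xs.
  by rewrite x1E; exact: power_operator_center_gt0.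
have r0 : 0 < sqnorm (x1 - xs) by rewrite sqnorm_gt0// subr_eq0.
apply: power_operator_gt0 => //; apply: small => //; first by rewrite t10.
apply: le_trans (sqnorm_le_norm _) _; apply: ler_wpM2l => //.
by rewrite distrC; apply: lerXn2r; rewrite ?nnegrE// ltW.
Unshelve. all: by end_near. Qed.

End propagation.

(** * The barrier *)

Section barrier_function.
Variables (R : realType) (N : nat) (p H k l0 : R).
Hypotheses (p2 : 2 < p) (l00 : 0 < l0) (l0p : l0 <= (4 * p)^-1) (k0 : 0 <= k).
Local Notation gam := (gam p).
Local Notation pc := (pconj p).
Local Notation amp := (amp N p H k).
Local Notation scl := (scl N p H k).
Local Notation lam := (lam k l0).

(** The variable (|y| / rad)^pconj, with r = |y|^2; the support of the barrier
    is where it is at most 1. *)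
Definition zvar s r : R := scl s * r `^ (pc / 2).

(** Both factors are cut at 0 separately: the second one is positive wherever
    the first is, but the product is positive again for large arguments. *)
Definition barrier s r : R :=
  amp s * (Num.max (1 - zvar s r) 0 * Num.max (1 - lam s * zvar s r) 0) `^ gam.

Let gam0 : 0 < gam. Proof. exact: lt_trans (gam_gt1 p2). Qed.
Let pc0 : 0 < pc / 2. Proof. by have := pconj_gt1 p2; lra. Qed.
Let p0 : 0 < p. Proof. by move: p2; lra. Qed.

Lemma lam_bounds s : -1 < s -> 0 < lam s < 1.
Proof.
move=> s1; have D1 := den_ge1 k0 s1; have D0 := den_gt0 k0 s1.
rewrite /lam divr_gt0//= ltr_pdivrMr// mul1r; apply: lt_le_trans D1.
apply: le_lt_trans l0p _; rewrite invf_lt1; move: p2; lra.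
Qed.

Lemma zvar_ge0 s r : 0 <= zvar s r.
Proof. by rewrite mulr_ge0 ?powR_ge0// ltW// expR_gt0. Qed.

Lemma barrier_ge0 s r : 0 <= barrier s r.
Proof. by rewrite mulr_ge0 ?powR_ge0// ltW// expR_gt0. Qed.

Lemma barrier_eq0 s r : 1 <= zvar s r -> barrier s r = 0.
Proof.
move=> z1; rewrite /barrier (@max_r _ _ (1 - zvar s r)); last by lra.
by rewrite mul0r powR0 ?mulr0// gt_eqF.
Qed.

Lemma barrierE s r : -1 < s -> zvar s r < 1 ->
  barrier s r = amp s * press (lam s) (zvar s r) `^ gam.
Proof.
move=> s1 z1; have /andP[la lb] := lam_bounds s1; have z0 := zvar_ge0 s r.
have : lam s * zvar s r <= 1 * zvar s r by rewrite ler_wpM2r// ltW.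
by move=> lz; rewrite /barrier !max_l//; lra.
Qed.

Lemma barrier_le s r : -1 < s ->
  barrier s r <= amp s * Num.max (1 - zvar s r) 0 `^ gam.
Proof.
move=> s1; have /andP[la lb] := lam_bounds s1; have z0 := zvar_ge0 s r.
rewrite ler_pM2l ?expR_gt0//; apply: ge0_ler_powR; rewrite ?nnegrE ?(ltW gam0)//.
- by rewrite mulr_ge0// le_max lexx orbT.
- by rewrite le_max lexx orbT.
rewrite ler_piMr//; first by rewrite le_max lexx orbT.
rewrite ge_max ler01 andbT; have : 0 <= lam s * zvar s r by rewrite mulr_ge0// ltW.
by lra.
Qed.

Lemma barrier_le_amp s r : -1 < s -> barrier s r <= amp s.
Proof.
move=> s1; apply: le_trans (barrier_le r s1) _.
rewrite ger_pMr ?expR_gt0//; have z0 := zvar_ge0 s r.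
apply: (@le_trans _ _ (1 `^ gam)); last by rewrite powR1.
apply: ge0_ler_powR; rewrite ?nnegrE ?(ltW gam0)//.
  by rewrite le_max lexx orbT.
by rewrite ge_max ler01 andbT; lra.
Qed.

Lemma barrier_le_linear s r : -1 < s -> zvar s r <= 1 ->
  barrier s r <= amp s * (1 - zvar s r).
Proof.
move=> s1 z1; apply: le_trans (barrier_le r s1) _; have z0 := zvar_ge0 s r.
rewrite ler_pM2l ?expR_gt0// max_l; last by lra.
have [->|zn] := eqVneq (zvar s r) 1.
  by rewrite subrr powR0// gt_eqF.
apply: ge1r_powR; last exact: ltW (gam_gt1 p2).
by rewrite subr_gt0 lt_neqAle zn z1 lerBlDr lerDl z0.
Qed.

Lemma continuous_zvar (T : topologicalType) (f g : T -> R) z : -1 < f z ->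
  0 <= g z -> (forall w, 0 <= g w) -> cont_at f z -> cont_at g z ->
  cont_at (fun w => zvar (f w) (g w)) z.
Proof.
move=> fz gz g0 cf cg; apply: ca_mul.
  exact: (ca_comp (dv_continuous (dv_scl N p H k0 fz)) cf).
have -> : (fun w => g w `^ (pc / 2)) = (fun w => Num.max (g w) 0 `^ (pc / 2)).
  by apply/funext => w; rewrite max_l.
by apply: (ca_comp (h := fun s => Num.max s 0 `^ (pc / 2))) => //;
  exact: continuous_pospow.
Qed.

Lemma continuous_barrier (T : topologicalType) (f g : T -> R) z : -1 < f z ->
  0 <= g z -> (forall w, 0 <= g w) -> cont_at f z -> cont_at g z ->
  cont_at (fun w => barrier (f w) (g w)) z.
Proof.
move=> fz gz g0 cf cg; have cz := continuous_zvar fz gz g0 cf cg.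
have cm (h : T -> R) : cont_at h z -> cont_at (fun w => Num.max (h w) 0) z.
  by move=> ch; exact: (continuous_max ch (@ca_cst R _ 0 z)).
have c1 := @ca_cst R _ 1 z.
apply: ca_mul; first exact: (ca_comp (dv_continuous (dv_amp N p H k0 fz)) cf).
have -> : (fun w => (Num.max (1 - zvar (f w) (g w)) 0 *
      Num.max (1 - lam (f w) * zvar (f w) (g w)) 0) `^ gam) =
   (fun w => Num.max (Num.max (1 - zvar (f w) (g w)) 0 *
      Num.max (1 - lam (f w) * zvar (f w) (g w)) 0) 0 `^ gam).
  by apply/funext => w; rewrite (@max_l _ _ (_ * _))// mulr_ge0// le_max lexx orbT.
apply: (ca_comp (h := fun s => Num.max s 0 `^ gam)).
  exact: continuous_pospow.
apply: ca_mul; apply: cm; apply: ca_add => //; apply: ca_opp => //.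
by apply: ca_mul => //; exact: (ca_comp (dv_continuous (dv_lam l0 k0 fz)) cf).
Qed.

Lemma press_homo (l z z' : R) : 0 <= l < 1 -> 0 <= z' -> z' <= z -> z <= 1 ->
  press l z <= press l z'.
Proof.
move=> /andP[la lb] z'0 zz z1; rewrite /press.
have h : l * z' <= l * z by rewrite ler_wpM2l.
have h1 : l * z <= l by rewrite ler_piMr.
by apply: ler_pM; lra.
Qed.

(** [press] is decreasing in z, so a power of r touched from below and a power
    of [press] touched from above combine to an upper bound of the barrier. *)
Lemma barrier_le_touching s1 r1 s r :
  let P1 := press (lam s1) (zvar s1 r1) in
  0 < P1 -> 0 < r1 -> -1 < s -> r1 / 2 <= r <= 3 / 2 * r1 -> zvar s r < 1 ->
  barrier s r <=
  amp s * upper gam P1 (press (lam s) (scl s * lower (pc / 2) r1 r)).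
Proof.
move=> P1 P10 r10 sm rr z1; rewrite barrierE//.
have /andP[la lb] := lam_bounds sm; have z0 := zvar_ge0 s r.
have lz : lam s * zvar s r <= 1 * zvar s r by rewrite ler_wpM2r// ltW.
rewrite ler_pM2l ?expR_gt0//.
apply: (@le_trans _ _ (upper gam P1 (press (lam s) (zvar s r)))).
  apply: powR_le_upper; rewrite ?(ltW gam0)//.
  by rewrite /press mulr_gt0//; lra.
apply: upper_homo; rewrite ?(ltW gam0)//.
apply: press_homo; rewrite ?(ltW z1) ?la ?lb ?(ltW la)//.
  by rewrite mulr_ge0// ltW// ?lower_gt0 ?expR_gt0.
rewrite /zvar ler_pM2l ?expR_gt0//.
by apply: lower_le_powR; rewrite ?(ltW pc0).
Qed.

(** Since gam > 1, the barrier is o(h) along a curve that leaves from a point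
    where it vanishes. *)
Lemma barrier_edge_flat (s1 ds b c r1 C : R) :
  -1 < s1 -> 0 < r1 -> 1 <= zvar s1 r1 -> 0 <= C ->
  (forall h, 0 < h < 1 -> 0 <= r1 + (b * h + c * h ^+ 2)) ->
  (forall h, 0 < h < 1 ->
     h * C <= barrier (s1 + ds * h) (r1 + (b * h + c * h ^+ 2))) ->
  C = 0.
Proof.
move=> sm r10 z1 C0 rpos HC; apply/eqP; rewrite eq_le C0 andbT.
pose rh h := r1 + (b * h + c * h ^+ 2).
pose sh h := s1 + ds * h.
have drh : has_deriv rh 0 b.
  apply: dv_eq.
    apply: dv_add; first exact: dv_cst.
    apply: dv_add; first by apply: dv_mul; [exact: dv_cst|exact: dv_id].
    by apply: dv_mul; [exact: dv_cst|apply: dv_exp; exact: dv_id].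
  by rewrite /=; ring.
have dsh : has_deriv sh 0 ds.
  apply: dv_eq.
    apply: dv_add; first exact: dv_cst.
    by apply: dv_mul; [exact: dv_cst|exact: dv_id].
  by rewrite /=; ring.
have rh0 : rh 0 = r1 by rewrite /rh; ring.
have sh0 : sh 0 = s1 by rewrite /sh; ring.
have [dz Dz] : exists d, has_deriv (fun h => zvar (sh h) (rh h)) 0 d.
  eexists; apply: dv_mul.
    by apply: dv_comp; [rewrite sh0; exact: dv_scl|exact: dsh].
  by apply: dv_powR; [rewrite rh0|exact: drh].
have camp : {for 0, continuous (fun h => amp (sh h))}.
  apply: (ca_comp (h := amp)); last exact: dv_continuous dsh.
  by rewrite sh0; exact: dv_continuous (dv_amp _ _ _ k0 sm).
(* difference quotient bound *)
have [Dd De] := Dz.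
have Lq : h^-1 *: (zvar (sh (h *: 1 + 0)) (rh (h *: 1 + 0)) - zvar (sh 0) (rh 0))
    @[h --> (0 : R)^'] --> dz.
  by rewrite -De; exact: Dd.
pose M := `|dz| + 1.
have M0 : 0 < M by rewrite ltr_wpDl.
apply/ler_addgt0Pr => eps eps0; rewrite add0r.
pose A1 := amp s1 + 1.
have A10 : 0 < A1 by rewrite addr_gt0// expR_gt0.
have key : \forall h \near (0 : R)^'+,
    [/\ 0 < h < 1, A1 * (M `^ gam * h `^ (gam - 1)) < eps,
     amp (sh h) <= A1, -1 < sh h & 1 - zvar (sh h) (rh h) <= M * h].
  near=> h.
  have h0 : 0 < h by near: h; exact: nbhs_right_gt.
  split => //.
  - by rewrite h0; near: h; apply: nbhs_right_lt.
  - have : h `^ (gam - 1) < eps / (A1 * M `^ gam).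
      apply: powR_lt_root; rewrite ?ltW//.
      + by rewrite subr_gt0 gam_gt1.
      + by rewrite divr_gt0// mulr_gt0// powR_gt0.
      near: h; apply: nbhs_right_lt.
      by rewrite powR_gt0// divr_gt0// mulr_gt0// powR_gt0.
    by rewrite ltr_pdivlMr ?mulr_gt0 ?powR_gt0// mulrC mulrA.
  - apply: ltW; near: h.
    have : amp (sh h) @[h --> (0 : R)^'+] --> amp s1.
      by rewrite -sh0; apply: cvg_at_right_filter; exact: camp.
    by move/cvgr_lt; apply; rewrite ltrDl.
  - near: h.
    have : sh h @[h --> (0 : R)^'+] --> s1.
      by rewrite -[in X in _ --> X]sh0; apply: cvg_at_right_filter;
        exact: dv_continuous dsh.
    by move/cvgr_gt; apply.
  - have Lh : `|h^-1 * (zvar (sh h) (rh h) - zvar s1 r1)| <= M.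
      have -> : h^-1 * (zvar (sh h) (rh h) - zvar s1 r1) =
          h^-1 *: (zvar (sh (h *: 1 + 0)) (rh (h *: 1 + 0)) - zvar (sh 0) (rh 0)).
        by rewrite sh0 rh0 addr0 /GRing.scale /= mulr1.
      near: h; apply: (cvgr_le _ (cvg_norm (cvg_dnbhs_at_right Lq))).
      by rewrite /M ltrDl.
    move: Lh; rewrite normrM gtr0_norm ?invr_gt0// ler_pdivrMl// mulrC => Lh.
    have := ler_norm (- (zvar (sh h) (rh h) - zvar s1 r1)); rewrite normrN.
    by lra.
have [h [hh he hA hs hz]] : exists h, [/\ 0 < h < 1,
   A1 * (M `^ gam * h `^ (gam - 1)) < eps, amp (sh h) <= A1, -1 < sh h &
   1 - zvar (sh h) (rh h) <= M * h].
  exact: filter_ex key.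
have /andP[h0 _] := hh.
have := le_trans (HC h hh) (barrier_le _ hs); rewrite -/(rh h) -/(sh h) => hC.
have b1 : amp (sh h) * Num.max (1 - zvar (sh h) (rh h)) 0 `^ gam <=
    A1 * (M * h) `^ gam.
  apply: ler_pM; rewrite ?powR_ge0 ?(ltW (expR_gt0 _))//.
  apply: ge0_ler_powR; rewrite ?nnegrE ?(ltW gam0)//.
  - by rewrite le_max lexx orbT.
  - by rewrite mulr_ge0 ?ltW.
  - by rewrite ge_max hz mulr_ge0 ?ltW.
have b2 : A1 * (M * h) `^ gam = h * (A1 * (M `^ gam * h `^ (gam - 1))).
  rewrite powRM ?ltW// -(@mulr_powRB1 _ h gam) ?ltW//; ring.
have : h * C <= h * (A1 * (M `^ gam * h `^ (gam - 1))).
  by rewrite -b2; exact: le_trans hC b1.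
rewrite ler_pM2l// => ?; apply: ltW; exact: le_lt_trans he.
Unshelve. all: by end_near. Qed.

End barrier_function.

(** * Comparison with the barrier by doubling of variables *)

Section comparison.
Variables (R : realType) (N : nat) (p H k l0 : R).
Hypotheses (p2 : 2 < p) (l00 : 0 < l0) (l0p : l0 <= (4 * p)^-1)
  (kE : k = l0 / (4 * p * (N%:R + 1))) (hN : (1 <= N)%N).
Local Notation q := (qstar N p).
Local Notation gam := (gam p).
Local Notation pc := (pconj p).
Local Notation amp := (amp N p H k).
Local Notation scl := (scl N p H k).
Local Notation lam := (lam k l0).
Local Notation W := (barrier N p H k l0).
Local Notation Zv := (zvar N p H k).

Hypothesis supersolution : forall L z : R, 1 <= L -> 0 < z < 1 ->
  0 < drift p N%:R (l0 / L) z + absorption_const N p H / eta N p / L *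
   (press (l0 / L) z `^ ((gam - 1) * (q - 1)) * slope (l0 / L) z `^ q *
    z `^ (q / p)).

Let k0 : 0 <= k.
Proof.
rewrite kE divr_ge0 ?(ltW l00)// mulr_ge0 ?addr_ge0//; move: p2; lra.
Qed.

Lemma barrier_at0 s : -1 < s -> W s 0 = amp s.
Proof.
move=> s1; have z0 : Zv s 0 = 0.
  by rewrite /zvar powR0 ?mulr0// gt_eqF//; have := pconj_gt1 p2; lra.
rewrite barrierE// z0//.
by rewrite /press subr0 mulr0 subr0 mulr1 powR1 mulr1.
Qed.

(** At the center the barrier has a peak of order |y|^pconj with pconj < 2, so
    no paraboloid touches it there from below. *)
Lemma barrier_peak s e : -1 < s -> 0 < e ->
  ~ (forall h, 0 < h < 1 -> amp s <= W s (h ^+ 2) + h ^+ 2 / e).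
Proof.
move=> s1 e0 Hh; have c1 := pconj_gt1 p2; have c2 := pconj_lt2 p2.
have A0 : 0 < amp s by exact: expR_gt0.
have S0 : 0 < scl s by exact: expR_gt0.
have [h [hh hs hA]] : exists h : R, [/\ 0 < h < 1, scl s * h `^ pc < 1 &
    h `^ (2 - pc) < amp s * scl s * e].
  apply: (@filter_ex _ ((0 : R)^'+)); near=> h.
  have h0 : 0 < h by near: h; exact: nbhs_right_gt.
  split.
  - by rewrite h0; near: h; exact: nbhs_right_lt.
  - have : h `^ pc < (scl s)^-1.
      apply: powR_lt_root; rewrite ?(ltW h0) ?invr_gt0//; first by lra.
      by near: h; apply: nbhs_right_lt; rewrite powR_gt0// invr_gt0.
    by rewrite -(ltr_pM2l S0) divff// gt_eqF.
  - apply: powR_lt_root; rewrite ?(ltW h0) ?mulr_gt0//; first by lra.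
    by near: h; apply: nbhs_right_lt; rewrite powR_gt0// !mulr_gt0.
have /andP[h0 h1] := hh.
have zE : Zv s (h ^+ 2) = scl s * h `^ pc.
  rewrite /zvar -powR_mulrn ?ltW// -powRrM.
  by congr (_ * _ `^ _); field.
have := Hh h hh.
have zh : Zv s (h ^+ 2) <= 1 by rewrite zE ltW.
have := barrier_le_linear p2 l00 l0p k0 s1 zh; rewrite zE => hb hp.
have hph : h `^ pc * h `^ (2 - pc) = h ^+ 2.
  rewrite -powRD; last by rewrite (gt_eqF h0) implybT.
  have -> : pc + (2 - pc) = 2%:R by ring.
  by rewrite powR_mulrn// ltW.
have : amp s * scl s * h `^ pc <= h ^+ 2 / e by move: hb hp; lra.
rewrite ler_pdivlMr// -hph => hc.
have : amp s * scl s * e * h `^ pc <= h `^ (2 - pc) * h `^ pc by move: hc; lra.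
rewrite ler_pM2r ?powR_gt0// => hc'.
by have := lt_le_trans hA hc'; rewrite ltxx.
Unshelve. all: by end_near. Qed.

(** The test function of the points where the barrier vanishes. *)
Section paraboloid.
Variables (B T : R) (n : nat) (e s1 : R).

Let g t r := pen B T n t + (r + (t - s1) ^+ 2) / e.
Let gt (t r : R) := pen1 B T n t + 2 * (t - s1) / e.
Let g1 (t r : R) := e^-1.
Let g2 (t r : R) : R := 0.

Lemma profile_paraboloid : profile g gt g1 g2.
Proof.
split.
- move=> t r _; apply: dv_eq.
    apply: dv_add; first exact: dv_pen.
    apply: dv_mul; last exact: dv_cst.
    apply: dv_add; first exact: dv_cst.
    by apply: dv_exp; apply: dv_add; [exact: dv_id|exact: dv_cst].
  by rewrite /gt /=; ring.
- move=> t r _; apply: dv_eq.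
    apply: dv_add; first exact: dv_cst.
    apply: dv_mul; last exact: dv_cst.
    by apply: dv_add; [exact: dv_id|exact: dv_cst].
  by rewrite /g1 /=; ring.
- by move=> t r _; exact: dv_cst.
- move=> z z0; have c x := @ca_cst R _ x z.
  have c1 : cont_at (fun v : R * R => v.1) z by exact: cvg_fst.
  have c2 : cont_at (fun v : R * R => v.2) z by exact: cvg_snd.
  have cp : cont_at (fun v : R * R => pen B T n v.1) z.
    exact: (ca_comp (dv_continuous (dv_pen B T n z.1)) c1).
  have cp1 : cont_at (fun v : R * R => pen1 B T n v.1) z.
    exact: (ca_comp (continuous_pen1 (x := z.1)) c1).
  split; [|  |exact: c|exact: c].
  + exact: (ca_add cp (ca_mul (ca_add c2 (ca_exp (n := 2) (ca_add c1 (c _)))) (c _))).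
  + exact: (ca_add cp1 (ca_mul (ca_mul (c _) (ca_add c1 (c _))) (c _))).
Qed.

End paraboloid.

Lemma sqnormN (x : 'rV[R]_N) : sqnorm (- x) = sqnorm x.
Proof. by rewrite /sqnorm; apply: eq_bigr => i _; rewrite mxE sqrrN. Qed.

Lemma sqnorm_lt_norm (x : 'rV[R]_N) a : 0 <= a -> sqnorm x < a ^+ 2 -> `|x| < a.
Proof.
move=> a0 xa; rewrite -(@ltr_pXn2r _ 2)// ?nnegrE//.
exact: le_lt_trans (sqr_norm_le_sqnorm x) xa.
Qed.

(** Moving y towards x by the fraction h multiplies the quadratic term c by (1 -
    h)^2; at a maximum point the barrier has to absorb the gain. *)
Lemma segment_gain (h c w a b : R) : 0 < h < 1 -> 0 <= c ->
  a - w - b - (1 - h) ^+ 2 * c <= a - 0 - b - c -> h * c <= w.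
Proof.
move=> /andP[h0 h1] c0 H1.
have hh : h ^+ 2 <= h by rewrite expr2 ler_piMr// ltW.
have : h * c <= (2 * h - h ^+ 2) * c by apply: ler_wpM2r => //; lra.
by lra.
Qed.

Lemma maximum_transfer (a a1 w w1 v v1 b c : R) : w + v <= b ->
  a - w - v - c <= a1 - w1 - v1 - c -> a - b <= a1 - (w1 + v1).
Proof. by lra. Qed.

Section doubling.
Variables (u : R -> 'rV[R]_N -> R).
Hypothesis vu : viscosity_subsolution p q u.

(** The barrier is not C^2 at the center, nor across the boundary of its
    support, so the touching argument is run for u(t,x) - W(s,y) with a
    quadratic penalty on (t,x) - (s,y), where x and y may settle at different
    points. Where W vanishes it is flat, so the penalty must be 0 at the maximum
    point, and there u is touched by a paraboloid, whose operator is the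
    positive derivative of [pen]. The center is excluded by the peak. At any
    other point the translate of W is touched from above by a smooth function,
    which touches u as well and is a strict supersolution. *)
Lemma no_doubled_maximum B T n e R1 t1 s1 (x1 y1 : 'rV[R]_N) :
  0 < B -> 0 < T -> (0 < n)%N -> 0 < e -> 0 < t1 -> t1 < T ->
  - (1 / 2) < s1 -> s1 < T + 1 / 2 -> -1 <= s1 - t1 -> `|x1| < R1 -> `|y1| < R1 + 1 ->
  (forall t x s y, 0 <= t -> t <= T -> `|x| <= R1 -> - (1 / 2) <= s -> s <= T + 1 ->
     `|y| <= R1 + 1 ->
     u t x - W s (sqnorm y) - pen B T n t - (sqnorm (x - y) + (t - s) ^+ 2) / e <=
     u t1 x1 - W s1 (sqnorm y1) - pen B T n t1 -
       (sqnorm (x1 - y1) + (t1 - s1) ^+ 2) / e) ->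
  False.
Proof.
move=> B0 T0 n0 e0 t10 t1T s1l s1u d1 x1R y1R M.
have s1m : -1 < s1 by lra.
set Q := sqnorm (x1 - y1) + (t1 - s1) ^+ 2 in M.
have Q0 : 0 <= Q by rewrite addr_ge0 ?sqnorm_ge0 ?sqr_ge0.
have [z1|z1] := leP 1 (Zv s1 (sqnorm y1)).
  (* The barrier vanishes at y1: compare along the segment from y1 to x1. *)
  have r10 : 0 < sqnorm y1.
    rewrite lt_neqAle sqnorm_ge0 andbT eq_sym; apply/eqP => r0; move: z1.
    rewrite /zvar r0 powR0 ?mulr0 ?ler10//.
    by rewrite gt_eqF//; have := pconj_gt1 p2; lra.
  have W0 : W s1 (sqnorm y1) = 0 by exact: barrier_eq0.
  pose b := \sum_(i < N) 2 * y1 0 i * (x1 - y1) 0 i.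
  have sqE h : sqnorm (y1 + h *: (x1 - y1)) =
      sqnorm y1 + (b * h + sqnorm (x1 - y1) * h ^+ 2).
    rewrite /sqnorm /b mulr_suml mulr_suml -!big_split/=; apply: eq_bigr => i _.
    by rewrite !mxE; ring.
  have Qe : Q / e = 0.
    have Qe0 : 0 <= Q / e by rewrite divr_ge0// ltW.
    apply: (barrier_edge_flat p2 l00 l0p k0 (ds := t1 - s1) (b := b)
      (c := sqnorm (x1 - y1)) s1m r10 z1 Qe0).
      by move=> h _; rewrite -sqE sqnorm_ge0.
    move=> h /andP[h0 h1]; rewrite -sqE.
    pose yh := y1 + h *: (x1 - y1); pose sh := s1 + (t1 - s1) * h.
    have yhE : yh = (1 - h) *: y1 + h *: x1.
      by rewrite /yh scalerBr scalerBl scale1r addrA addrAC.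
    have yhR : `|yh| <= R1 + 1.
      rewrite yhE; apply: le_trans (ler_normD _ _) _; rewrite !normrZ.
      rewrite (@gtr0_norm _ h)// gtr0_norm; last by lra.
      have : (1 - h) * `|y1| <= (1 - h) * (R1 + 1) by rewrite ler_wpM2l//; lra.
      have : h * `|x1| <= h * (R1 + 1) by rewrite ler_wpM2l//; lra.
      by lra.
    have hs : sh = (1 - h) * s1 + h * t1 by rewrite /sh; ring.
    have h1' : 0 <= 1 - h by lra.
    have shl : - (1 / 2) <= sh.
      rewrite hs; have : 0 <= h * t1 by rewrite mulr_ge0// ltW.
      have : (1 - h) * - (1 / 2) <= (1 - h) * s1 by rewrite ler_wpM2l// ltW.
      by lra.
    have shu : sh <= T + 1.
      rewrite hs.
      have : (1 - h) * s1 <= (1 - h) * (T + 1) by rewrite ler_wpM2l//; lra.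
      have : h * t1 <= h * (T + 1) by rewrite ler_wpM2l//; lra.
      by lra.
    have := M t1 x1 sh yh (ltW t10) (ltW t1T) (ltW x1R) shl shu yhR.
    have -> : sqnorm (x1 - yh) + (t1 - sh) ^+ 2 = (1 - h) ^+ 2 * Q.
      have -> : x1 - yh = (1 - h) *: (x1 - y1).
        by rewrite /yh scalerBl scale1r opprD addrA.
      rewrite /Q mulrDr /sqnorm mulr_sumr; congr (_ + _).
        by apply: eq_bigr => i _; rewrite !mxE; ring.
      by rewrite /sh; ring.
    rewrite W0 -/sh -/yh => HM.
    by move: HM; rewrite -mulrA; apply: segment_gain; rewrite ?h0.
  have {Qe} Qe : Q = 0.
    by apply/eqP; move/eqP: Qe; rewrite mulf_eq0 invr_eq0 (gt_eqF e0) orbF.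
  have h1 := sqnorm_ge0 (x1 - y1); have h2 := sqr_ge0 (t1 - s1).
  have x1E : x1 = y1.
    apply/eqP; rewrite -subr_eq0; apply: contraT => /sqnorm_gt0.
    by move: Qe; rewrite /Q; lra.
  have t1E : t1 = s1.
    apply/eqP; rewrite -subr_eq0 -sqrf_eq0; apply/eqP.
    by move: Qe; rewrite /Q; lra.
  have C := C12_radial y1 (profile_paraboloid B T n e s1).
  have := vu C t10 (x := x1).
  have loc : \forall z \near (t1, x1), u z.1 z.2 -
      (pen B T n z.1 + (sqnorm (z.2 - y1) + (z.1 - s1) ^+ 2) / e) <=
      u t1 x1 - (pen B T n t1 + (sqnorm (x1 - y1) + (t1 - s1) ^+ 2) / e).
    near=> z.
    have [a1 a2 a3] : [/\ 0 < z.1, z.1 < T & `|0 - z.2| < R1].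
      by near: z; apply: near_cylinder; rewrite ?sub0r ?normrN.
    rewrite sub0r normrN in a3.
    have := M z.1 z.2 s1 y1 (ltW a1) (ltW a2) (ltW a3); rewrite /Q.
    have b1 : - (1 / 2) <= s1 by lra.
    have b2 : s1 <= T + 1 by lra.
    by move=> /(_ b1 b2 (ltW y1R)); lra.
  move=> /(_ loc); apply/negP; rewrite -ltNge x1E.
  rewrite (pde_operator_radial_center _ (profile_paraboloid B T n e s1))//.
    by rewrite t1E subrr mulr0 mul0r addr0 -t1E pen1_gt0.
  by rewrite gt_eqF// (lt_trans ltr01 (qstar_gt1 N p2)).
(* The maximum is at the center: averaging over y = v and y = - v removes the
   linear term of the penalty. *)
have [y1E|y1n] := eqVneq y1 0.
  apply: (barrier_peak s1m e0) => h /andP[h0 h1].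
  have i0 : 'I_N by exact: (Ordinal hN).
  pose v : 'rV[R]_N := h *: Defs.basis R i0.
  have sv x : sqnorm (v + x) = sqnorm x + (2 * x 0 i0 * h + h ^+ 2).
    exact: sqnorm_basis.
  have sqv : sqnorm v = h ^+ 2.
    by rewrite -[v]addr0 sv sqnorm0 mxE mulr0 mul0r !add0r.
  have nv : `|v| <= R1 + 1.
    have vh : `|v| <= h.
      rewrite -(@ler_pXn2r _ 2)// ?nnegrE ?(ltW h0)//.
      by rewrite -sqv sqr_norm_le_sqnorm.
    by have := normr_ge0 x1; lra.
  have nv' : `|- v| <= R1 + 1 by rewrite normrN.
  have b1 : - (1 / 2) <= s1 by lra.
  have b2 : s1 <= T + 1 by lra.
  have := M t1 x1 s1 v (ltW t10) (ltW t1T) (ltW x1R) b1 b2 nv.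
  have := M t1 x1 s1 (- v) (ltW t10) (ltW t1T) (ltW x1R) b1 b2 nv'.
  rewrite sqnormN sqv y1E sqnorm0 barrier_at0// /Q y1E subr0 opprK.
  have -> : sqnorm (x1 - v) = sqnorm x1 + (2 * (- x1) 0 i0 * h + h ^+ 2).
    by rewrite -sqnormN opprB sv sqnormN.
  by rewrite [x1 + v]addrC sv mxE; lra.
(* The translation by (d, c) takes (s1, y1) to (t1, x1) and makes the penalty
   constant. *)
pose d := s1 - t1; pose c := x1 - y1; pose r1 := sqnorm y1.
have r10 : 0 < r1 by exact: sqnorm_gt0.
have xc : x1 - c = y1 by rewrite /c opprB addrC subrK.
have dpen t (_ : 0 < t) := dv_pen B T n t.
have cpen t (_ : 0 < t) : {for t, continuous (pen1 B T n)}.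
  exact: continuous_pen1.
have pen10 : 0 <= pen1 B T n t1 by rewrite ltW// pen1_gt0.
have prof := profile_barrier_test p2 l00 l0p kE s1m d1 r10 dpen cpen z1.
have C := C12_radial c prof.
have := vu C t10 (x := x1).
have op := barrier_operator_gt0 p2 l00 l0p kE hN supersolution s1m t10 d1 r10
  dpen cpen pen10 z1 (x := x1) (c := c).
rewrite xc in op.
have P0 := barrier_press_gt0 p2 l00 l0p kE s1m z1.
set bt := barrier_test _ _ _ _ _ _ _ _ _ in C prof op *.
have loc : \forall z \near (t1, x1), u z.1 z.2 - bt z.1 (sqnorm (z.2 - c)) <=
    u t1 x1 - bt t1 (sqnorm (x1 - c)).
  have cs : cont_at (fun z : R * 'rV[R]_N => z.1 + d) (t1, x1).
    by apply: ca_add; [exact: cvg_fst|exact: ca_cst].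
  have cr : cont_at (fun z : R * 'rV[R]_N => sqnorm (z.2 - c)) (t1, x1).
    exact: continuous_sqnorm_pair.
  have cy : cont_at (fun z : R * 'rV[R]_N => `|z.2 - c|) (t1, x1).
    by apply: cvg_norm; apply: cvgB; [exact: cvg_snd|exact: cvg_cst].
  have sE : t1 + d = s1 by rewrite /d addrC subrK.
  have czv : cont_at (fun z : R * 'rV[R]_N => Zv (z.1 + d) (sqnorm (z.2 - c)))
      (t1, x1).
    apply: (continuous_zvar p2 k0) => //=; rewrite ?sE//; try exact: sqnorm_ge0.
    by move=> w; exact: sqnorm_ge0.
  have cs' : (fun z : R * 'rV[R]_N => z.1 + d) @ (t1, x1) --> s1.
    by rewrite -[in X in _ --> X]sE; exact: cs.
  have cr' : (fun z : R * 'rV[R]_N => sqnorm (z.2 - c)) @ (t1, x1) --> r1.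
    by rewrite /r1 -xc; exact: cr.
  have cy' : (fun z : R * 'rV[R]_N => `|z.2 - c|) @ (t1, x1) --> `|y1|.
    by rewrite -xc; exact: cy.
  have czv' : (fun z : R * 'rV[R]_N => Zv (z.1 + d) (sqnorm (z.2 - c))) @ (t1, x1)
       --> Zv s1 r1.
    by rewrite /r1 -xc -sE; exact: czv.
  near=> z.
  have [a1 a2 a3] : [/\ 0 < z.1, z.1 < T & `|0 - z.2| < R1].
    by near: z; apply: near_cylinder; rewrite ?sub0r ?normrN.
  rewrite sub0r normrN in a3.
  have b1 : - (1 / 2) < z.1 + d by near: z; exact: (cvgr_gt _ cs').
  have b2 : z.1 + d < T + 1.
    by near: z; apply: (cvgr_lt _ cs'); lra.
  have b3 : `|z.2 - c| < R1 + 1 by near: z; exact: (cvgr_lt _ cy').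
  have b4 : r1 / 2 < sqnorm (z.2 - c).
    by near: z; apply: (cvgr_gt _ cr'); lra.
  have b5 : sqnorm (z.2 - c) < 3 / 2 * r1.
    by near: z; apply: (cvgr_lt _ cr'); lra.
  have b6 : Zv (z.1 + d) (sqnorm (z.2 - c)) < 1.
    by near: z; exact: (cvgr_lt _ czv').
  have Mz := M z.1 z.2 (z.1 + d) (z.2 - c) (ltW a1) (ltW a2) (ltW a3) (ltW b1)
    (ltW b2) (ltW b3); move: Mz.
  have -> : z.2 - (z.2 - c) = x1 - y1 by rewrite opprB addrC subrK.
  have -> : z.1 - (z.1 + d) = t1 - s1 by rewrite /d; ring.
  have tb : W (z.1 + d) (sqnorm (z.2 - c)) + pen B T n z.1 <=
      bt z.1 (sqnorm (z.2 - c)).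
    rewrite /bt /barrier_test /composite lerD2r.
    have sm : -1 < z.1 + d by apply: lt_trans b1; rewrite ltrN2 ltr_pdivrMr// mul1r ltr1n.
    have rr : r1 / 2 <= sqnorm (z.2 - c) <= 3 / 2 * r1 by rewrite !ltW.
    exact: (barrier_le_touching p2 l00 l0p k0 P0 r10 sm rr b6).
  have te : bt t1 (sqnorm (x1 - c)) = W s1 (sqnorm y1) + pen B T n t1.
    by rewrite (barrierE p2 l00 l0p k0 s1m z1) xc; exact: barrier_test_at.
  by rewrite te -/Q; exact: maximum_transfer.
by move=> /(_ loc); apply/negP; rewrite -ltNge op.
Unshelve. all: by end_near. Qed.

End doubling.

End comparison.

Section projections.
Context {X A B : topologicalType}.
Implicit Types (f : X -> A * B) (z : X).

Lemma continuous_pr1 f z : {for z, continuous f} ->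
  {for z, continuous (fun w => (f w).1)}.
Proof. by move=> cf; apply: (cvg_comp _ _ cf); exact: cvg_fst. Qed.

Lemma continuous_pr2 f z : {for z, continuous f} ->
  {for z, continuous (fun w => (f w).2)}.
Proof. by move=> cf; apply: (cvg_comp _ _ cf); exact: cvg_snd. Qed.

Lemma continuous_after (C : topologicalType) (g : A -> C) (f : X -> A) z :
  {for f z, continuous g} -> {for z, continuous f} ->
  {for z, continuous (fun w => g (f w))}.
Proof. by move=> cg cf; exact: (cvg_comp _ _ cf cg). Qed.

End projections.

Section comparison.
Variables (R : realType) (N : nat) (p H k l0 : R).
Hypotheses (p2 : 2 < p) (l00 : 0 < l0) (l0p : l0 <= (4 * p)^-1)
  (kE : k = l0 / (4 * p * (N%:R + 1))) (hN : (1 <= N)%N).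
Local Notation q := (qstar N p).
Local Notation gam := (gam p).
Local Notation pc := (pconj p).
Local Notation amp := (amp N p H k).
Local Notation scl := (scl N p H k).
Local Notation lam := (lam k l0).
Local Notation W := (barrier N p H k l0).
Local Notation Zv := (zvar N p H k).

Hypothesis supersolution : forall L z : R, 1 <= L -> 0 < z < 1 ->
  0 < drift p N%:R (l0 / L) z + absorption_const N p H / eta N p / L *
   (press (l0 / L) z `^ ((gam - 1) * (q - 1)) * slope (l0 / L) z `^ q *
    z `^ (q / p)).

Let k0 : 0 <= k.
Proof.
rewrite kE divr_ge0 ?(ltW l00)// mulr_ge0 ?addr_ge0//; move: p2; lra.
Qed.

Section principle.
Variables (u : R -> 'rV[R]_N -> R).
Hypotheses (bu : bounded_continuous u) (u0 : forall t x, 0 <= t -> 0 <= u t x)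
  (vu : viscosity_subsolution p q u)
  (ini : forall s x y, `|s| < 1 / 2 -> `|x - y| < 1 / 2 ->
     u 0 x <= W s (sqnorm y)).

Section functional.
Variables (B T e : R) (n : nat).

Let Z : Type := ((R * 'rV[R]_N) * (R * 'rV[R]_N))%type.

Definition doubled (z : (R * 'rV[R]_N) * (R * 'rV[R]_N)) : R :=
  u (Num.max z.1.1 0) z.1.2 - W z.2.1 (sqnorm z.2.2) - pen B T n z.1.1
  - (sqnorm (z.1.2 - z.2.2) + (z.1.1 - z.2.1) ^+ 2) / e.

Lemma continuous_doubled z : -1 < z.2.1 -> {for z, continuous doubled}.
Proof.
move=> s1; have c r := @ca_cst R _ r z.
have cz : {for z, continuous (fun z : Z => z)} by exact: cvg_id.
have c1 := continuous_pr1 cz; have c2 := continuous_pr2 cz.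
have c11 : cont_at (fun z : Z => z.1.1) z := continuous_pr1 c1.
have c12 := continuous_pr2 c1; have c22 := continuous_pr2 c2.
have c21 : cont_at (fun z : Z => z.2.1) z := continuous_pr1 c2.
have cs (f : Z -> 'rV[R]_N) : {for z, continuous f} ->
    cont_at (fun z => sqnorm (f z)) z.
  move=> cf; apply: continuous_after cf.
  by have := @continuous_sqnorm R N 0 (f z); under eq_fun do rewrite subr0.
have cu := continuous_after (continuous_clip bu (x := z.1)) c1.
have cW : cont_at (fun z : Z => W z.2.1 (sqnorm z.2.2)) z.
  refine (@continuous_barrier R N p H k l0 p2 k0 Z (fun z => z.2.1)
    (fun z => sqnorm z.2.2) z s1 (sqnorm_ge0 _) _ c21 (cs _ c22)).
  by move=> w; exact: sqnorm_ge0.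
have cp : cont_at (fun z : Z => pen B T n z.1.1) z.
  exact: (ca_comp (f := fun z : Z => z.1.1) (dv_continuous (dv_pen B T n z.1.1)) c11).
have cd : cont_at (fun z : Z => sqnorm (z.1.2 - z.2.2)) z.
  by apply: cs; exact: (cvgB c12 c22).
have ct : cont_at (fun z : Z => (z.1.1 - z.2.1) ^+ 2) z.
  exact: (ca_exp (n := 2) (ca_add c11 (ca_opp c21))).
exact: (ca_add (ca_add (ca_add cu (ca_opp cW)) (ca_opp cp))
  (ca_opp (ca_mul (ca_add cd ct) (c _)))).
Qed.

End functional.

Lemma gap_bound (a w v Q e B : R) : 0 < e -> 0 <= w -> 0 <= v -> a <= B ->
  0 < a - w - v - Q / e -> Q < B * e.
Proof. by move=> e0 w0 v0 aB h; rewrite -ltr_pdivrMr//; lra. Qed.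

Lemma gap_upper (a w v Q : R) : 0 <= w -> 0 <= v -> 0 <= Q ->
  0 < a - w - v - Q -> w < a /\ v < a.
Proof. by move=> w0 v0 Q0 h; split; lra. Qed.

(** A maximum point of the doubled functional exists on a compact set, by finite
    propagation it is interior in x, and the initial condition, assumed with
    some room in time and space, excludes t = 0. *)
Lemma barrier_comparison R0 : (forall x, R0 < `|x| -> u 0 x = 0) ->
  forall t x, 0 <= t -> u t x <= W t (sqnorm x).
Proof.
move=> ini0 ts xs ts0; rewrite leNgt; apply/negP => gap.
have [_ [Mu HMu]] := bu.
pose B := `|Mu| + 1; have B0 : 0 < B by rewrite ltr_wpDl.
have uB t x : 0 <= t -> u t x <= B.
  move=> t0; apply: le_trans (ler_norm _) _; apply: le_trans (HMu _ _ t0) _.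
  by apply: le_trans (ler_norm _) _; rewrite lerDl.
pose T := ts + 1; have tsT : ts < T by rewrite ltrDl.
have T0 : 0 < T by exact: le_lt_trans tsT.
have gap0 : 0 < u ts xs - W ts (sqnorm xs) by rewrite subr_gt0.
have [n n0 pn] := penalisation_small B ts0 tsT gap0.
have qn : q != 0 by rewrite gt_eqF// (lt_trans ltr01 (qstar_gt1 N p2)).
have [Rp HR] := finite_propagation p2 qn bu uB B0 u0 vu ini0 T0.
pose R1 := Num.max Rp `|xs| + 1.
have RpR : Rp < R1.
  by apply: (@le_lt_trans _ _ (Num.max Rp `|xs|)); rewrite ?le_max ?lexx// ltrDl.
have xsR : `|xs| < R1.
  by apply: (@le_lt_trans _ _ (Num.max Rp `|xs|)); rewrite ?le_max ?lexx ?orbT// ltrDl.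
have R10 : 0 < R1 by exact: le_lt_trans xsR.
have R1R : R1 < R1 + 1 by rewrite ltrDl.
have R110 : 0 < R1 + 1 by exact: lt_trans R1R.
(* The value is positive and u <= B, so this penalty keeps the points at distance
   less than 1/2. *)
pose e := (4 * B)^-1; have e0 : 0 < e by rewrite invr_gt0 mulr_gt0.
have Be : B * e = (1 / 2) ^+ 2 by rewrite /e; field; rewrite gt_eqF.
pose K := (`[0, T]%classic `*` [set x : 'rV[R]_N | `|0 - x| <= R1]) `*`
  (`[- (1 / 2), T + 1]%classic `*` [set x : 'rV[R]_N | `|0 - x| <= R1 + 1]).
have cK : compact K.
  by apply: compact_setX; apply: compact_setX;
    do ?[exact: segment_compact|exact: compact_sup_ball].
have half0 : - (1 / 2) < 0 :> R by rewrite oppr_lt0 divr_gt0.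
have half1 : -1 < - (1 / 2) :> R by rewrite ltrN2 ltr_pdivrMr// mul1r ltr1n.
have Ks : K ((ts, xs), (ts, xs)).
  split=> /=; split=> /=; rewrite ?in_itv/= ?sub0r ?normrN ?ts0 ?(ltW tsT) ?(ltW xsR)//.
    rewrite (ltW (lt_le_trans half0 ts0))/=; apply: ltW; apply: lt_trans tsT _.
    by rewrite ltrDl.
  exact: ltW (lt_trans xsR R1R).
have cont : {within K, continuous (doubled B T e n)}.
  apply: continuous_in_subspaceT => z; rewrite inE => -[_ [/=]].
  rewrite in_itv/= => /andP[z1 _] _; apply: continuous_doubled.
  exact: lt_le_trans z1.
have [[[t1 x1] [s1 y1]] K1 M1] := compact_EVT_max (ex_intro _ _ Ks) cK cont.
move: K1; rewrite inE => -[[/=]]; rewrite !in_itv/= => /andP[t10 t1T].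
rewrite sub0r normrN => x1R [/= /andP[s1l s1u]]; rewrite sub0r normrN => y1R.
have P0 : 0 < doubled B T e n ((t1, x1), (s1, y1)).
  apply: lt_le_trans (M1 ((ts, xs), (ts, xs)) _); last by rewrite inE.
  rewrite /doubled /= !subrr sqnorm0 expr0n/= addr0 mul0r subr0 max_l// subr_gt0.
  exact: pn.
move: (P0); rewrite /doubled /= (max_l t10) => P1.
pose Q := sqnorm (x1 - y1) + (t1 - s1) ^+ 2.
have W1 : 0 <= W s1 (sqnorm y1) by exact: barrier_ge0.
have pt1 : 0 <= pen B T n t1 by apply: pen_ge0 => //; exact: ltW.
have Q1 : Q < (1 / 2) ^+ 2.
  by rewrite -Be; exact: (gap_bound e0 W1 pt1 (uB t1 x1 t10) P1).
have Qe : 0 <= Q / e by rewrite divr_ge0 ?(ltW e0)// addr_ge0 ?sqnorm_ge0 ?sqr_ge0.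
have [wu vu'] := gap_upper W1 pt1 Qe P1.
have half : 0 <= 1 / 2 :> R by rewrite divr_ge0.
have xy : `|x1 - y1| < 1 / 2.
  apply: sqnorm_lt_norm => //; apply: le_lt_trans Q1.
  by rewrite lerDl sqr_ge0.
have tsd : `|t1 - s1| < 1 / 2.
  rewrite -(@ltr_pXn2r _ 2)// ?nnegrE// real_normK ?num_real//.
  by apply: le_lt_trans Q1; rewrite lerDr sqnorm_ge0.
have t1p : 0 < t1.
  rewrite lt_neqAle t10 andbT; apply/eqP => t1E.
  move: wu; apply/negP; rewrite -leNgt -t1E; apply: ini => //.
  by move: tsd; rewrite -t1E sub0r normrN.
have t1lt : t1 < T.
  rewrite lt_neqAle t1T andbT; apply/eqP => t1E.
  by move: vu'; apply/negP; rewrite -leNgt t1E pen_end// uB// ltW.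
have x1lt : `|x1| < R1.
  rewrite ltNge; apply/negP => x1g; move: wu; apply/negP; rewrite -leNgt.
  by rewrite HR// ?t10 ?t1T//; exact: lt_le_trans x1g.
have [sa sb] : - (1 / 2) < s1 - t1 /\ s1 - t1 < 1 / 2.
  by apply/andP; rewrite -ltr_norml distrC.
have s1l' : - (1 / 2) < s1 by apply: lt_trans sa _; rewrite ltrBlDr ltrDl.
have s1u' : s1 < T + 1 / 2.
  by rewrite -ltrBlDl; apply: lt_trans sb; rewrite ltrD2l ltrN2.
have d1 : -1 <= s1 - t1 by apply: ltW; exact: lt_trans half1 sa.
have y1lt : `|y1| < R1 + 1.
  have -> : y1 = x1 - (x1 - y1) by rewrite opprB addrC subrK.
  apply: le_lt_trans (ler_normB _ _) _; apply: ltrD => //.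
  by apply: lt_trans xy _; rewrite ltr_pdivrMr// mul1r ltr1n.
apply: (no_doubled_maximum p2 l00 l0p kE hN supersolution vu B0 T0 n0 e0 t1p
  t1lt s1l' s1u' d1 x1lt y1lt) => t x s y h1 h2 h3 h4 h5 h6.
have := M1 ((t, x), (s, y)); rewrite inE /doubled /= (max_l h1) (max_l t10).
apply; split=> /=; split=> /=; rewrite ?in_itv/= ?sub0r ?normrN//.
  by rewrite h1.
by rewrite h4.
Qed.

End principle.

End comparison.

(** * Integrals and supports *)

Section integral_bound.
Context d (X : measurableType d) (R : realType).
Variable mu : {measure set X -> \bar R}.

(** Monotonicity holds for the supremum over simple functions that defines the
    integral, so u(t) need not be shown to be measurable. *)
Lemma ge0_le_integral_raw (f g : X -> \bar R) : (forall x, 0 <= f x)%E ->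
  (forall x, f x <= g x)%E -> (\int[mu]_x f x <= \int[mu]_x g x)%E.
Proof.
move=> f0 fg; have g0 x : (0 <= g x)%E by exact: le_trans (fg x).
rewrite !ge0_integralE// !patch_setT.
apply: ereal_sup_le => _ [h hf <-]; exists h => // x.
exact: le_trans (hf x) (fg x).
Qed.

End integral_bound.

Section euclidean_norm.
Variables (R : realType) (N : nat).
Implicit Types (f : 'rV[R]_N -> R) (x : 'rV[R]_N).

Lemma sqr_enorm x : enorm x ^+ 2 = sqnorm x.
Proof. by rewrite sqr_sqrtr// sqnorm_ge0. Qed.

Lemma coord_le_enorm x i : `|x 0 i| <= enorm x.
Proof.
rewrite -sqrtr_sqr ler_wsqrtr// (bigD1 i)//= lerDl.
by apply: sumr_ge0 => j _; exact: sqr_ge0.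
Qed.

Lemma L1norm_le f a rho : 0 <= rho -> (forall x, 0 <= f x <= a) ->
  (forall x, rho < enorm x -> f x = 0) ->
  (L1norm f <= (a * (2 * rho) ^+ N)%:E)%E.
Proof.
move=> rho0 fa fr; rewrite /L1norm Lnorm1.
pose A : set (N.-tuple (measurableTypeR R)) :=
  [set v | forall i, `[- rho, rho]%classic (tnth v i)].
have mA : measurable A.
  rewrite (_ : A = \bigcap_(i in [set: 'I_N])
    ((fun v : N.-tuple (measurableTypeR R) => tnth v i) @^-1` `[- rho, rho])).
    apply: fin_bigcap_measurable => // i _.
    rewrite -[X in measurable X]setTI; apply: measurable_tnth => //.
  by apply/seteqP; split=> v /= Av i; [move=> _|]; apply: Av.
have a0 : 0 <= a by have /andP[h1 h2] := fa 0; exact: le_trans h2.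
apply: (@le_trans _ _ (\int[lebesgueRN R N]_v (a * \1_A v)%:E)%E).
  apply: ge0_le_integral_raw => v //=; rewrite lee_fin.
  have /andP[f0 f1] := fa (row_of_tuple v); rewrite ger0_norm//.
  have [vr|vr] := leP (enorm (row_of_tuple v)) rho.
    have Av : v \in A.
      rewrite inE => i /=; rewrite in_itv/= -ler_norml.
      have := le_trans (coord_le_enorm (row_of_tuple v) i) vr.
      by rewrite mxE.
    by rewrite indicE Av mulr1.
  by rewrite fr// mulr_ge0.
rewrite (@integralZl_indic _ _ _ _ _ _ (fun=> A))//; last by rewrite ltNge a0.
rewrite integral_indic// setIT EFinM lee_wpmul2l//.
rewrite [leLHS](@lebesgueRN_box R N (fun=> `[- rho, rho]%classic))//.
rewrite le_eqVlt; apply/orP; left; apply/eqP.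
transitivity (\prod_(i < N) (2 * rho)%:E)%E; last first.
  by rewrite prodEFin prodr_const card_ord.
apply: eq_bigr => i _; rewrite lebesgue_measure_itv/= lte_fin.
case: ltP => h; first by rewrite -EFinB; congr EFin; ring.
have -> : rho = 0 by apply/eqP; rewrite eq_le rho0 andbT; move: h; lra.
by rewrite mulr0.
Qed.

Lemma support_radius_le (u : R -> 'rV[R]_N -> R) t rho : 0 < rho ->
  (forall x, rho < enorm x -> u t x = 0) -> (support_radius u t <= rho%:E)%E.
Proof. by move=> r0 h; apply: ereal_inf_lbound; exists rho. Qed.

Lemma compact_support_bounded f : compact (supp f) ->
  exists2 r, 0 <= r & forall x, r < `|x| -> f x = 0.
Proof.
move=> /compact_bounded[M [_ HM]]; exists (`|M| + 1) => [|x xr].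
  by rewrite addr_ge0.
apply/eqP; apply: contraTT xr => fx; rewrite -leNgt.
apply: (HM (`|M| + 1)); last exact: subset_closure.
by apply: le_lt_trans (ler_norm _) _; rewrite ltrDl.
Qed.

End euclidean_norm.

(** * Size of the barrier *)

Section estimates.
Variables (R : realType) (N : nat) (p : R).
Hypotheses (p2 : 2 < p).
Local Notation n := (N%:R : R).
Local Notation et := (eta N p).
Local Notation a := (et * (p - 2) * N.+1%:R).

(** For large H both the amplitude and the radius are large on the time interval
    (-1/2, 1/2), uniformly in the small parameters l0 and k; this matters
    because these are chosen after H. *)
Lemma barrier_large K r0 : 0 < K -> 0 <= r0 ->
  exists H : R, forall l0 k s r, 0 < l0 -> l0 <= (4 * p)^-1 -> 0 <= k -> k <= 1 ->
    `|s| < 1 / 2 -> 0 <= r -> r <= r0 -> K <= barrier N p H k l0 s r.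
Proof.
move=> K0 r00; have e0 := eta_gt0 N p2.
have g1 := gam_gt1 p2; have c1 := pconj_gt1 p2.
have n0 : 0 <= n by [].
pose c := n * et * 2 + p * et * (n + 1) * 2.
pose b := (p - 2) * et * (n + 1) * 2.
pose l2 : R := ln 2; have l20 : 0 <= l2 by rewrite ln_ge0// ler1n.
pose m := ln (r0 + 1).
pose w := (p - 1) * ln (gam p * pconj p) - ln et.
pose H1 := (p * (m / 2 + l2 + b) - w) / (p - 2).
pose H2 := c + gam p * (2 * l2) + ln K.
exists (Num.max H1 H2) => l0 k s r l00 l0p k0 k1; rewrite ltr_norml => /andP[s1 s2] r0' rr.
set H := Num.max H1 H2.
have sm : -1 < s by lra.
have tau0 := tau_gt0 sm; have D1 := den_ge1 k0 sm; have D0 := den_gt0 k0 sm.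
have lt0 : 0 <= ln (2 + s) by rewrite ln_ge0//; lra.
have lt2 : ln (2 + s) <= 2.
  have -> : 2 + s = 1 + (1 + s) by ring.
  by apply: (@le_trans _ _ (1 + s)); [apply: le_ln1Dx|]; lra.
have ld0 : 0 <= ln (den k s) by rewrite ln_ge0.
have ld2 : ln (den k s) <= 2.
  rewrite /den; apply: (@le_trans _ _ (k * ln (2 + s))).
    by apply: le_ln1Dx; apply: (@lt_le_trans _ _ 0); [lra|rewrite mulr_ge0].
  by apply: le_trans lt2; rewrite ler_piMl.
have amp_ge : H - c <= lnamp N p H k s.
  rewrite /lnamp /c.
  have h1 : n * et * ln (2 + s) <= n * et * 2.
    by apply: ler_wpM2l => //; rewrite mulr_ge0// ltW.
  have h2 : p * et * (n + 1) * ln (den k s) <= p * et * (n + 1) * 2.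
    apply: ler_wpM2l => //; rewrite mulr_ge0 ?addr_ge0// mulr_ge0 ?(ltW e0)//.
    by move: p2; lra.
  by lra.
have rad_ge : ((p - 2) * H + w) / p - b <= lnrad N p H k s.
  rewrite /lnrad /rad0 /b /w.
  have h1 : 0 <= et * ln (2 + s) by rewrite mulr_ge0// ltW.
  have h2 : (p - 2) * et * (n + 1) * ln (den k s) <= (p - 2) * et * (n + 1) * 2.
    apply: ler_wpM2l => //; rewrite mulr_ge0 ?addr_ge0// mulr_ge0 ?(ltW e0)//.
    by move: p2; lra.
  by rewrite addrA; lra.
have rad_big : m / 2 + l2 <= lnrad N p H k s.
  apply: le_trans rad_ge; rewrite lerBrDr ler_pdivlMr; last by move: p2; lra.
  have : H1 <= H by rewrite /H le_max lexx.
  rewrite ler_pdivrMr; last by move: p2; lra.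
  by lra.
have m0 : 0 <= m by rewrite ln_ge0//; lra.
have zh : zvar N p H k s r <= 1 / 2.
  have -> : 1 / 2 = expR (- l2) :> R by rewrite expRN lnK ?posrE// mul1r.
  apply: (@le_trans _ _ (scl N p H k s * (r0 + 1) `^ (pconj p / 2))).
    rewrite ler_wpM2l ?expR_ge0//; apply: ge0_ler_powR; rewrite ?nnegrE; lra.
  rewrite /scl powRE_expR; last by lra.
  rewrite -expRD ler_expR -/m.
  have h : pconj p * (m / 2 + l2) <= pconj p * lnrad N p H k s.
    by rewrite ler_pM2l//; lra.
  have : l2 <= pconj p * l2 by rewrite ler_peMl// ltW.
  by lra.
have z0 := zvar_ge0 N p H k s r.
have k0' := k0.
rewrite (barrierE p2 l00 l0p k0 sm); last by lra.
have /andP[la lb] := lam_bounds p2 l00 l0p k0 sm.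
have lz : lam k l0 s * zvar N p H k s r <= 1 * zvar N p H k s r.
  by rewrite ler_wpM2r// ltW.
have pr : expR (- (2 * l2)) <= press (lam k l0 s) (zvar N p H k s r).
  have -> : expR (- (2 * l2)) = (1 / 2) * (1 / 2).
    have -> : - (2 * l2) = - l2 + - l2 by ring.
    by rewrite expRD expRN lnK ?posrE// mul1r.
  by rewrite /press; apply: ler_pM; lra.
apply: (@le_trans _ _ (expR (H - c) * expR (- (2 * l2)) `^ gam p)); last first.
  apply: ler_pM; rewrite ?expR_ge0 ?powR_ge0 ?ler_expR//.
  apply: ge0_ler_powR; rewrite ?nnegrE ?expR_ge0//; first by lra.
  by rewrite mulr_ge0; lra.
rewrite powRE_expR ?expR_gt0// expRK -expRD -[leLHS]lnK ?posrE// ler_expR.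
have : H2 <= H by rewrite /H le_max lexx orbT.
by rewrite /H2; lra.
Qed.

Variables (H k : R).
Hypotheses (k0 : 0 < k).

Lemma barrier_support l0 s r : expR (lnrad N p H k s) ^+ 2 <= r ->
  barrier N p H k l0 s r = 0.
Proof.
move=> hr; apply: barrier_eq0 => //; rewrite /zvar /scl.
have c1 := pconj_gt1 p2.
apply: (@le_trans _ _ (expR (- (pconj p * lnrad N p H k s)) *
  (expR (lnrad N p H k s) ^+ 2) `^ (pconj p / 2))).
  rewrite powRE_expR ?exprn_gt0 ?expR_gt0// -expRM_natl expRK -expRD -[leLHS]expR0.
  by rewrite ler_expR le_eqVlt; apply/orP; left; apply/eqP; field.
rewrite ler_wpM2l ?expR_ge0//; apply: ge0_ler_powR => //.
- by lra.
- by rewrite nnegrE exprn_ge0// expR_ge0.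
- by rewrite nnegrE (le_trans _ hr)// exprn_ge0// expR_ge0.
Qed.

Section positive_time.
Variable t : R.
Hypothesis t0 : 0 < t.
Let l := ln (1 + t).
Let l0 : 0 < l. Proof. by rewrite ln_gt0//; move: t0; lra. Qed.
Let k0' : 0 <= k. Proof. exact: ltW. Qed.

Lemma lnden_ge : ln k + ln l <= ln (den k t).
Proof.
rewrite -lnM ?posrE// ler_ln ?posrE ?mulr_gt0//; last first.
  by apply: den_gt0 => //; move: t0; lra.
rewrite /den; apply: (@le_trans _ _ (k * ln (2 + t))); last by rewrite lerDr.
by rewrite ler_wpM2l// ler_ln ?posrE; move: t0; lra.
Qed.

Lemma radius_decay : expR (lnrad N p H k t) <=
  expR (rad0 N p H + et * ln 2 - a * ln k) * (1 + t) `^ et * l `^ (- a).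
Proof.
have e0 := eta_gt0 N p2.
rewrite !powRE_expR//; last by move: t0; lra.
rewrite -!expRD ler_expR /lnrad -natr1.
have h1 : et * ln (2 + t) <= et * (ln 2 + ln (1 + t)).
  rewrite ler_pM2l// -lnM ?posrE//; last by move: t0; lra.
  by rewrite ler_ln ?posrE; move: t0; lra.
have h2 : (p - 2) * et * (n + 1) * (ln k + ln l) <=
          (p - 2) * et * (n + 1) * ln (den k t).
  apply: ler_wpM2l lnden_ge; rewrite mulr_ge0 ?addr_ge0// mulr_ge0 ?(ltW e0)//.
  by move: p2; lra.
rewrite -/l in h1 *; lra.
Qed.

(** The left-hand side bounds the mass of the barrier. By the choice of eta the
    powers of 2 + t cancel and the powers of the logarithm add up to N + 1. *)
Lemma mass_decay :
  amp N p H k t * (2 * expR (lnrad N p H k t)) ^+ N <=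
  2 ^+ N * expR (H + n * rad0 N p H - N.+1%:R * ln k) * l `^ (- N.+1%:R).
Proof.
rewrite exprMn mulrCA -mulrA ler_pM2l ?exprn_gt0//.
rewrite powRE_expR// -expRM_natl -!expRD ler_expR /lnamp /lnrad -natr1.
have e : et * (n * (p - 2) + p) = 1.
  by rewrite mulVf// -invr_eq0 -/et gt_eqF ?eta_gt0.
have h2 : (n + 1) * (ln k + ln l) <= (n + 1) * ln (den k t).
  by apply: ler_wpM2l lnden_ge; rewrite addr_ge0.
apply: (@le_trans _ _ (H + n * rad0 N p H -
   et * (n * (p - 2) + p) * ((n + 1) * ln (den k t)))).
  by rewrite le_eqVlt; apply/orP; left; apply/eqP; ring.
by rewrite e; lra.
Qed.

End positive_time.

End estimates.

(** * The decay estimate *)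

Theorem proposition2p1 (R : realType) (N : nat) (hN : (1 <= N)%N)
    (p : R) (hp : 2 < p) (u0 : 'rV[R]_N -> R)
    (hu0 : W1infty u0) (hu0_ge0 : forall x, 0 <= u0 x)
    (hu0_neq0 : exists x, u0 x != 0) (hu0_supp : compact (supp u0)) :
  exists C2 : R, 0 < C2 /\
    forall u : R -> 'rV[R]_N -> R,
      cauchy_solution p (qstar N p) u0 u ->
      forall t : R, 0 < t ->
        (support_radius u t <=
          (C2 * (1 + t) `^ (eta N p) *
             ln (1 + t) `^ (- (eta N p * (p - 2) * N.+1%:R)))%:E)%E /\
        (L1norm (u t) <= (C2 * ln (1 + t) `^ (- N.+1%:R))%:E)%E.
Proof.
(* One solution suffices to see that u0 is bounded. *)
have [[v [[_ [M HM]] _ _ _ v0]]|no] :=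
  pselect (exists v, cauchy_solution p (qstar N p) u0 v); last first.
  by exists 1; split=> // u su; case: no; exists u.
have [r0 r00 u0r] := compact_support_bounded hu0_supp.
pose K := `|M| + 1; have K0 : 0 < K by rewrite ltr_wpDl.
have u0K x : u0 x <= K.
  rewrite -v0; apply: le_trans (ler_norm _) _; apply: le_trans (HM 0 x _) _ => //.
  by apply: le_trans (ler_norm _) _; rewrite lerDl.
pose rho := N%:R * (r0 + 1) ^+ 2; have rho0 : 0 <= rho.
  by rewrite mulr_ge0// sqr_ge0.
(* H depends on u0 only, l0 on H, and k on l0. *)
have [H HH] := barrier_large N hp K0 rho0.
have e0 := eta_gt0 N hp; have q1 := qstar_gt1 N hp; have g1 := gam_gt1 hp.
have [l0 /andP[l00 l0p] super] := @drift_absorption_gt0 R p N%:R hp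
  (etrans (ler1n _ _) hN) (absorption_const N p H / eta N p)
  ((gam p - 1) * (qstar N p - 1)) (qstar N p) (divr_gt0 (expR_gt0 _) e0)
  (mulr_ge0 (ltW (etrans (subr_gt0 _ _) g1)) (ltW (etrans (subr_gt0 _ _) q1)))
  (ltW (lt_trans ltr01 q1)).
pose k := l0 / (4 * p * (N%:R + 1)).
have p4 : 1 < 4 * p by move: hp; lra.
have n1 : 1 <= N%:R + 1 :> R by rewrite lerDr.
have D1 : 1 <= 4 * p * (N%:R + 1).
  apply: le_trans (ltW p4) _; rewrite ler_peMr//.
  by apply: ltW; exact: lt_trans p4.
have D0 : 0 < 4 * p * (N%:R + 1) by exact: lt_le_trans D1.
have k0 : 0 < k by rewrite divr_gt0.
have k1 : k <= 1.
  rewrite ler_pdivrMr// mul1r; apply: le_trans D1; apply: le_trans l0p _.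
  by rewrite invf_le1 ?ltW//; exact: lt_trans p4.
pose A1 := expR (rad0 N p H + eta N p * ln 2 -
  eta N p * (p - 2) * N.+1%:R * ln k).
pose A2 := 2 ^+ N * expR (H + N%:R * rad0 N p H - N.+1%:R * ln k).
have A10 : 0 < A1 by exact: expR_gt0.
have A20 : 0 < A2 by rewrite mulr_gt0 ?exprn_gt0 ?expR_gt0.
exists (A1 + A2); split; first exact: addr_gt0.
move=> u [bu ug vu _ ui] t t0.
have ub x : u t x <= barrier N p H k l0 t (sqnorm x).
  have ini s (y z : 'rV[R]_N) : `|s| < 1 / 2 -> `|y - z| < 1 / 2 ->
      u 0 y <= barrier N p H k l0 s (sqnorm z).
    move=> s1 yz; have [yr|yr] := ltP r0 `|y|.
      by rewrite ui u0r// barrier_ge0.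
    rewrite ui; apply: le_trans (u0K y) _.
    apply: HH => //; rewrite ?(ltW k0) ?sqnorm_ge0//.
    apply: le_trans (sqnorm_le_norm z) _; rewrite ler_wpM2l//.
    apply: lerXn2r; rewrite ?nnegrE ?addr_ge0//.
    have -> : z = y - (y - z) by rewrite opprB addrC subrK.
    apply: le_trans (ler_normB _ _) _; apply: lerD => //; apply: ltW.
    by apply: lt_trans yz _; rewrite ltr_pdivrMr// mul1r ltr1n.
  apply: (barrier_comparison hp l00 l0p erefl hN super bu ug vu ini (R0 := r0)).
    by move=> y yr; rewrite ui u0r.
  exact: ltW.
pose X := expR (lnrad N p H k t); have X0 : 0 < X by exact: expR_gt0.
have uX x : X < enorm x -> u t x = 0.
  move=> xX; apply/eqP; rewrite eq_le (ug _ _ (ltW t0)) andbT.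
  apply: le_trans (ub x) _; rewrite barrier_support// -sqr_enorm.
  by apply: lerXn2r; rewrite ?nnegrE ?(ltW X0) ?sqrtr_ge0//; exact: ltW.
split.
  apply: le_trans (support_radius_le X0 uX) _; rewrite lee_fin.
  apply: le_trans (radius_decay N hp H k0 t0) _.
  by rewrite !ler_wpM2r ?powR_ge0// lerDl ltW.
have tm : -1 < t by apply: lt_trans t0; rewrite oppr_lt0.
have u_le x : 0 <= u t x <= amp N p H k t.
  rewrite (ug _ _ (ltW t0))/=; apply: le_trans (ub x) _.
  exact: (barrier_le_amp N H hp l00 l0p (ltW k0) _ tm).
apply: le_trans (L1norm_le (ltW X0) u_le uX) _; rewrite lee_fin.
apply: le_trans (mass_decay N hp H k0 t0) _.
by rewrite ler_wpM2r ?powR_ge0// lerDr ltW.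
Qed.
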